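(* Let $a,b>0$ be constants with $a+b<\tfrac12$. There exists $\varepsilon_0>0$ such that for every fixed $0<\varepsilon<\varepsilon_0$ the following holds. Consider data $n,\boldsymbol{s},\boldsymbol{t},H$ with $n\to\infty$ such that, uniformly over $1\le j\le n$, $s_j-s$, $x_j$, $t_j-s$ and $y_j$ are $O(n^{1/2+\varepsilon})$; $X=O(n^{1+2\varepsilon})$; and $\frac{(1-2\lambda)^2}{3A}\le a\log n$. Then \[ |\mathcal{D}(\boldsymbol{s},\boldsymbol{t},H)|=\binom{n^2-X-n}{\lambda n^2}^{-1}\prod_{j=1}^n\binom{n-x_j-1}{s_j}\binom{n-y_j-1}{t_j}\exp\Bigl(-\frac12\Bigl(1-\frac{R}{2An^2}\Bigr)\Bigl(1-\frac{C}{2An^2}\Bigr)-\frac{Y+\sum_{j=1}^n(s_j-s)(t_j-s)}{2An^2}+O(n^{-b})\Bigr). \]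
   Context: A simple digraph has no loops and no multiple arcs (arcs $w_jw_k$ and $w_kw_j$ may both be present). Let $\boldsymbol{s}=(s_1,\dots,s_n)$, $\boldsymbol{t}=(t_1,\dots,t_n)$ be vectors of positive integers with equal sums. $\mathcal{D}(\boldsymbol{s},\boldsymbol{t})$ is the set of simple digraphs on vertices $\{w_1,\dots,w_n\}$ in which $w_j$ has out-degree $s_j$ and in-degree $t_j$ for all $j$. $H$ is a fixed simple digraph on the same vertices; $x_j$, $y_j$ are the out-degree and in-degree of $w_j$ in $H$. $\mathcal{D}(\boldsymbol{s},\boldsymbol{t},H)$ is the set of digraphs in $\mathcal{D}(\boldsymbol{s},\boldsymbol{t})$ that are arc-disjoint from $H$. Define $s=n^{-1}\sum_js_j$ $(=n^{-1}\sum_jt_j)$, $\lambda=s/n$, $A=\tfrac12\lambda(1-\lambda)$, $\delta_j=s_j-s+\lambda x_j$, $\eta_j=t_j-s+\lambda y_j$, $X=\sum_jx_j$ (the number of arcs of $H$), $Y=\sum_{w_jw_k\in E(H)}\delta_j\eta_k$ (sum over arcs $w_j\to w_k$ of $H$), $R=\sum_j(s_j-s)^2$, $C=\sum_j(t_j-s)^2$. Asymptotic notation refers to $n\to\infty$. *)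

(* Defs.v *)
From mathcomp Require Import all_boot all_order all_algebra.
From mathcomp Require Import all_classical all_reals all_analysis.

Set Implicit Arguments.
Unset Strict Implicit.
Unset Printing Implicit Defensive.
Import Order.TTheory GRing.Theory Num.Theory.

Definition digraph (n : nat) := {set 'I_n * 'I_n}.

(* simple: no loops (multiple arcs are impossible with a set of arcs) *)
Definition simple_digraph n (G : digraph n) : bool :=
  [forall j : 'I_n, (j, j) \notin G].

Definition outdeg n (G : digraph n) (j : 'I_n) : nat := #|[set k | (j, k) \in G]|.
Definition indeg n (G : digraph n) (j : 'I_n) : nat := #|[set k | (k, j) \in G]|.

Definition Dset n (s t : 'I_n -> nat) (H : digraph n) : {set digraph n} :=
  [set G : digraph n | [&& simple_digraph G,
      [forall j, outdeg G j == s j], [forall j, indeg G j == t j] &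
      [disjoint G & H]]].

Local Open Scope ring_scope.

Section Params.
Variables (R : realType) (n : nat) (s t : 'I_n -> nat) (H : digraph n).

Definition sbar : R := (\sum_j s j)%N%:R / n%:R.
Definition lam : R := sbar / n%:R.
Definition Acst : R := lam * (1 - lam) / 2.
Definition xdeg (j : 'I_n) : nat := outdeg H j.
Definition ydeg (j : 'I_n) : nat := indeg H j.
Definition delta (j : 'I_n) : R := (s j)%:R - sbar + lam * (xdeg j)%:R.
Definition eta (j : 'I_n) : R := (t j)%:R - sbar + lam * (ydeg j)%:R.
Definition Xarcs : nat := (\sum_j xdeg j)%N.
Definition Ysum : R := \sum_(e in H) delta e.1 * eta e.2.
Definition Rsum : R := \sum_j ((s j)%:R - sbar) ^+ 2.
Definition Csum : R := \sum_j ((t j)%:R - sbar) ^+ 2.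
Definition STsum : R := \sum_j ((s j)%:R - sbar) * ((t j)%:R - sbar).

Definition formula (d : R) : R :=
  ('C(n ^ 2 - Xarcs - n, \sum_j s j)%:R)^-1 *
  (\prod_j ('C(n - xdeg j - 1, s j)%:R * 'C(n - ydeg j - 1, t j)%:R)) *
  expR (- (1/2) * (1 - Rsum / (2 * Acst * n%:R ^+ 2))
                * (1 - Csum / (2 * Acst * n%:R ^+ 2))
        - (Ysum + STsum) / (2 * Acst * n%:R ^+ 2) + d).
End Params.

(* Main.v *)
(** A digraph avoiding H is a 0-1 matrix with row sums s and column sums t that
    vanishes on H and on the diagonal.  Writing N(s,t,H) for the number of such
    matrices, moving an entry of row a down its column to row b gives an exact
    formula for N(s+e_b,t,H) / N(s+e_a,t,H), and counting the pairs (matrix,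
    move) gives exact linear relations between the probabilities P(a,k) that
    the cell (a,k) is occupied.  Conditioning on a cell being occupied or empty
    stays inside the class of models, so errors can be bootstrapped: an estimate
    of P to relative order n^(-k/2) improves the ratios, which improves P, until
    P is known up to O(n^(-3/2)) and, when H is empty, the ratios are known up
    to O(n^(-2)); this last step needs the fourth moment of the number of common
    columns of two rows.  Hence N(s,t,0) divided by the expected formula is
    constant, up to a factor 1 + o(1), over all s and t in a box of side
    n^(1/2+eps).  The constant is found by summing over the box: almost all
    matrices with m ones have row and column sums in it, by binomial tail bounds.
    Finally H and the diagonal are inserted cell by cell, each cell multiplying
    N by 1 - P.  All errors have the form nu^c z^k with z = n^(-1/2) and nu a
    power n^(eps) dominating log n and 1 / (lambda (1 - lambda)). *)

Require Import Defs.
From mathcomp Require Import all_boot all_order all_algebra.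
From mathcomp Require Import ring lra zify.

Set Implicit Arguments.
Unset Strict Implicit.
Unset Printing Implicit Defensive.
Import Order.TTheory GRing.Theory Num.Theory.
Local Open Scope ring_scope.

(** Two step counts dictate the precision. Joining two vectors of row sums inside the box takes up
    to about n^(3/2) unit moves, so the ratio of a move is needed to O(n^(-2)); inserting H and the
    diagonal takes about n^(1+2 eps) cells, so P is needed to O(n^(-3/2)). Either way a total of
    order n^(-1/2) is left, times fewer than 3000 powers of nu, and eps0 = (1/2 - b) / 3000 pays for
    these. The obstacle is the denominator D of the move formula, the number of moves leading back:
    where it is small, 1/D cannot be expanded around the mean of D. A switching on four cells shows
    that raising D by one at least doubles the number of graphs while D stays below n / (32 nu). So
    D below n / (64 nu) has probability at most z^10, and elsewhere moments of D suffice. The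
    constant is a bare binomial because for typical degree vectors R and C are close to 2An^2: both
    brackets in the exponential are then nearly 0, and the formula summed over typical pairs factors
    into two sums of binomial products. The hypothesis with a log n serves to bound 1 / (lambda (1 -
    lambda)) by nu. *)

Module OrderBounds.

(** * Calculus of error bounds in powers of [nu] and [z] *)

Definition ob (R : realFieldType) (nu z : R) (k : int) (c : nat) (x : R) : Prop :=
  `|x| <= nu ^+ c * z ^ k.

(** So [z] is n^(-1/2). Thanks to [2 <= nu], one extra power of [nu] pays for adding two bounds, and
    about log2 m powers pay for a numeral m, so that no constants have to be tracked. *)
Record scale (R : realFieldType) (n : nat) (nu z : R) : Prop := Scale {
  scale_nu : 2 <= nu; scale_z0 : 0 < z; scale_z1 : z <= 1;
  scale_n : n%:R * z ^+ 2 = 1 }.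

Section Ob.
Variables (R : realFieldType) (n : nat) (nu z : R).
Hypothesis sc : scale n nu z.
Local Notation ob := (ob nu z).
Implicit Types (x y : R) (k : int) (c : nat).

Let nu2 : 2 <= nu. Proof. exact: scale_nu sc. Qed.
Let z0 : 0 < z. Proof. exact: scale_z0 sc. Qed.
Let z1 : z <= 1. Proof. exact: scale_z1 sc. Qed.
Let nu1 : 1 <= nu. Proof. by have := nu2; lra. Qed.
Let nu0 : 0 < nu. Proof. exact: lt_le_trans ltr01 nu1. Qed.

Lemma ob_rhs_gt0 k c : 0 < nu ^+ c * z ^ k.
Proof. by rewrite mulr_gt0 ?exprn_gt0 // exprz_gt0. Qed.

Lemma ob_le k c x k' c' : ob k c x -> (k' <= k)%R -> (c <= c')%N -> ob k' c' x.
Proof.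
move=> h hk hc; apply: le_trans h _.
apply: ler_pM.
- by rewrite exprn_ge0 // ltW.
- by rewrite exprz_ge0 // ltW.
- exact: ler_weXn2l.
- have h1 : 0 <= k - k' by rewrite subr_ge0.
  have -> : k = k' + (k - k') by lia.
  case: (k - k') h1 => // m _; rewrite exprzDr ?unitfE ?gt_eqF //.
  by rewrite ger_pMr ?exprz_gt0 // -exprnP exprn_ile1 // ltW.
Qed.

Definition imin k1 k2 : int := if (k1 <= k2)%R then k1 else k2.

Lemma obD k1 c1 k2 c2 x y :
  ob k1 c1 x -> ob k2 c2 y -> ob (imin k1 k2) (maxn c1 c2).+1 (x + y).
Proof.
move=> hx hy; apply: le_trans (ler_normD _ _) _.
have hx' : ob (imin k1 k2) (maxn c1 c2) x.
  by apply: ob_le hx _ _; rewrite ?leq_maxl // /imin; case: ifP; lia.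
have hy' : ob (imin k1 k2) (maxn c1 c2) y.
  by apply: ob_le hy _ _; rewrite ?leq_maxr // /imin; case: ifP; lia.
apply: le_trans (lerD hx' hy') _.
rewrite -mulr2n -mulr_natl mulrA exprS ler_wpM2r ?exprz_ge0 ?(ltW z0) //.
by rewrite ler_wpM2r // exprn_ge0 // ltW.
Qed.

Lemma obN k c x : ob k c x -> ob k c (- x).
Proof. by rewrite /ob normrN. Qed.

Lemma obB k1 c1 k2 c2 x y :
  ob k1 c1 x -> ob k2 c2 y -> ob (imin k1 k2) (maxn c1 c2).+1 (x - y).
Proof. by move=> hx /obN; apply: obD. Qed.

Lemma obM k1 c1 k2 c2 x y :
  ob k1 c1 x -> ob k2 c2 y -> ob (k1 + k2) (c1 + c2) (x * y).
Proof.
move=> hx hy; rewrite /ob normrM exprD exprzDr ?unitfE ?gt_eqF //.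
by rewrite mulrACA; apply: ler_pM.
Qed.

Lemma obX k c x m : ob k c x -> ob (k * m%:Z) (c * m) (x ^+ m).
Proof.
move=> hx; rewrite /ob normrX exprM -exprz_exp -exprnP -exprMn.
by apply: lerXn2r; rewrite ?nnegrE ?normr_ge0 // ltW // ob_rhs_gt0.
Qed.

Lemma ob0 k : ob k 0 0.
Proof. by rewrite /ob normr0 ltW // ob_rhs_gt0. Qed.

Lemma ob1 : ob 0 0 1.
Proof. by rewrite /ob normr1 expr0 expr0z mulr1. Qed.

Lemma ob_nat m : ob 0 (up_log 2 m) m%:R.
Proof.
rewrite /ob expr0z mulr1 normr_nat.
apply: (@le_trans _ _ ((2 ^ up_log 2 m)%N%:R)).
  by rewrite ler_nat up_logP.
by rewrite natrX; apply: lerXn2r nu2; rewrite nnegrE // ltW.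
Qed.

Lemma ob_nat_c m c : (up_log 2 m <= c)%N -> ob 0 c m%:R.
Proof. exact: ob_le (ob_nat m) _. Qed.

Lemma ob_unit x : `|x| <= 1 -> ob 0 0 x.
Proof. by rewrite /ob expr0 expr0z mulr1. Qed.

Lemma ob_bool (b : bool) : ob 0 0 b%:R.
Proof. by apply: ob_unit; case: b; rewrite ?normr1 ?normr0. Qed.

Lemma ob_z : ob 1 0 z.
Proof. by rewrite /ob expr0 mul1r expr1z gtr0_norm. Qed.

Lemma ob_zi : ob (-1) 0 z^-1.
Proof. by rewrite /ob expr0 mul1r exprN1 gtr0_norm ?invr_gt0. Qed.

Lemma ob_n : ob (-2) 0 n%:R.
Proof.
rewrite /ob normr_nat expr0 mul1r; change (z ^ (-2)) with (z ^- 2).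
have h : z ^+ 2 != 0 by rewrite expf_neq0 // gt_eqF.
by rewrite -[X in X <= _](mulfK h) (scale_n sc) mul1r.
Qed.

Lemma ob_nu : ob 0 1 nu.
Proof. by rewrite /ob expr1 expr0z mulr1 gtr0_norm. Qed.

Lemma ob_sum (I : finType) (P : pred I) (F : I -> R) k c :
  (#|I| <= n)%N -> (forall i, P i -> ob k c (F i)) -> ob (k - 2) c (\sum_(i | P i) F i).
Proof.
move=> hI hF; apply: le_trans (ler_norm_sum _ _ _) _.
apply: le_trans (ler_sum _ hF) _.
rewrite sumr_const -(mulr_natr (nu ^+ c * z ^ k)) exprzDr ?unitfE ?gt_eqF // [X in _ <= X]mulrA.
apply: ler_wpM2l; first exact/ltW/ob_rhs_gt0.
have := ob_n; rewrite /ob expr0 mul1r normr_nat; apply: le_trans.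
by rewrite ler_nat (leq_trans (max_card _)).
Qed.

Lemma ob_sum_le (I : finType) (P : pred I) (F G : I -> R) k c :
  (forall i, P i -> `|F i| <= G i) -> ob k c (\sum_(i | P i) G i) ->
  ob k c (\sum_(i | P i) F i).
Proof.
move=> hF; apply: le_trans; apply: le_trans (ler_norm_sum _ _ _) _.
by apply: le_trans (ler_sum _ hF) (ler_norm _).
Qed.

Lemma ob_abs k c x : ob k c x -> ob k c `|x|.
Proof. by rewrite /ob normr_id. Qed.

Lemma ob_of_le k c x y : `|x| <= y -> ob k c y -> ob k c x.
Proof. by move=> h /(le_trans (ler_norm _)); apply: le_trans h. Qed.

Lemma ob_small (e : nat) k c x : nu ^+ e * z <= 1 -> ob k c x -> (c <= e)%N -> 1 <= k -> `|x| <= 1.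
Proof.
move=> sm h hc hk; apply: le_trans (ob_le h hk hc) _.
by rewrite expr1z.
Qed.

Lemma ob_inv k c x : nu ^- c * z ^ k <= `|x| -> ob (- k) c x^-1.
Proof.
move=> h; rewrite /ob normfV -invr_expz -(invrK (nu ^+ c)) -invfM.
have h0 : 0 < nu ^- c * z ^ k by rewrite mulr_gt0 ?invr_gt0 ?exprn_gt0 // exprz_gt0.
by rewrite lef_pV2 ?posrE // (lt_le_trans h0).
Qed.
End Ob.

Arguments ob_small {R n nu z} sc e {k c x}.

(** The exponents are existential variables, computed while the expression is traversed; [obt] then
    compares them with the claimed exponents by evaluation. An order estimate thereby reduces to
    writing the error as an explicit polynomial in quantities that are already bounded. *)
Ltac obr :=
  lazymatch goal with
  | sc : scale ?n ?nu ?z |- ob _ _ _ _ ?e =>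
    first
    [ match goal with
      | H : ob _ _ _ _ e |- _ => exact H end
    | constr_eq e z; eapply (ob_z sc)
    | constr_eq e nu; eapply (ob_nu sc)
    | constr_eq e (z^-1)%R; eapply (ob_zi sc)
    | lazymatch e with
      | 0%R => eapply (ob0 sc 50)
      | 1%R => eapply ob1
      | (nat_of_bool _)%:R => eapply ob_bool
      | ?m%:R => first [constr_eq m n; eapply (ob_n sc) | let c := eval vm_compute in (up_log 2 m) in eapply (ob_nat_c sc (m := m) (c := c)); vm_compute; reflexivity]
      | ?x - ?y => eapply (obB sc); [obr | obr]
      | ?x + ?y => eapply (obD sc); [obr | obr]
      | - ?x => eapply (obN (x:=x)); obr
      | ?x * ?y => eapply (obM sc); [obr | obr]
      | ?x ^+ ?m => eapply (obX sc); obr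
      | \sum_(i | _) _ => eapply (ob_sum sc); [by rewrite ?card_ord | let i := fresh "i" in let h := fresh "h" in intros i h; cbv beta; obr]
      end
    | match goal with
      | H : context [ob _ _ _ _ _] |- _ => solve [simple eapply H; first [eassumption | trivial]]
      end
    | solve [eauto 3 with ob nocore] ]
  end.
Ltac obt :=
  lazymatch goal with
  | sc : scale ?n ?nu ?z |- ob _ _ _ _ _ =>
    eapply (ob_le sc); [obr | vm_compute; reflexivity | vm_compute; reflexivity]
  end.

(** For exponents of [z] that contain a variable [k], known from [hk] to be 1 or 2; the exponent of
    [nu] stays symbolic. *)
Ltac obt2 hk :=
  lazymatch goal with
  | sc : scale ?n ?nu ?z |- ob _ _ _ _ _ =>
    eapply (ob_le sc); [obr | clear - hk; case: hk => ->; vm_compute; reflexivity | lia]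
  end.

(* [lia] translates every hypothesis; only the [leq] ones matter here. *)
Ltac small_lia :=
  repeat match goal with
  | H : ?P |- _ => lazymatch P with is_true (leq _ _) => fail | nat => fail | _ => clear H end
  end; lia.

End OrderBounds.
Import OrderBounds.

(** * Graphs with prescribed degrees, and conditioning on one cell *)

Module Conditioning.

Section Graphs.
Variables (R : realFieldType) (n : nat).
Local Notation cell := ('I_n * 'I_n)%type.
Implicit Types (G H : {set cell}) (c : cell) (a b k l : 'I_n).

Definition indc G c : R := (c \in G)%:R.
Definition rd G a : R := \sum_k indc G (a, k).
Definition cd G k : R := \sum_a indc G (a, k).

(** Degrees are real numbers and the two totals need not agree: an inconsistent model just has no
    graphs. Degrees can therefore be lowered without side conditions. *)
Record model := Mod { ms : 'I_n -> R; mt : 'I_n -> R; mH : {set cell} }.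
Implicit Types (M U : model).

Definition gs M : {set {set cell}} :=
  [set G : {set cell} | [&& [forall a, rd G a == ms M a],
     [forall k, cd G k == mt M k] & [disjoint G & mH M]]].

Lemma gsP M G : reflect [/\ forall a, rd G a = ms M a,
  forall k, cd G k = mt M k & forall c, c \in G -> c \notin mH M] (G \in gs M).
Proof.
rewrite inE disjoint_subset; apply: (iffP and3P) => -[h1 h2 h3]; split=> //.
- by move=> a; apply/eqP/(forallP h1).
- by move=> a; apply/eqP/(forallP h2).
- exact/subsetP.
- by apply/forallP => a; apply/eqP.
- by apply/forallP => a; apply/eqP.
- exact/subsetP.
Qed.

Definition decf (f : 'I_n -> R) a := fun j => f j - (j == a)%:R.
Definition incf (f : 'I_n -> R) a := fun j => f j + (j == a)%:R.
(** [rem c M] results from conditioning on [c] occupied: the point is deleted and its cell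
    forbidden. [fb c M] results from conditioning on [c] empty. In [mv a U] only a row sum is
    raised, so the base model [U] has one row point too few. *)
Definition rem c M := Mod (decf (ms M) c.1) (decf (mt M) c.2) (c |: mH M).
Definition fb c M := Mod (ms M) (mt M) (c |: mH M).
Definition mv a M := Mod (incf (ms M) a) (mt M) (mH M).

Lemma ind_ge0 G c : 0 <= indc G c. Proof. exact: ler0n. Qed.
Lemma ind_le1 G c : indc G c <= 1. Proof. by rewrite /indc; case: (_ \in _). Qed.

Lemma ind_add c0 G c : c0 \notin G -> indc (c0 |: G) c = indc G c + (c == c0)%:R.
Proof.
move=> h; rewrite /indc in_setU1; case: eqP => [->|_] /=; last by rewrite addr0.
by rewrite (negbTE h) add0r.
Qed.


Lemma sum_eqr (j : 'I_n) : \sum_k ((k == j)%:R : R) = 1.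
Proof. by rewrite (bigD1 j) //= eqxx big1 ?addr0 // => i /negbTE ->. Qed.

Lemma sum_pair_r (c : cell) a : \sum_k (((a, k) == c)%:R : R) = (a == c.1)%:R.
Proof.
case: c => b l; have [->|ne] := eqVneq a b; rewrite /= ?eqxx.
  rewrite -[RHS](sum_eqr l); apply: eq_bigr => k _.
  by rewrite xpair_eqE eqxx.
by rewrite big1 ?(negbTE ne) // => k _; rewrite xpair_eqE (negbTE ne).
Qed.

Lemma sum_pair_c (c : cell) k : \sum_a (((a, k) == c)%:R : R) = (k == c.2)%:R.
Proof.
case: c => b l; have [->|ne] := eqVneq k l; rewrite /= ?eqxx.
  rewrite -[RHS](sum_eqr b); apply: eq_bigr => a _.
  by rewrite xpair_eqE eqxx andbT.
by rewrite big1 ?(negbTE ne) // => a _; rewrite xpair_eqE (negbTE ne) andbF.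
Qed.

Lemma rd_add c G a : c \notin G -> rd (c |: G) a = rd G a + (a == c.1)%:R.
Proof.
move=> h; rewrite /rd -sum_pair_r -big_split; apply: eq_bigr => k _.
exact: ind_add.
Qed.

Lemma cd_add c G k : c \notin G -> cd (c |: G) k = cd G k + (k == c.2)%:R.
Proof.
move=> h; rewrite /cd -sum_pair_c -big_split; apply: eq_bigr => a _.
exact: ind_add.
Qed.




Lemma gs_notin M G c : G \in gs M -> c \in mH M -> c \notin G.
Proof. by move=> /gsP[_ _ d] h; apply/negP => /d; rewrite h. Qed.

Lemma gs_rem M c G : c \notin mH M -> c \notin G ->
  (c |: G \in gs M) = (G \in gs (rem c M)).
Proof.
move=> cH cG; apply/gsP/gsP => /= -[h1 h2 h3]; split.
- by move=> a; rewrite /decf -h1 rd_add // addrK.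
- by move=> a; rewrite /decf -h2 cd_add // addrK.
- move=> e eG; rewrite in_setU1 negb_or h3 ?in_setU1 ?eG ?orbT // andbT.
  by apply: contraNneq cG => <-.
- by move=> a; rewrite rd_add // h1 subrK.
- by move=> a; rewrite cd_add // h2 subrK.
- move=> e; rewrite in_setU1 => /orP[/eqP -> //|/h3].
  by rewrite in_setU1 negb_or => /andP[].
Qed.

Lemma gs_fb M c G : (G \in gs (fb c M)) = (G \in gs M) && (c \notin G).
Proof.
apply/gsP/andP => /= [[h1 h2 h3]|[/gsP[h1 h2 h3] cG]].
- split; first by apply/gsP; split=> // e /h3; rewrite in_setU1 negb_or => /andP[].
  by apply/negP => /h3; rewrite setU11.
- split=> // e eG; rewrite in_setU1 negb_or h3 // andbT.
  by apply: contraNneq cG => <-.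
Qed.

(** Deleting [c] is a bijection from the graphs that contain [c] onto the graphs of [rem c M]. *)
Lemma sum_rem M c (g : {set cell} -> R) : c \notin mH M ->
  \sum_(G in gs M) indc G c * g G = \sum_(G in gs (rem c M)) g (c |: G).
Proof.
move=> cH; rewrite (bigID (fun G => c \in G)) /= [X in _ + X]big1 ?addr0; last first.
  by move=> G /andP[_ h]; rewrite /indc (negbTE h) mul0r.
rewrite (reindex_onto (fun G => c |: G) (fun G => G :\ c)) /=; last first.
  by move=> G /andP[_ h]; rewrite setD1K.
apply: eq_big => [G|G /andP[/andP[_ h] _]]; last by rewrite /indc h mul1r.
rewrite setU11 andbT; apply/andP/idP => [[h /eqP e]|h].
  by rewrite -gs_rem // -e in_setD1 eqxx.
have cG : c \notin G by apply: gs_notin h _; rewrite setU11.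
by rewrite gs_rem //; split=> //; rewrite setU1K.
Qed.

Lemma sum_fb M c (g : {set cell} -> R) :
  \sum_(G in gs M) (1 - indc G c) * g G = \sum_(G in gs (fb c M)) g G.
Proof.
rewrite (bigID (fun G => c \in G)) /= big1 ?add0r; last first.
  by move=> G /andP[_ h]; rewrite /indc h subrr mul0r.
apply: eq_big => [G|G /andP[_ h]]; first by rewrite gs_fb.
by rewrite /indc (negbTE h) subr0 mul1r.
Qed.

(* [#|gs M|%:R = 0] gives the junk value [ex M g = 0]. *)
Definition ex M (g : {set cell} -> R) := (\sum_(G in gs M) g G) / #|gs M|%:R.
Definition pr M c := ex M (indc^~ c).
Definition nz M := (0 < #|gs M|)%N.
Definition Nb M : R := #|gs M|%:R.

Lemma Nb_sum M : Nb M = \sum_(G in gs M) 1.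
Proof. by rewrite sumr_const. Qed.

Lemma Nb_ge0 M : 0 <= Nb M. Proof. exact: ler0n. Qed.

Lemma Nb_gt0 M : nz M -> 0 < Nb M. Proof. by rewrite ltr0n. Qed.

Lemma Nb_eq0 M : ~~ nz M -> Nb M = 0.
Proof. by rewrite /nz -leqNgt leqn0 => /eqP e; rewrite /Nb e. Qed.

Lemma eq_ex M g1 g2 : (forall G, G \in gs M -> g1 G = g2 G) -> ex M g1 = ex M g2.
Proof. by move=> h; rewrite /ex (eq_bigr g2). Qed.

Lemma exD M g1 g2 : ex M (fun G => g1 G + g2 G) = ex M g1 + ex M g2.
Proof. by rewrite /ex big_split mulrDl. Qed.

Lemma exZ M x g : ex M (fun G => x * g G) = x * ex M g.
Proof. by rewrite /ex -mulr_sumr mulrA. Qed.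

Lemma exN M g : ex M (fun G => - g G) = - ex M g.
Proof. by rewrite /ex sumrN mulNr. Qed.

Lemma exB M g1 g2 : ex M (fun G => g1 G - g2 G) = ex M g1 - ex M g2.
Proof. by rewrite exD exN. Qed.

Lemma ex_cst M x : nz M -> ex M (fun=> x) = x.
Proof.
by move=> h; rewrite /ex sumr_const -(mulr_natr x) mulfK // gt_eqF // Nb_gt0.
Qed.

Lemma ex_sum M (I : finType) (P : pred I) (F : I -> {set cell} -> R) :
  ex M (fun G => \sum_(i | P i) F i G) = \sum_(i | P i) ex M (F i).
Proof. by rewrite /ex exchange_big mulr_suml. Qed.

Lemma ex_le M g1 g2 : (forall G, G \in gs M -> g1 G <= g2 G) -> ex M g1 <= ex M g2.
Proof. by move=> h; rewrite ler_wpM2r ?invr_ge0 ?ler0n // ler_sum. Qed.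

Lemma ex_ge0 M g : (forall G, G \in gs M -> 0 <= g G) -> 0 <= ex M g.
Proof. by move=> h; rewrite divr_ge0 ?ler0n // sumr_ge0. Qed.

Lemma ex_norm M g : `|ex M g| <= ex M (fun G => `|g G|).
Proof.
rewrite /ex normrM normfV normr_nat ler_wpM2r ?invr_ge0 ?ler0n //.
exact: ler_norm_sum.
Qed.

Lemma ex_Nb M g : ex M g * Nb M = \sum_(G in gs M) g G.
Proof.
have [h|h] := boolP (nz M); first by rewrite divfK // gt_eqF // Nb_gt0.
rewrite Nb_eq0 // mulr0 big_pred0 // => G; apply/negbTE.
by move: h; rewrite /nz -leqNgt leqn0 cards_eq0 => /eqP ->; rewrite inE.
Qed.

Lemma pr_Nb M c : c \notin mH M -> pr M c * Nb M = Nb (rem c M).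
Proof.
move=> h; rewrite ex_Nb (eq_bigr (fun G => indc G c * 1)) => [|G _]; last by rewrite mulr1.
by rewrite sum_rem // Nb_sum.
Qed.

Lemma ex_ind M c g : c \notin mH M ->
  ex M (fun G => indc G c * g G) = pr M c * ex (rem c M) (fun G => g (c |: G)).
Proof.
move=> h; have [h0|h0] := boolP (nz M); last first.
  by rewrite /pr /ex -!/(Nb _) (Nb_eq0 h0) !invr0 !mulr0 mul0r.
apply: (@mulIf _ (Nb M)); first by rewrite gt_eqF // Nb_gt0.
by rewrite ex_Nb mulrAC pr_Nb // mulrC ex_Nb sum_rem.
Qed.

Lemma pr_fb M c : nz M -> (1 - pr M c) * Nb M = Nb (fb c M).
Proof.
move=> h; rewrite mulrBl mul1r ex_Nb !Nb_sum -sumrB -sum_fb.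
by apply: eq_bigr => G _; rewrite mulr1.
Qed.

Lemma ex_fb M c g : nz M ->
  ex M (fun G => (1 - indc G c) * g G) = (1 - pr M c) * ex (fb c M) g.
Proof.
move=> h0; apply: (@mulIf _ (Nb M)); first by rewrite gt_eqF // Nb_gt0.
by rewrite ex_Nb mulrAC pr_fb // mulrC ex_Nb sum_fb.
Qed.

Lemma pr_ge0 M c : 0 <= pr M c.
Proof. by apply: ex_ge0 => G _; apply: ind_ge0. Qed.

Lemma pr_le1 M c : pr M c <= 1.
Proof.
have [h0|h0] := boolP (nz M); last first.
  by rewrite /pr /ex -!/(Nb _) (Nb_eq0 h0) !invr0 !mulr0 ler01.
by rewrite -[leRHS](ex_cst 1 h0); apply: ex_le => G _; apply: ind_le1.
Qed.

Lemma pr_in M c : c \in mH M -> pr M c = 0.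
Proof.
move=> h; rewrite /pr /ex big1 ?mul0r // => G hG.
by rewrite /indc (negbTE (gs_notin hG h)).
Qed.

Lemma nz_rem M c : c \notin mH M -> nz M -> 0 < pr M c -> nz (rem c M).
Proof.
move=> h h0 h1; rewrite /nz -(ltr0n R) -/(Nb _) -pr_Nb // mulr_gt0 //.
exact: Nb_gt0.
Qed.

Lemma nz_fb M c : nz M -> pr M c < 1 -> nz (fb c M).
Proof.
move=> h0 h1; rewrite /nz -(ltr0n R) -/(Nb _) -pr_fb // mulr_gt0 ?subr_gt0 //.
exact: Nb_gt0.
Qed.

Lemma pr_col M k : nz M -> \sum_a pr M (a, k) = mt M k.
Proof.
move=> h; rewrite /pr -ex_sum -[RHS](ex_cst _ h); apply: eq_ex => G /gsP[_ hc _].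
by rewrite -hc.
Qed.


End Graphs.

End Conditioning.
Import Conditioning.

(** * Exact identities from moving a point within its column *)

Module SwitchIdentities.

Section Switch.
Variables (R : realFieldType) (n : nat).
Local Notation cell := ('I_n * 'I_n)%type.
Implicit Types (G H : {set cell}) (c : cell) (a b k l : 'I_n).
Local Notation model := (model R n).
Implicit Types (M U : model).
Local Notation ind := (@indc R n).

Lemma gs_eq M1 M2 : ms M1 =1 ms M2 -> mt M1 =1 mt M2 -> mH M1 = mH M2 ->
  gs M1 = gs M2.
Proof.
move=> e1 e2 e3; apply/setP => G; apply/gsP/gsP; rewrite e3 => -[h1 h2 h3].
  by split=> // j; rewrite -?e1 -?e2.
by split=> // j; rewrite ?e1 ?e2.
Qed.

Lemma Nb_eq M1 M2 : ms M1 =1 ms M2 -> mt M1 =1 mt M2 -> mH M1 = mH M2 ->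
  Nb M1 = Nb M2.
Proof. by move=> e1 e2 e3; rewrite /Nb (gs_eq e1 e2 e3). Qed.

(** Indicator that the point [(a, k)] may be moved to [(b, k)]; [cnt H a b G] is thus the number of
    moves from row [a] to row [b]. *)
Definition fr H a b G k : R := ind G (a, k) * (1 - ind G (b, k)) * (1 - ind H (b, k)).
Definition cnt H a b G : R := \sum_k fr H a b G k.

Lemma ind01 G c : ind G c = 0 \/ ind G c = 1.
Proof. by rewrite /indc; case: (_ \in _); [right|left]. Qed.

Lemma fr_ge0 H a b G k : 0 <= fr H a b G k.
Proof.
by rewrite /fr; case: (ind01 G (a, k)) => ->; case: (ind01 G (b, k)) => ->;
  case: (ind01 H (b, k)) => ->; lra.
Qed.

Lemma fr_le1 H a b G k : fr H a b G k <= 1.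
Proof.
by rewrite /fr; case: (ind01 G (a, k)) => ->; case: (ind01 G (b, k)) => ->;
  case: (ind01 H (b, k)) => ->; lra.
Qed.

Lemma cnt_ge0 H a b G : 0 <= cnt H a b G.
Proof. by apply: sumr_ge0 => k _; apply: fr_ge0. Qed.

Lemma pair_eqr a b k l : a != b -> ((a, k) == (b, l) :> cell) = false.
Proof. by move=> h; rewrite xpair_eqE (negbTE h). Qed.

Lemma pair_eql a b k l : k != l -> ((a, k) == (b, l) :> cell) = false.
Proof. by move=> h; rewrite xpair_eqE (negbTE h) andbF. Qed.

Lemma sum_rem_fb M c1 c2 (g : {set cell} -> R) : c1 \notin mH M -> c1 != c2 ->
  \sum_(G in gs M) ind G c1 * (1 - ind G c2) * g G =
  \sum_(G in gs (fb c2 (rem c1 M))) g (c1 |: G).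
Proof.
move=> h ne; rewrite -sum_fb.
rewrite (eq_bigr (fun G => ind G c1 * ((1 - ind G c2) * g G))); last first.
  by move=> G _; rewrite mulrA.
rewrite sum_rem //; apply: eq_bigr => G hG.
rewrite ind_add; last by apply: gs_notin hG _; rewrite setU11.
by rewrite eq_sym (negbTE ne) addr0.
Qed.

(** A move fixes everything except the moved point, so deleting that point from the source or from
    the target leaves the same model. *)
Lemma mv_rem U a b k : a != b ->
  gs (fb (b, k) (rem (a, k) (mv a U))) = gs (fb (a, k) (rem (b, k) (mv b U))).
Proof.
move=> ne; apply: gs_eq => //= [j|]; first by rewrite /decf /incf !addrK.
by rewrite setUCA.
Qed.

(** The 1 is the moved point itself, which can be moved back. *)
Lemma cnt_switch U a b k G0 : a != b -> G0 \in gs (fb (b, k) (rem (a, k) (mv a U))) ->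
  (a, k) \notin mH U ->
  cnt (mH U) b a ((b, k) |: G0) = cnt (mH U) b a ((a, k) |: G0) + 1.
Proof.
move=> ne h aH.
have hb : (b, k) \notin G0 by apply: gs_notin h _; rewrite setU11.
have ha : (a, k) \notin G0 by apply: gs_notin h _; rewrite !inE eqxx orbT.
rewrite /cnt (bigD1 k) //= [in RHS](bigD1 k) //= addrAC; congr (_ + _).
  rewrite /fr !ind_add // !eqxx (pair_eqr _ _ ne) eq_sym (pair_eqr _ _ ne).
  rewrite /indc (negbTE ha) (negbTE hb) (negbTE aH) /=; ring.
apply: eq_bigr => l /pair_eql nl.
by rewrite /fr !ind_add // !nl !addr0.
Qed.

(* Move a point of row [a] down its column to row [b]; a graph of the target
   model is reached from [cnt b a] graphs of the source model. *)
Lemma move_identity U a b : a != b ->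
  Nb (mv b U) - \sum_(G in gs (mv b U)) (cnt (mH U) b a G == 0)%:R =
  \sum_(G in gs (mv a U)) cnt (mH U) a b G / (cnt (mH U) b a G + 1).
Proof.
move=> ne; set H := mH U.
have -> : Nb (mv b U) - \sum_(G in gs (mv b U)) (cnt H b a G == 0)%:R =
    \sum_(G in gs (mv b U)) \sum_k fr H b a G k / cnt H b a G.
  rewrite Nb_sum -sumrB; apply: eq_bigr => G _; rewrite -mulr_suml -/(cnt _ _ _ _).
  by have [->|h] := eqVneq; rewrite ?subrr ?mul0r // subr0 divff.
rewrite exchange_big /=.
under [in RHS]eq_bigr do rewrite /cnt mulr_suml.
rewrite [in RHS]exchange_big /=; apply: eq_bigr => k _; rewrite -!/(cnt _ _ _ _).
have [aH|aH] := boolP ((a, k) \in H).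
  rewrite !big1 // => G hG.
    by rewrite /fr /indc (negbTE (gs_notin hG _)) // !mul0r.
  by rewrite /fr {3}/indc aH subrr mulr0 mul0r.
have [bH|bH] := boolP ((b, k) \in H).
  rewrite !big1 // => G hG.
    by rewrite /fr {3}/indc bH subrr mulr0 mul0r.
  by rewrite /fr /indc (negbTE (gs_notin hG _)) // !mul0r.
under eq_bigr do rewrite /fr {3}/indc (negbTE aH) subr0 mulr1.
under [in RHS]eq_bigr do rewrite /fr {3}/indc (negbTE bH) subr0 mulr1.
rewrite !sum_rem_fb ?(inj_eq, xpair_eqE) ?(negbTE ne) ?(eq_sym b) ?(negbTE ne) //.
rewrite -mv_rem //; apply: eq_bigr => G0 h.
by rewrite cnt_switch.
Qed.

(** The event that both cells are occupied cancels from the difference; what remains are the graphs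
    with exactly one of them occupied. [U] lacks a point in each of the two rows but only one in
    column [k], so [mv a U] and [mv b U] are these two cases. *)
Lemma pr_sub M a b k : a != b -> (a, k) \notin mH M -> (b, k) \notin mH M ->
  let U := Mod (decf (decf (ms M) a) b) (decf (mt M) k) ((a, k) |: ((b, k) |: mH M)) in
  [/\ (pr M (a, k) - pr M (b, k)) * Nb M = Nb (mv b U) - Nb (mv a U) &
   Nb (mv a U) = Nb (fb (a, k) (rem (b, k) M))].
Proof.
move=> ne ha hb U.
have ea : Nb (mv a U) = Nb (fb (a, k) (rem (b, k) M)).
  apply: Nb_eq => //= j; rewrite /decf /incf; ring.
have eb : Nb (mv b U) = Nb (fb (b, k) (rem (a, k) M)).
  by apply: Nb_eq => //= [j|]; [rewrite /decf /incf; ring | rewrite setUCA].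
split=> //; rewrite ea eb mulrBl !ex_Nb !Nb_sum.
rewrite -(sum_rem_fb (fun=> 1)) ?xpair_eqE ?(negbTE ne) // -(sum_rem_fb (fun=> 1)) ?xpair_eqE ?(eq_sym b) ?(negbTE ne) //.
by rewrite -!sumrB; apply: eq_bigr => G _; ring.
Qed.

(** In column [k] the probabilities add up to [mt M k] and vanish on forbidden cells, so one of them
    is determined by its differences to the others. Through this identity, estimates of ratios
    become estimates of probabilities. *)
Lemma pr_identity M a k : nz M -> (a, k) \notin mH M ->
  (n%:R - cd R (mH M) k) * pr M (a, k) - mt M k =
  \sum_(b | (b, k) \notin mH M) (pr M (a, k) - pr M (b, k)).
Proof.
move=> h ha; rewrite sumrB -(pr_col k h) sumr_const; congr (_ - _); last first.
  rewrite (bigID (fun b => (b, k) \in mH M)) /= big1 ?add0r // => b hb.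
  exact: pr_in.
rewrite -(mulr_natl (pr M (a, k))); congr (_ * _).
have -> : cd R (mH M) k = #|[pred b | (b, k) \in mH M]|%:R.
  rewrite /cd -sum1_card natr_sum [RHS]big_mkcond.
  by apply: eq_bigr => b _; rewrite /indc inE; case: (_ \in _).
have -> : n%:R = #|[pred b | (b, k) \in mH M]|%:R + #|[predC [pred b | (b, k) \in mH M]]|%:R :> R.
  by rewrite -natrD cardC card_ord.
rewrite addrAC subrr add0r; congr _%:R.
Qed.
End Switch.

End SwitchIdentities.
Import SwitchIdentities.

(** * A switching on four cells that changes the number of moves between two rows *)

Module FourCycles.

Section TailSwitch.
Variables (R : realFieldType) (n : nat).
Local Notation cell := ('I_n * 'I_n)%type.
Implicit Types (G H : {set cell}) (c : cell) (a b k l : 'I_n).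
Local Notation model := (model R n).
Implicit Types (M U : model).
Local Notation ind := (@indc R n).
Local Notation cnt := (@cnt R n).
Local Notation fr := (@fr R n).

Lemma ind_add_ne c0 G c : c != c0 -> ind (c0 |: G) c = ind G c.
Proof. by move=> h; rewrite /indc in_setU1 (negbTE h). Qed.

Lemma ind_add_eq c G : ind (c |: G) c = 1.
Proof. by rewrite /indc setU11. Qed.

Lemma ind_notin G c : c \notin G -> ind G c = 0.
Proof. by rewrite /indc => /negbTE ->. Qed.

Lemma ind_in c G : c \in G -> ind G c = 1.
Proof. by rewrite /indc => ->. Qed.

Lemma sum_rem2_fb2 M c1 c2 c3 c4 (g : {set cell} -> R) :
  c1 \notin mH M -> c2 \notin mH M -> uniq [:: c1; c2; c3; c4] ->
  \sum_(G in gs M) ind G c1 * (ind G c2 * ((1 - ind G c3) * ((1 - ind G c4) * g G))) =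
  \sum_(G in gs (fb c4 (fb c3 (rem c2 (rem c1 M))))) g (c1 |: (c2 |: G)).
Proof.
rewrite /= !inE !negb_or => h1 h2 /andP[/and3P[n12 n13 n14] /andP[/andP[n23 n24] _]].
rewrite sum_rem //.
rewrite (eq_bigr (fun G => ind G c2 * ((1 - ind G c3) * ((1 - ind G c4) * g (c1 |: G))))).
  rewrite sum_rem; last by rewrite !inE negb_or eq_sym n12.
  rewrite -2!sum_fb; apply: eq_bigr => G _.
  by rewrite !ind_add_ne // eq_sym.
by move=> G _; rewrite !ind_add_ne // eq_sym.
Qed.

Section Rows.
Variables (M : model) (a b : 'I_n).
Hypothesis nab : a != b.
Let H := mH M.

(** A switching is a third row [c] with a column [k] counted by [sw_u] and a column [l] counted by
    [sw_v], so [sw_F] is the number of switchings that can start at [G]. *)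
Definition sw_u G (c : 'I_n) := \sum_k ind G (a, k) * ind G (b, k) * (1 - ind G (c, k)) * (1 - ind H (c, k)).
Definition sw_v G (c : 'I_n) := \sum_l ind G (c, l) * (1 - ind G (a, l)) * (1 - ind G (b, l))
                       * (1 - ind H (a, l)) * (1 - ind H (b, l)).
Definition other (c : 'I_n) := (c != a) && (c != b).
Definition sw_F G := \sum_(c | other c) sw_u G c * sw_v G c.
Definition atd (x : R) G : R := (cnt H b a G == x)%:R.

Lemma atd_ge0 x G : 0 <= atd x G. Proof. exact: ler0n. Qed.

Lemma sw_wt_ge0 x G k l : 0 <= atd x G * (fr H a b G k * fr H b a G l).
Proof. by apply/mulr_ge0/mulr_ge0; rewrite ?atd_ge0 ?fr_ge0. Qed.

(* The switching [G - bk - cl + bl + ck], where [ak] is in [G] and [al] is not: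
   it raises [cnt b a] by one. *)
Lemma switch_cell x (c k l : 'I_n) : other c ->
  \sum_(G in gs M) atd x G * ((ind G (a, k) * ind G (b, k) * (1 - ind G (c, k)) * (1 - ind H (c, k))) *
    (ind G (c, l) * (1 - ind G (a, l)) * (1 - ind G (b, l)) * (1 - ind H (a, l)) * (1 - ind H (b, l))))
  <= \sum_(G in gs M) atd (x + 1) G * (fr H a b G k * fr H b a G l).
Proof.
move=> /andP[nca ncb].
have rhs0 : 0 <= \sum_(G in gs M) atd (x + 1) G * (fr H a b G k * fr H b a G l).
  by apply: sumr_ge0 => G _; apply: sw_wt_ge0.
have triv (P : {set cell} -> R) : (forall G, G \in gs M -> P G = 0) ->
    \sum_(G in gs M) P G <= \sum_(G in gs M) atd (x + 1) G * (fr H a b G k * fr H b a G l).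
  by move=> h; rewrite big1.
have [ekl|nkl] := eqVneq k l.
  by apply: triv => G _; rewrite ekl; case: (ind01 R G (b, l)) => ->; ring.
have [h|ck] := boolP ((c, k) \in H).
  by apply: triv => G _; rewrite (ind_in h); ring.
have [h|al] := boolP ((a, l) \in H).
  by apply: triv => G _; rewrite (ind_in h); ring.
have [h|bl] := boolP ((b, l) \in H).
  by apply: triv => G _; rewrite (ind_in h); ring.
have [h|bk] := boolP ((b, k) \in H).
  by apply: triv => G hG; rewrite (ind_notin (gs_notin hG h)); ring.
have [h|cl] := boolP ((c, l) \in H).
  by apply: triv => G hG; rewrite (ind_notin (gs_notin hG h)); ring.
pose g G := ind G (a, k) * (1 - ind G (a, l)).
rewrite (eq_bigr (fun G => ind G (b, k) * (ind G (c, l) * ((1 - ind G (c, k)) *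
   ((1 - ind G (b, l)) * (atd x G * g G)))))); last first.
  by move=> G _; rewrite (ind_notin ck) (ind_notin al) (ind_notin bl) /g; ring.
rewrite sum_rem2_fb2 //; last first.
  by rewrite /= !inE !xpair_eqE !eqxx ?(eq_sym b) ?(negbTE ncb) (negbTE nkl) ?(eq_sym l) ?(negbTE nkl) ?andbF.
have <- : gs (fb (c, l) (fb (b, k) (rem (c, k) (rem (b, l) M)))) =
          gs (fb (b, l) (fb (c, k) (rem (c, l) (rem (b, k) M)))).
  apply: gs_eq => /= [j|j|]; rewrite /decf; try ring.
  by apply/setP => e; rewrite !inE; do !case: (_ == _).
apply: (@le_trans _ _ (\sum_(G in gs M) ind G (b, l) * (ind G (c, k) * ((1 - ind G (b, k)) *
   ((1 - ind G (c, l)) * (atd (x + 1) G * g G)))))); last first.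
  apply: ler_sum => G hG; rewrite /fr (ind_notin al) (ind_notin bk) /g.
  have iv e : 0 <= 1 - ind G e by rewrite subr_ge0 ind_le1.
  have A0 := atd_ge0 (x + 1) G.
  set r := (X in _ <= X).
  rewrite [leLHS](_ : _ = r * (ind G (c, k) * (1 - ind G (c, l)))); last by rewrite /r; ring.
  apply: ler_piMr; last by apply: mulr_ile1; rewrite ?ind_ge0 ?ind_le1 ?iv // gerBl ind_ge0.
  by rewrite /r !subr0 !mulr1 !mulr_ge0 ?ind_ge0 ?iv.
rewrite sum_rem2_fb2 //; last first.
  by rewrite /= !inE !xpair_eqE !eqxx ?(eq_sym b) ?(negbTE ncb) (negbTE nkl) ?(eq_sym l) ?(negbTE nkl) ?andbF.
apply: ler_sum => G hG.
have nn e : e \in [:: (b, k); (b, l); (c, k); (c, l)] -> e \notin G.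
  by move=> he; apply: gs_notin hG _; move: he; rewrite !inE => /or4P[] /eqP ->; rewrite !eqxx ?orbT.
have gE i j i' j' : (i != a) -> i' != a -> g ((i, j) |: ((i', j') |: G)) = g G.
  by move=> h h'; rewrite /g !ind_add_ne // xpair_eqE eq_sym ?(negbTE h) ?(negbTE h').
rewrite !gE // 1?eq_sym //.
rewrite /g; case: (ind01 R G (a, k)) => eak; first by rewrite eak !mul0r !mulr0.
case: (ind01 R G (a, l)) => eal; last by rewrite eal subrr !mulr0.
rewrite ler_wpM2r ?eak ?eal ?subr0 ?mulr1 ?ler01 // /atd ler_nat.
(* In the source, [bk] cannot move to row [a] because [ak] is occupied; in the target, [bl] can,
   because [al] is empty and allowed. No other column of row [b] is affected. *)
suff -> : cnt H b a ((b, l) |: ((c, k) |: G)) = cnt H b a ((b, k) |: ((c, l) |: G)) + 1.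
  by rewrite (inj_eq (addIr 1)).
rewrite /cnt (bigD1 k) // (bigD1 l) 1?eq_sym //=.
rewrite [in RHS](bigD1 k) // [in RHS](bigD1 l) 1?eq_sym //=.
have rest i : (i != k) && (i != l) -> fr H b a ((b, l) |: ((c, k) |: G)) i =
     fr H b a ((b, k) |: ((c, l) |: G)) i.
  case/andP=> ik il; rewrite /fr !ind_add_ne //;
  by rewrite xpair_eqE ?(negbTE ik) ?(negbTE il) ?andbF // eq_sym ?(negbTE nca) ?(negbTE nab).
rewrite (eq_bigr _ rest) /fr ind_add_eq.
have hak i j : ind ((b, i) |: ((c, j) |: G)) (a, k) = 1.
  by rewrite !ind_add_ne // xpair_eqE ?(negbTE nab) ?(eq_sym a) ?(negbTE nca).
have hal i j : ind ((b, i) |: ((c, j) |: G)) (a, l) = 0.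
  by rewrite !ind_add_ne // xpair_eqE ?(negbTE nab) ?(eq_sym a) ?(negbTE nca).
have hbl : ind ((b, k) |: ((c, l) |: G)) (b, l) = 0.
  rewrite !ind_add_ne ?xpair_eqE ?(eq_sym l) ?(negbTE nkl) ?(eq_sym b) ?(negbTE ncb) ?andbF //.
  by rewrite (ind_notin (nn _ _)) // !inE eqxx orbT.
by rewrite !hak !hal hbl (ind_notin al); ring.
Qed.

(** Double counting. A target graph determines the switching up to a column [k] movable from [a] to
    [b], a column [l] movable from [b] to [a], and a row [c], for which the trivial bound n is
    used. *)
Lemma switch_ineq x :
  \sum_(G in gs M) atd x G * sw_F G <=
  \sum_(G in gs M) atd (x + 1) G * (cnt H a b G * cnt H b a G * n%:R).
Proof.
have -> : \sum_(G in gs M) atd x G * sw_F G = \sum_(c | other c) \sum_k \sum_l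
   \sum_(G in gs M) atd x G * ((ind G (a, k) * ind G (b, k) * (1 - ind G (c, k)) * (1 - ind H (c, k))) *
    (ind G (c, l) * (1 - ind G (a, l)) * (1 - ind G (b, l)) * (1 - ind H (a, l)) * (1 - ind H (b, l)))).
  rewrite (eq_bigr (fun G => \sum_(c | other c) \sum_k \sum_l atd x G * ((ind G (a, k) * ind G (b, k) * (1 - ind G (c, k)) * (1 - ind H (c, k))) *
    (ind G (c, l) * (1 - ind G (a, l)) * (1 - ind G (b, l)) * (1 - ind H (a, l)) * (1 - ind H (b, l)))))).
    rewrite exchange_big; apply: eq_bigr => c _; rewrite exchange_big; apply: eq_bigr => k _.
    by rewrite exchange_big.
  move=> G _; rewrite /sw_F mulr_sumr; apply: eq_bigr => c _.
  rewrite /sw_u /sw_v mulr_suml mulr_sumr; apply: eq_bigr => k _.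
  by rewrite !mulr_sumr.
have -> : \sum_(G in gs M) atd (x + 1) G * (cnt H a b G * cnt H b a G * n%:R) =
  \sum_(c : 'I_n) \sum_k \sum_l \sum_(G in gs M) atd (x + 1) G * (fr H a b G k * fr H b a G l).
  rewrite sumr_const card_ord -(mulr_natl (\sum_k _)).
  under [in RHS]eq_bigr do rewrite exchange_big.
  rewrite exchange_big mulr_sumr; apply: eq_bigr => G _ /=.
  rewrite mulrA [RHS]mulrC; congr (_ * _).
  rewrite /cnt mulr_suml mulr_sumr; apply: eq_bigr => k _.
  by rewrite !mulr_sumr.
rewrite big_mkcond; apply: ler_sum => c _; case: ifP => hc.
  by apply: ler_sum => k _; apply: ler_sum => l _; apply: switch_cell.
by do 3![apply: sumr_ge0 => ? _]; apply: sw_wt_ge0.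
Qed.
End Rows.
End TailSwitch.

End FourCycles.
Import FourCycles.

(** * The parameter regime, regular models, and column counts for two or three rows *)

Module Regularity.

(** Dominates the powers of [nu] that are ever required to be small against [1 / z]; the final error
    carries [nu ^+ 2900]. It also determines eps0 in the theorem. *)
Definition bigE : nat := 3000.

Record ctx (R : realFieldType) (n : nat) (nu z p : R) : Prop := Ctx {
  cs : scale n nu z; cp0 : 0 < p; cp1 : p < 1; cw : 1 <= nu * (p * (1 - p));
  csm : nu ^+ bigE * z <= 1 }.

(** The slack [i] counts unit changes of the model: each conditioning on a cell raises it by 1, and
    every estimate is stated for slacks up to some numeral, leaving room for the conditionings in
    its proof. *)
Record reg (R : realFieldType) (n : nat) (nu z p : R) (i : nat) (M : model R n) : Prop := Reg {
  rs : forall a, `|ms M a - p * n%:R| <= nu / z + i%:R;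
  rt : forall k, `|mt M k - p * n%:R| <= nu / z + i%:R;
  rx : forall a, rd R (mH M) a <= nu / z + i%:R;
  ry : forall k, cd R (mH M) k <= nu / z + i%:R;
  rX : \sum_a rd R (mH M) a <= (nu / z) ^+ 2 + i%:R;
  rS : `|\sum_a ms M a - p * n%:R ^+ 2| <= i%:R;
  rT : `|\sum_k mt M k - p * n%:R ^+ 2| <= i%:R }.

Lemma nat_floor (R : realFieldType) (x : R) (m : nat) : 0 <= x -> x <= m%:R ->
  exists j : nat, j%:R <= x < j.+1%:R.
Proof.
move=> x0; elim: m => [|m IH] h; first by exists 0%N; rewrite x0 (le_lt_trans h) ?ltr01.
have [h'|h'] := lerP x m%:R; first exact: IH.
have [e|ne] := eqVneq x m.+1%:R.
  by exists m.+1; rewrite e lexx ltr_nat ltnS leqnn.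
by exists m; rewrite (ltW h') lt_neqAle ne h.
Qed.

Section Tail.
Variables (R : realFieldType) (n : nat) (nu z p : R).
Hypothesis cx : ctx n nu z p.
Local Notation cell := ('I_n * 'I_n)%type.
Implicit Types (G H : {set cell}) (a b k l : 'I_n).
Local Notation model := (model R n).
Implicit Types (M U : model).
Local Notation ind := (@indc R n).
Local Notation cnt := (@cnt R n).
Local Notation rd := (@rd R n).
Local Notation cd := (@cd R n).
Local Notation ob := (ob nu z).
Local Notation reg := (@reg R n nu z p).
Let sc := cs cx.

Lemma z_gt0 : 0 < z. Proof. exact: scale_z0 sc. Qed.
Lemma nu_ge2 : 2 <= nu. Proof. exact: scale_nu sc. Qed.
Lemma n_gt0 : 0 < n%:R :> R.
Proof.
rewrite ltr0n lt0n; apply/eqP => e; have := scale_n sc.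
by rewrite e mul0r => /eqP; rewrite eq_sym oner_eq0.
Qed.
Lemma n_z : n%:R = z ^ (-2).
Proof.
have h : z ^+ 2 != 0 by rewrite expf_neq0 // gt_eqF // z_gt0.
by change (z ^ (-2)) with (z ^- 2); apply: (mulIf h); rewrite mulVf // (scale_n sc).
Qed.

Lemma z2n : z ^+ 2 = n%:R^-1.
Proof.
have h : n%:R != 0 :> R by rewrite gt_eqF // n_gt0.
by apply: (mulfI h); rewrite divff // (scale_n sc).
Qed.

Lemma ob_le_n (k : int) (c : nat) (x : R) : ob k c x -> -1 <= k -> (c <= bigE)%N -> x <= n%:R.
Proof.
move=> h hk hc; apply: le_trans (ler_norm _) _.
apply: le_trans (ob_le sc h hk hc) _.
rewrite n_z (_ : -2 = -1 + -1) // exprzDr ?unitfE ?gt_eqF ?z_gt0 //.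
apply: ler_wpM2r; first by rewrite exprz_ge0 // ltW // z_gt0.
by rewrite exprN1 -(ler_pM2r z_gt0) mulVf ?gt_eqF ?z_gt0 // (csm cx).
Qed.

Lemma e_small i : (i <= 100)%N -> 1000 * nu * (nu / z + i%:R) <= n%:R.
Proof.
move=> hi; have hi' : ob 0 7 i%:R.
  apply: (ob_le sc (ob_nat sc i)) => //.
  by apply: leq_trans (leq_up_log _ hi) _.
apply: (@ob_le_n (-1) 1200) => //; obt.
Qed.

Lemma rd_ge0 H a : 0 <= rd H a. Proof. by apply: sumr_ge0 => k _; apply: ind_ge0. Qed.
Lemma cd_ge0 H a : 0 <= cd H a. Proof. by apply: sumr_ge0 => k _; apply: ind_ge0. Qed.

Definition kap a b G := \sum_k ind G (a, k) * ind G (b, k).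
Definition fH H a b G := \sum_k ind H (a, k) * ind G (b, k).

(** A point of row [b] fails to move to row [a] if its column is occupied in row [a] (counted by
    [kap]) or forbidden there (counted by [fH]). The two cases exclude each other because [G] avoids
    [mH M]. *)
Lemma cntE M G a b : G \in gs M ->
  cnt (mH M) b a G = ms M b - kap a b G - fH (mH M) a b G.
Proof.
move=> hG; have /gsP[<- _ d] := hG.
rewrite /cnt /Conditioning.rd /kap /fH -!sumrB; apply: eq_bigr => k _; rewrite /fr.
case: (boolP ((a, k) \in mH M)) => h.
  by rewrite (ind_in _ h) (ind_notin _ (gs_notin hG h)); ring.
by rewrite (ind_notin _ h); ring.
Qed.

Lemma fH_ge0 H a b G : 0 <= fH H a b G.
Proof. by apply: sumr_ge0 => k _; rewrite mulr_ge0 ?ind_ge0. Qed.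

Lemma fH_le H a b G : fH H a b G <= rd H a.
Proof.
apply: ler_sum => k _; rewrite -[leRHS]mulr1.
by rewrite ler_wpM2l ?ind_ge0 ?ind_le1.
Qed.

Lemma kapC a b G : kap a b G = kap b a G.
Proof. by apply: eq_bigr => k _; rewrite mulrC. Qed.

Lemma sw_u_ge0 M a b G c : 0 <= sw_u M a b G c.
Proof.
apply: sumr_ge0 => k _.
by case: (ind01 R G (a, k)) => ->; case: (ind01 R G (b, k)) => ->;
  case: (ind01 R G (c, k)) => ->; case: (ind01 R (mH M) (c, k)) => ->; lra.
Qed.

(** Of the points of row [c], at most [kap - sw_u] lie in columns common to [a] and [b]; those in
    columns of exactly one of these rows are bounded by the two [cnt] and the forbidden cells; the
    rest is counted by [sw_v], again up to forbidden cells. Finally [kap <= ms M b]. *)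
Lemma sw_v_ge M a b G c : G \in gs M ->
  sw_u M a b G c - (ms M b - ms M c + cnt (mH M) a b G + cnt (mH M) b a G
   + rd (mH M) a + rd (mH M) b) <= sw_v M a b G c.
Proof.
move=> hG; have k_le : kap a b G <= ms M b.
  have /gsP[<- _ _] := hG; apply: ler_sum => k _.
  by rewrite -[leRHS]mul1r ler_wpM2r ?ind_ge0 ?ind_le1.
suff : sw_u M a b G c + ms M c - kap a b G - cnt (mH M) a b G - cnt (mH M) b a G
   - rd (mH M) a - rd (mH M) b <= sw_v M a b G c by lra.
have /gsP[<- _ _] := hG; rewrite /sw_u /kap /SwitchIdentities.cnt /Conditioning.rd /sw_v -big_split -!sumrB /=.
apply: ler_sum => k _; rewrite /fr.
by case: (ind01 R G (a, k)) => ->; case: (ind01 R G (b, k)) => ->;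
  case: (ind01 R G (c, k)) => ->; case: (ind01 R (mH M) (c, k)) => ->;
  case: (ind01 R (mH M) (a, k)) => ->; case: (ind01 R (mH M) (b, k)) => ->; lra.
Qed.

(** Each column [k] common to [a] and [b] leaves at least [n - 2 - mt M k - cd (mH M) k] other rows
    in which the cell is empty and allowed. *)
Lemma sw_u_sum M a b G : G \in gs M ->
  \sum_k ind G (a, k) * ind G (b, k) * (n%:R - 2 - mt M k - cd (mH M) k)
   <= \sum_(c | other a b c) sw_u M a b G c.
Proof.
move=> hG; rewrite /sw_u exchange_big; apply: ler_sum => k _ /=.
have -> : n%:R - 2 - mt M k - cd (mH M) k =
  \sum_(c : 'I_n) (1 - (c == a)%:R - (c == b)%:R - ind G (c, k) - ind (mH M) (c, k)).
  have /gsP[_ <- _] := hG.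
  by rewrite !sumrB !sum_eqr sumr_const card_ord /cd; ring.
rewrite mulr_sumr [leRHS]big_mkcond; apply: ler_sum => c _.
rewrite /other; case: (ind01 R G (a, k)) => ->; case: (ind01 R G (b, k)) => ->;
  case: (ind01 R G (c, k)) => ->; case: (ind01 R (mH M) (c, k)) => ->;
  do 2!case: (c == _); rewrite /=; lra.
Qed.
End Tail.

End Regularity.
Import Regularity.

(** * The number of moves between two rows is rarely small *)

Module SwitchTail.

(** Convexity: [u * (u - W)] lies above its tangent at the average [T = S / N], which is the line
    [(2 * T - W) * u - T ^+ 2]. *)
Lemma sq_lower (R : realFieldType) (I : finType) (P : pred I) (u v : I -> R) (W N : R) :
  0 < N -> #|I|%:R <= N -> (forall i, P i -> 0 <= u i) ->
  (forall i, P i -> u i - W <= v i) ->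
  let S := \sum_(i | P i) u i in S * (S / N - W) <= \sum_(i | P i) u i * v i.
Proof.
move=> N0 hI u0 uv; set S := \sum_(i | P i) u i; cbv zeta; set T := S / N.
have h1 : \sum_(i | P i) ((2 * T - W) * u i - T ^+ 2) <= \sum_(i | P i) u i * v i.
  apply: ler_sum => i Pi; apply: (@le_trans _ _ (u i * (u i - W))).
    by have := sqr_ge0 (u i - T); lra.
  by rewrite ler_wpM2l ?u0 ?uv.
apply: le_trans h1; rewrite sumrB -mulr_sumr -/S sumr_const -(mulr_natr (T ^+ 2)).
have h2 : T ^+ 2 * #|P|%:R <= T ^+ 2 * N.
  rewrite ler_wpM2l ?sqr_ge0 // (le_trans _ hI) // ler_nat; exact: max_card.
have -> : S * (S / N - W) = (2 * T - W) * S - T ^+ 2 * N.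
  by rewrite /T; field; rewrite gt_eqF.
lra.
Qed.

Section TailBound.
Variables (R : realFieldType) (n : nat) (nu z p : R).
Hypothesis cx : ctx n nu z p.
Local Notation cell := ('I_n * 'I_n)%type.
Implicit Types (G H : {set cell}) (a b k l : 'I_n).
Local Notation model := (model R n).
Implicit Types (M U : model).
Local Notation ind := (@indc R n).
Local Notation cnt := (@cnt R n).
Local Notation rd := (@rd R n).
Local Notation cd := (@cd R n).
Local Notation ob := (ob nu z).
Local Notation reg := (@reg R n nu z p).
Let sc := cs cx.

Lemma n_pq : n%:R / nu <= p * (1 - p) * n%:R.
Proof.
have := nu_ge2 cx => h; rewrite ler_pdivrMr; last by lra.
have := cw cx; have := n_gt0 cx => h1 h2.
by rewrite -[leLHS]mul1r mulrAC ler_pM2r // mulrC.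
Qed.

Section Bounds.
Variables (i : nat) (M : model) (a b : 'I_n) (G : {set cell}).
Hypotheses (hi : (i <= 100)%N) (rM : reg i M) (hG : G \in gs M).

Lemma cnt_swap_le : cnt (mH M) a b G <= cnt (mH M) b a G + 3 * (nu / z + i%:R).
Proof.
rewrite !(cntE _ _ hG) (kapC _ b a).
have := fH_ge0 R (mH M) b a G; have := fH_le R (mH M) a b G.
have := rx rM a; have := rs rM a; have := rs rM b.
by rewrite !ler_norml => /andP[? ?] /andP[? ?] *; lra.
Qed.

(** If few points of [b] can move to [a], the two rows share at least pn/2 columns, so the total [S]
    of [sw_u] is at least [m n / 4] with [m = n / nu]. Since [sw_v] exceeds [sw_u] minus m/8,
    [sq_lower] yields [m ^+ 2 * n / 32]. *)
Lemma sw_F_ge : a != b -> cnt (mH M) b a G <= n%:R / (32 * nu) ->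
  n%:R ^+ 3 / (32 * nu ^+ 2) <= sw_F M a b G.
Proof.
move=> nab hD; set D := cnt (mH M) b a G in hD *; set e := nu / z + i%:R.
have he : 1000 * nu * e <= n%:R by apply: e_small cx _ hi.
have nu2 := nu_ge2 cx; have n0 := n_gt0 cx; have z0 := z_gt0 cx.
have nu0 : 0 < nu by lra.
have i0 : 0 <= i%:R :> R by exact: ler0n.
have e2 : 2 <= e.
  have : nu <= nu / z by rewrite ler_peMr ?(ltW nu0) // -div1r ler_pdivlMr // mul1r (scale_z1 sc).
  by rewrite /e; lra.
pose m := n%:R / nu.
have m0 : 0 < m by rewrite divr_gt0.
have mn : m * nu = n%:R by rewrite /m divfK // gt_eqF.
have hD' : D <= m / 32 by apply: le_trans hD _; rewrite /m invfM mulrCA mulrC.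
have he' : 1000 * e <= m by rewrite /m ler_pdivlMr // mulrAC.
have D0 : 0 <= D by apply: cnt_ge0.
have hA : cnt (mH M) a b G <= D + 3 * e by exact: cnt_swap_le.
have mp : m <= p * n%:R.
  apply: le_trans n_pq _; rewrite ler_pM2r // -[leRHS]mulr1 ler_wpM2l ?(ltW (cp0 cx)) //.
  by have := cp0 cx; lra.
have mq : m <= (1 - p) * n%:R.
  apply: le_trans n_pq _; rewrite ler_pM2r // -[leRHS]mul1r.
  by apply: ler_wpM2r; have := cp1 cx; have := cp0 cx; lra.
set S := \sum_(c | other a b c) sw_u M a b G c.
have hk : p * n%:R / 2 <= kap R a b G.
  have := cntE a b hG; rewrite -/D => eD.
  have := fH_le R (mH M) a b G; have := rx rM a; have := rs rM b.
  by rewrite -/e ler_norml => /andP[? ?] *; lra.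
have hS : m * n%:R / 4 <= S.
  apply: le_trans (sw_u_sum a b hG).
  have -> : m * n%:R / 4 = m / n%:R * n%:R ^+ 2 / 4 by field; rewrite gt_eqF.
  apply: (@le_trans _ _ (kap R a b G * ((1 - p) * n%:R / 2))).
    apply: (@le_trans _ _ ((p * n%:R / 2) * ((1 - p) * n%:R / 2))); last first.
      by rewrite ler_wpM2r // divr_ge0 // mulr_ge0 ?(ltW n0) // subr_ge0 (ltW (cp1 cx)).
    have := n_pq; rewrite -/m => hm.
    have -> : m / n%:R * n%:R ^+ 2 / 4 = m * n%:R / 4 by field; rewrite gt_eqF.
    have : m * n%:R <= p * (1 - p) * n%:R * n%:R by rewrite ler_pM2r.
    by lra.
  rewrite /kap mulr_suml; apply: ler_sum => k _; apply: ler_wpM2l.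
    by rewrite mulr_ge0 ?ind_ge0.
  have := rt rM k; have := ry rM k; rewrite -/e ler_norml => ? /andP[? ?].
  by lra.
set W := 2 * D + 7 * e.
have hW : W <= m / 8 by rewrite /W; lra.
apply: (@le_trans _ _ (S * (S / n%:R - W))); last first.
  apply: sq_lower; rewrite ?card_ord // => c _; first exact: sw_u_ge0.
  apply: le_trans (sw_v_ge a b c hG).
  rewrite -/D /W; have := rx rM a; have := rx rM b; have := rs rM b; have := rs rM c.
  by rewrite -/e !ler_norml => /andP[? ?] /andP[? ?] ? ?; lra.
have hSn : m / 4 <= S / n%:R by rewrite ler_pdivlMr // mulrAC.
apply: (@le_trans _ _ (m * n%:R / 4 * (m / 8))).
  by rewrite -mn le_eqVlt; apply/orP; left; apply/eqP; field; rewrite gt_eqF.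
apply: ler_pM; [| |exact: hS|]; try lra.
by rewrite divr_ge0 // mulr_ge0 // ltW.
Qed.
End Bounds.

Definition atw M a b x := \sum_(G in gs M) atd M a b x G.

(** With [m = n / nu], at least [n m^2 / 32] switchings leave a graph with [cnt = x], while at most
    [n m^2 / 512] arrive at one with [cnt = x + 1]. This is better than the factor 2 that is
    claimed. *)
Lemma at_double i M a b (x : R) : (i <= 90)%N -> reg i M -> a != b ->
  0 <= x -> x + 1 <= n%:R / (32 * nu) -> 2 * atw M a b x <= atw M a b (x + 1).
Proof.
move=> hi rM nab x0 hx.
have nu2 := nu_ge2 cx; have n0 := n_gt0 cx.
have nu0 : 0 < nu by lra.
have hi' : (i <= 100)%N by apply: leq_trans hi _.
have he : 1000 * nu * (nu / z + i%:R) <= n%:R by apply: e_small cx _ hi'.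
pose m := n%:R / nu.
have m0 : 0 < m by rewrite divr_gt0.
have mn : m * nu = n%:R by rewrite /m divfK // gt_eqF.
have hx' : x + 1 <= m / 32 by apply: le_trans hx _; rewrite /m invfM mulrCA mulrC.
have he' : 1000 * (nu / z + i%:R) <= m by rewrite /m ler_pdivlMr // mulrAC.
pose L := n%:R * m ^+ 2 / 32.
have L0 : 0 < L by rewrite /L !mulr_gt0 // ?exprn_gt0 // invr_gt0.
suff : L * atw M a b x <= L / 2 * atw M a b (x + 1).
  by rewrite -mulrA ler_pM2l //; lra.
have LE : L = n%:R ^+ 3 / (32 * nu ^+ 2) by rewrite /L /m; field; rewrite gt_eqF.
apply: (@le_trans _ _ (\sum_(G in gs M) atd M a b x G * sw_F M a b G)).
  rewrite /atw mulr_sumr; apply: ler_sum => G hG; rewrite mulrC.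
  rewrite /atd; case: eqP => [e|_]; last by rewrite !mul0r.
  rewrite !mul1r LE; apply: sw_F_ge hi' rM hG nab _.
  by rewrite e; lra.
apply: le_trans (switch_ineq M nab x) _.
rewrite /atw mulr_sumr; apply: ler_sum => G hG.
rewrite /atd; case: eqP => [e|_]; last by rewrite mul0r mulr0.
rewrite mul1r mulr1 e.
have hA := cnt_swap_le a b rM hG; rewrite e in hA.
have A0 := cnt_ge0 R (mH M) a b G.
have h1 : cnt (mH M) a b G <= m / 16 by lra.
apply: (@le_trans _ _ (m / 16 * (m / 32) * n%:R)).
  rewrite ler_pM2r //; apply: ler_pM => //; lra.
have : 0 <= m ^+ 2 * n%:R by rewrite mulr_ge0 ?sqr_ge0 // ltW.
by rewrite /L; lra.
Qed.

Lemma at_pow i M a b (x : R) j : (i <= 90)%N -> reg i M -> a != b ->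
  0 <= x -> x + j%:R <= n%:R / (32 * nu) -> 2 ^+ j * atw M a b x <= Nb M.
Proof.
move=> hi rM nab x0; elim: j x x0 => [|j IH] x x0 hx.
  rewrite mul1r Nb_sum; apply: ler_sum => G _; rewrite /atd.
  by case: (_ == _).
have h1 : x + 1 + j%:R <= n%:R / (32 * nu) by rewrite -addrA (addrC 1) natr1.
have x10 : 0 <= x + 1 by lra.
apply: le_trans (IH _ x10 h1); rewrite exprS mulrAC mulrC ler_wpM2l ?exprn_ge0 //.
apply: (at_double hi rM nab x0); apply: le_trans h1.
by rewrite lerDl ler0n.
Qed.

Lemma pow2_ge (j m : nat) : j%:R ^+ m <= (2 : R) ^+ (j * m).
Proof.
rewrite exprM; apply: lerXn2r; rewrite ?nnegrE ?ler0n ?exprn_ge0 //.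
by rewrite -natrX ler_nat ltnW // ltn_expl.
Qed.

Lemma cnt_nat H a b G : exists d : nat, cnt H a b G = d%:R /\ (d <= n)%N.
Proof.
exists #|[pred k | [&& (a, k) \in G, (b, k) \notin G & (b, k) \notin H]]|.
split; last by rewrite -[X in (_ <= X)%N]card_ord max_card.
rewrite /SwitchIdentities.cnt -sum1_card natr_sum [RHS]big_mkcond; apply: eq_bigr => k _.
rewrite /fr /indc inE; case: (_ \in G); case: (_ \in G); case: (_ \in H) => /=; ring.
Qed.

Definition low M a b G : R := (cnt (mH M) b a G <= n%:R / (64 * nu))%R%:R.

(** Between n / (64 nu) and n / (32 nu) there is room for 14j doublings, where j is the integer part
    of [y]. They gain [2 ^+ (j * 14)], which is at least [j ^+ 14] and hence at least [z ^- 14];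
    summing over the possible values d of [cnt] costs n+1, at most [z ^- 4]. *)
Lemma tail_bound i M a b : (i <= 90)%N -> reg i M -> a != b ->
  ex M (low M a b) <= z ^+ 10.
Proof.
move=> hi rM nab.
have nu2 := nu_ge2 cx; have n0 := n_gt0 cx; have z0 := z_gt0 cx.
have nu0 : 0 < nu by lra.
have [h|h] := boolP (nz M); last first.
  by rewrite /ex -!/(Nb _) (Nb_eq0 h) invr0 mulr0 exprn_ge0 // ltW.
pose y := n%:R / (14 * 64 * nu).
have y0 : 0 <= y by rewrite divr_ge0 // ?ltW //; lra.
have yn : y <= n%:R by rewrite ler_pdivrMr; nra.
have [j /andP[j1 j2]] := nat_floor y0 yn.
have zj : 2 * z^-1 <= y.
  rewrite ler_pdivlMr; last lra.
  apply: (ob_le_n cx (k := -1) (c := 1800)) => //; obt.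
have zi2 : 1 <= z^-1 by rewrite invf_ge1 // (scale_z1 sc).
have zj' : z^-1 <= j%:R by move: j2; rewrite -natr1; lra.
have two_j : z ^- 14 <= (2 : R) ^+ (j * 14).
  apply: le_trans (pow2_ge _ _); rewrite -exprVn; apply: lerXn2r => //.
    by rewrite nnegrE invr_ge0 ltW.
  by rewrite nnegrE.
have two_j0 : 0 < (2 : R) ^+ (j * 14) by rewrite exprn_gt0.
have step (d : nat) : d%:R <= n%:R / (64 * nu) -> atw M a b d%:R <= z ^+ 14 * Nb M.
  move=> hd; have := @at_pow i M a b d%:R (j * 14) hi rM nab (ler0n _ _).
  have -> : n%:R / (32 * nu) = n%:R / (64 * nu) + n%:R / (64 * nu) by field; rewrite gt_eqF.
  rewrite natrM; have hj : j%:R * 14 <= n%:R / (64 * nu).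
    have -> : n%:R / (64 * nu) = y * 14 by rewrite /y; field; rewrite gt_eqF.
    by lra.
  move=> /(_ (lerD hd hj)) h1.
  apply: le_trans (_ : (2 ^+ (j * 14))^-1 * Nb M <= _).
    by rewrite ler_pdivlMl.
  rewrite ler_wpM2r ?Nb_ge0 // -[leRHS]invrK lef_pV2 ?posrE // ?invr_gt0 ?exprn_gt0 //.
rewrite /ex ler_pdivrMr ?Nb_gt0 //.
apply: (@le_trans _ _ (\sum_(d < n.+1 | d%:R <= n%:R / (64 * nu) :> R) atw M a b d%:R)).
  rewrite /atw exchange_big; apply: ler_sum => G _ /=.
  rewrite /low /atd; have [d [e dn]] := cnt_nat (mH M) b a G.
  case: (boolP (cnt (mH M) b a G <= n%:R / (64 * nu))%R) => hl; last by (apply: sumr_ge0 => d0 _; exact: ler0n).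
  rewrite (bigD1 (inord d)) /= ?inordK ?ltnS -?e //.
  by rewrite eqxx lerDl sumr_ge0 // => *; exact: ler0n.
apply: (@le_trans _ _ (\sum_(d < n.+1) z ^+ 14 * Nb M)).
  rewrite big_mkcond; apply: ler_sum => d _; case: ifP => hd; first exact: step.
  by rewrite mulr_ge0 ?Nb_ge0 // exprn_ge0 // ltW.
rewrite sumr_const card_ord -(mulr_natr (z ^+ 14 * _)) mulrAC ler_wpM2r ?Nb_ge0 //.
have zz : n%:R * z ^+ 2 = 1 := scale_n sc.
have n1 : 1 <= n%:R :> R by rewrite ler1n -(ltr0n R).
have : n.+1%:R * z ^+ 4 <= 1.
  rewrite -natr1 (_ : _ * _ = (n%:R * z ^+ 2) * z ^+ 2 + z ^+ 4); last by ring.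
  rewrite zz mul1r; apply: le_trans (_ : z ^+ 2 * 2 <= 1).
    have : z ^+ 4 <= z ^+ 2 by apply: ler_wiXn2l; rewrite ?(ltW z0) ?(scale_z1 sc).
    by lra.
  suff : z <= 1 / 2 by move=> hz; nra.
  have h1 : ob 1 2 (2 * z) by obt.
  have := ob_small sc bigE (csm cx) h1 isT isT.
  by rewrite gtr0_norm ?mulr_gt0 //; lra.
have z10 : 0 <= z ^+ 10 by rewrite exprn_ge0 // ltW.
by rewrite (_ : 14 = 10 + 4)%N // exprD => hh; nra.
Qed.
End TailBound.

End SwitchTail.
Import SwitchTail.

(** * The ratio of two neighbouring counts as an expectation *)

Module RatioBase.

Section Level0.
Variables (R : realFieldType) (n : nat) (nu z p : R).
Hypothesis cx : ctx n nu z p.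
Local Notation cell := ('I_n * 'I_n)%type.
Implicit Types (G H : {set cell}) (a b k l : 'I_n).
Local Notation model := (model R n).
Implicit Types (M U : model).
Local Notation ind := (@indc R n).
Local Notation cnt := (@cnt R n).
Local Notation rd := (@rd R n).
Local Notation cd := (@cd R n).
Local Notation ob := (ob nu z).
Local Notation reg := (@reg R n nu z p).
Let sc := cs cx.

Lemma ob_index i : (i <= 128)%N -> ob 0 7 i%:R.
Proof.
move=> hi; apply: (ob_le sc (ob_nat sc i)) => //; exact: leq_trans (leq_up_log _ hi) _.
Qed.

Definition ee (i : nat) := nu / z + i%:R.
Lemma ob_ee i : (i <= 128)%N -> ob (-1) 8 (ee i).
Proof. by move=> /ob_index h; rewrite /ee; obt. Qed.

Lemma ee_ge0 i : 0 <= ee i.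
Proof.
have := nu_ge2 cx; have := z_gt0 cx => h1 h2.
by rewrite addr_ge0 ?ler0n // divr_ge0 ?ltW //; lra.
Qed.

Lemma reg_gen i j M M' : reg i M ->
  (forall a, `|ms M' a - ms M a| <= j%:R) -> (forall k, `|mt M' k - mt M k| <= j%:R) ->
  (forall a, rd (mH M') a <= rd (mH M) a + j%:R) ->
  (forall a, cd (mH M') a <= cd (mH M) a + j%:R) ->
  \sum_a rd (mH M') a <= \sum_a rd (mH M) a + j%:R ->
  `|\sum_a ms M' a - \sum_a ms M a| <= j%:R ->
  `|\sum_a mt M' a - \sum_a mt M a| <= j%:R -> reg (i + j) M'.
Proof.
have tri (x y w : R) I : `|x - y| <= j%:R -> `|y - w| <= I -> `|x - w| <= I + j%:R.
  move=> h1 h2; rewrite (_ : x - w = (y - w) + (x - y)); last by ring.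
  exact: le_trans (ler_normD _ _) (lerD h2 h1).
case=> h1 h2 h3 h4 h5 h6 h7 g1 g2 g3 g4 g5 g6 g7; split; rewrite natrD ?addrA.
- by move=> a; apply: tri (g1 a) (h1 a).
- by move=> a; apply: tri (g2 a) (h2 a).
- by move=> a; apply: le_trans (g3 a) _; rewrite lerD2r.
- by move=> a; apply: le_trans (g4 a) _; rewrite lerD2r.
- by apply: le_trans g5 _; rewrite lerD2r.
- exact: tri g6 h6.
- exact: tri g7 h7.
Qed.

Lemma sum_dec (f : 'I_n -> R) a : \sum_j decf f a j = \sum_j f j - 1.
Proof. by rewrite sumrB sum_eqr. Qed.

Lemma sum_inc (f : 'I_n -> R) a : \sum_j incf f a j = \sum_j f j + 1.
Proof. by rewrite big_split /= sum_eqr. Qed.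

Lemma b01 (b : bool) : 0 <= (b%:R : R) <= 1. Proof. by case: b; rewrite !lexx ler01. Qed.

Lemma reg_rem i M c : c \notin mH M -> reg i M -> reg (i + 1) (rem c M).
Proof.
move=> hc rM; apply: reg_gen rM _ _ _ _ _ _ _ => /=.
- by move=> a; rewrite /decf addrAC subrr sub0r normrN normr_nat ler_nat; case: eqP.
- by move=> a; rewrite /decf addrAC subrr sub0r normrN normr_nat ler_nat; case: eqP.
- by move=> a; rewrite rd_add // lerD2l ler_nat; case: eqP.
- by move=> a; rewrite cd_add // lerD2l ler_nat; case: eqP.
- by under eq_bigr do rewrite rd_add //; rewrite big_split /= sum_eqr.
- by rewrite sum_dec addrAC subrr sub0r normrN normr1.
- by rewrite sum_dec addrAC subrr sub0r normrN normr1.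
Qed.

Lemma reg_fb i M c : c \notin mH M -> reg i M -> reg (i + 1) (fb c M).
Proof.
move=> hc rM; apply: reg_gen rM _ _ _ _ _ _ _ => /=; rewrite ?subrr ?normr0 //.
- by move=> a; rewrite subrr normr0.
- by move=> a; rewrite subrr normr0.
- by move=> a; rewrite rd_add // lerD2l ler_nat; case: eqP.
- by move=> a; rewrite cd_add // lerD2l ler_nat; case: eqP.
- by under eq_bigr do rewrite rd_add //; rewrite big_split /= sum_eqr.
Qed.

(* Strictly speaking [\sum_j ms] and [\sum_k mt] then differ: [mv a U] is the
   consistent model. *)
Lemma reg_mv i U a : reg i U -> reg (i + 1) (mv a U).
Proof.
move=> rM; apply: reg_gen rM _ _ _ _ _ _ _ => /=; rewrite ?subrr ?normr0 ?lerDl ?ler0n //.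
- by move=> j; rewrite /incf addrAC subrr add0r normr_nat ler_nat; case: eqP.
- by move=> j; rewrite subrr normr0.
- by move=> j; rewrite lerDl.
- by move=> j; rewrite lerDl.
- by rewrite sum_inc addrAC subrr add0r normr1.
Qed.

(** The model [U] of [pr_sub]. *)
Definition Urow M a b k := Mod (decf (decf (ms M) a) b) (decf (mt M) k)
  ((a, k) |: ((b, k) |: mH M)).

Lemma reg_U i M a b k : a != b -> (a, k) \notin mH M -> (b, k) \notin mH M ->
  reg i M -> reg (i + 2) (Urow M a b k).
Proof.
move=> ab ha hb rM.
have ha' : (a, k) \notin (b, k) |: mH M.
  by rewrite in_setU1 negb_or ha xpair_eqE (negbTE ab).
apply: reg_gen rM _ _ _ _ _ _ _ => /=.
- move=> j; rewrite /decf.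
  have /andP[? ?] := b01 (j == a); have /andP[? ?] := b01 (j == b).
  by rewrite ler_norml; lra.
- move=> j; rewrite /decf; have /andP[? ?] := b01 (j == k).
  by rewrite ler_norml; lra.
- move=> j; rewrite !rd_add //= -addrA lerD2l.
  by have /andP[? ?] := b01 (j == a); have /andP[? ?] := b01 (j == b); lra.
- move=> j; rewrite !cd_add //= -addrA lerD2l.
  by have /andP[? ?] := b01 (j == k); lra.
- under eq_bigr do rewrite !rd_add //; rewrite !big_split /= !sum_eqr; lra.
- by rewrite !sum_dec ler_norml; lra.
- by rewrite !sum_dec ler_norml; lra.
Qed.

(** Chosen so that [cnt a b / (cnt b a + 1) = 1 + Vst / Dst]. The common columns of the two rows
    cancel in [Vst], which leaves at most four times [nu / z + i], whereas [Dst] is typically of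
    order n up to powers of [nu]. *)
Definition Vst U a b G := cnt (mH U) a b G - cnt (mH U) b a G - 1.
Definition Dst U a b G := cnt (mH U) b a G + 1.
Definition rat U a b := Nb (mv b U) / Nb (mv a U).

Lemma VstE U a b G : a != b -> G \in gs (mv a U) ->
  Vst U a b G = ms U a - ms U b + fH R (mH U) a b G - fH R (mH U) b a G.
Proof.
move=> ab hG; rewrite /Vst (cntE a b hG) (cntE b a hG) (kapC _ a b) /= /incf eqxx.
by rewrite (eq_sym b) (negbTE ab) /=; ring.
Qed.

Lemma Vst_le i U a b G : a != b -> reg i U -> G \in gs (mv a U) ->
  `|Vst U a b G| <= 4 * ee i.
Proof.
move=> ab rU hG; rewrite VstE //.
have := rs rU a; have := rs rU b; have := rx rU a; have := rx rU b.
have := fH_ge0 R (mH U) a b G; have := fH_le R (mH U) a b G.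
have := fH_ge0 R (mH U) b a G; have := fH_le R (mH U) b a G.
by rewrite -/(ee i) !ler_norml => ? ? ? ? ? ? /andP[? ?] /andP[? ?]; lra.
Qed.

Lemma Dst_ge1 U a b G : 1 <= Dst U a b G.
Proof. by rewrite lerDr cnt_ge0. Qed.

(** As [1 / Dst] never exceeds 1, the graphs with small denominator enter only through the indicator
    [low], whose mean is at most [z ^+ 10]. *)
Lemma Dst_inv U a b G :
  (Dst U a b G)^-1 <= 64 * nu * z ^+ 2 + low nu (mv a U) a b G.
Proof.
have nu2 := nu_ge2 cx; have z0 := z_gt0 cx; have n0 := n_gt0 cx.
have d1 := Dst_ge1 U a b G; have d0 : 0 < Dst U a b G by lra.
rewrite /low /=; case: (lerP (cnt (mH U) b a G)) => h /=.
  have : (Dst U a b G)^-1 <= 1 by rewrite invf_le1.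
  have : 0 <= 64 * nu * z ^+ 2 by rewrite !mulr_ge0 ?exprn_ge0 // ltW //; lra.
  by lra.
rewrite [X in _ <= _ + X](_ : _ = 0) // addr0 -[leRHS]invrK lef_pV2 ?posrE //; last first.
  by rewrite invr_gt0 !mulr_gt0 ?exprn_gt0 //; lra.
apply: le_trans (_ : cnt (mH U) b a G <= _); last by rewrite /Dst lerDl.
suff -> : (64 * nu * z ^+ 2)^-1 = n%:R / (64 * nu) by exact: ltW.
by rewrite (z2n cx); field; rewrite !gt_eqF //; lra.
Qed.

(* The term [z ^+ 10] accounts for the graphs of the target model that no move reaches. *)
Lemma rat_ex i U a b : (i <= 80)%N -> a != b -> reg i U -> nz (mv a U) ->
  `|rat U a b - 1 - ex (mv a U) (fun G => Vst U a b G / Dst U a b G)| <= z ^+ 10 * rat U a b.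
Proof.
move=> hi ab rU h; have N0 := Nb_gt0 h.
have id := move_identity U ab.
set Z := \sum_(G in gs (mv b U)) _ in id.
have Z0 : 0 <= Z by apply: sumr_ge0 => G _; exact: ler0n.
have hZ : Z <= z ^+ 10 * Nb (mv b U).
  have hi' : (i + 1 <= 90)%N by lia.
  have := tail_bound cx hi' (reg_mv b rU) ab.
  have [hb|hb] := boolP (nz (mv b U)).
    rewrite /ex ler_pdivrMr ?Nb_gt0 //; apply: le_trans.
    apply: ler_sum => G _; rewrite ler_nat /low /=; case: eqP => // ->.
    have -> // : (0 <= n%:R / (64 * nu) :> R); rewrite divr_ge0 ?mulr_ge0 //.
    by have := nu_ge2 cx; lra.
  rewrite (Nb_eq0 hb) mulr0 => _; rewrite /Z big_pred0 // => G.
  by move: hb; rewrite /nz -leqNgt leqn0 cards_eq0 => /eqP ->; rewrite inE.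
have e : (rat U a b - 1 - ex (mv a U) (fun G => Vst U a b G / Dst U a b G)) = Z / Nb (mv a U).
  apply: (mulIf (lt0r_neq0 N0)); rewrite divfK ?lt0r_neq0 // 2!mulrBl ex_Nb /rat divfK ?lt0r_neq0 //.
  rewrite mul1r -[in LHS](subrK Z (Nb (mv b U))) id [X in _ - X - _]Nb_sum.
  rewrite [X in X - _ - _]addrC -addrA -addrA -opprD -big_split /= -sumrB.
  rewrite big1 ?addr0 // => G _; rewrite /Vst /Dst.
  by field; rewrite gt_eqF // ltr_wpDl ?cnt_ge0.
rewrite e ger0_norm ?divr_ge0 ?Nb_ge0 // /rat mulrA ler_wpM2r // invr_ge0 Nb_ge0 //.
Qed.

Lemma rat_ge0 U a b : 0 <= rat U a b. Proof. by rewrite divr_ge0 ?Nb_ge0. Qed.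


Lemma rat_0 i U a b : (i <= 80)%N -> a != b -> reg i U -> nz (mv a U) ->
  ob 1 40 (rat U a b - 1).
Proof.
move=> hi ab rU h; have h1 := rat_ex hi ab rU h.
set E := ex _ _ in h1; set r := rat U a b in h1 *.
have z0 := z_gt0 cx; have nu2 := nu_ge2 cx.
have hE : ob 1 30 E.
  have hi' : (i + 1 <= 90)%N by lia.
  have tb := tail_bound cx hi' (reg_mv a rU) ab.
  apply: (@ob_of_le _ _ _ _ _ _ (4 * ee i * (64 * nu * z ^+ 2 + z ^+ 10))).
    apply: le_trans (ex_norm _ _) _.
    apply: (@le_trans _ _ (ex (mv a U) (fun G => 4 * ee i * (64 * nu * z ^+ 2 + low nu (mv a U) a b G)))).
      apply: ex_le => G hG; rewrite normrM normfV.
      have d1 := Dst_ge1 U a b G; rewrite (ger0_norm (_ : 0 <= Dst U a b G)); last by lra.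
      apply: ler_pM => //; [by rewrite invr_ge0; lra|exact: Vst_le|exact: Dst_inv].
    rewrite exZ exD ex_cst // ler_wpM2l ?lerD2l ?mulr_ge0 // ?ee_ge0 //.
  have he : ob (-1) 8 (ee i) by apply: ob_ee; lia.
  obt.
have hz : z ^+ 10 <= 1 / 4.
  have h2 : ob 1 4 (4 * z ^+ 10) by obt.
  have := ob_small sc bigE (csm cx) h2 isT isT.
  by rewrite gtr0_norm ?mulr_gt0 ?exprn_gt0 //; lra.
have hE4 : `|E| <= 1.
  exact (ob_small sc bigE (csm cx) hE isT isT).
(* An a priori bound on the ratio, which turns the error [z ^+ 10 * r] into a multiple of
   [z ^+ 10]. *)
have r4 : r <= 4.
  by move: h1 hE4; rewrite !ler_norml => /andP[? ?] /andP[? ?]; have := rat_ge0 U a b; rewrite -/r => ?; nra.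
have hr : ob 1 4 (r - 1 - E).
  apply: (@ob_of_le _ _ _ _ _ _ (z ^+ 10 * 4)).
    by apply: le_trans h1 _; rewrite ler_wpM2l // exprn_ge0 // ltW.
  obt.
by rewrite (_ : r - 1 = (r - 1 - E) + E); [obt | ring].
Qed.
End Level0.

End RatioBase.
Import RatioBase.

(** * Occupation probabilities to leading order, and nonemptiness under conditioning *)

Module FirstOrder.

Section Step.
Variables (R : realFieldType) (n : nat) (nu z p : R).
Hypothesis cx : ctx n nu z p.
Local Notation cell := ('I_n * 'I_n)%type.
Implicit Types (G H : {set cell}).
Local Notation model := (model R n).
Implicit Types (M U : model).
Local Notation ind := (@indc R n).
Local Notation cnt := (@cnt R n).
Local Notation fr := (@fr R n).
Local Notation rd := (@rd R n).
Local Notation cd := (@cd R n).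
Local Notation ob := (ob nu z).
Local Notation reg := (@reg R n nu z p).
Local Notation ee := (@ee R nu z).
Let sc := cs cx.

(** This is [ms M a - p * (n - x)] with x forbidden cells in row [a]: the surplus over density p on
    the allowed cells, and the delta of the theorem when p is lambda. [P1h] spreads the surpluses of
    row and column evenly over their cells. *)
Definition dl M a := ms M a - p * n%:R + p * rd (mH M) a.
Definition et M k := mt M k - p * n%:R + p * cd (mH M) k.
Definition P1h M a k := p + (dl M a + et M k) * z ^+ 2.

Lemma ob_p : ob 0 0 p.
Proof. by apply: ob_unit; have := cp0 cx; have := cp1 cx => *; rewrite ler_norml; lra. Qed.

Lemma ob_abs_le (e x : R) k c : ob k c e -> `|x| <= e -> ob k c x.
Proof. by move=> h1 h2; apply: ob_of_le h2 h1. Qed.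

Lemma ob_w : ob 0 1 (p * (1 - p))^-1.
Proof.
have := cw cx; have p0 := cp0 cx; have p1 := cp1 cx.
have h : 0 < p * (1 - p) by rewrite mulr_gt0 // subr_gt0.
by move=> h2; rewrite /OrderBounds.ob expr1 expr0z mulr1 gtr0_norm ?invr_gt0 // -div1r ler_pdivrMr.
Qed.

Section Reg.
Variables (i : nat) (M : model).
Hypotheses (hi : (i <= 128)%N) (rM : reg i M).

Lemma ob_s a : ob (-1) 8 (ms M a - p * n%:R).
Proof. by apply: ob_abs_le (ob_ee cx hi) _; apply: rs rM a. Qed.
Lemma ob_t a : ob (-1) 8 (mt M a - p * n%:R).
Proof. by apply: ob_abs_le (ob_ee cx hi) _; apply: rt rM a. Qed.
Lemma ob_x a : ob (-1) 8 (rd (mH M) a).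
Proof. by apply: ob_abs_le (ob_ee cx hi) _; rewrite ger0_norm ?rd_ge0 //; apply: rx rM a. Qed.
Lemma ob_y a : ob (-1) 8 (cd (mH M) a).
Proof. by apply: ob_abs_le (ob_ee cx hi) _; rewrite ger0_norm ?cd_ge0 //; apply: ry rM a. Qed.
Lemma ob_dl a : ob (-1) 9 (dl M a).
Proof. by have := ob_s a; have := ob_x a; have := ob_p => *; rewrite /dl; obt. Qed.
Lemma ob_et a : ob (-1) 9 (et M a).
Proof. by have := ob_t a; have := ob_y a; have := ob_p => *; rewrite /et; obt. Qed.
Lemma ob_P1h a k : ob 1 11 (P1h M a k - p).
Proof.
have := ob_dl a; have := ob_et k => *.
by rewrite /P1h addrAC subrr add0r; obt.
Qed.

Lemma ob_ny k : ob 2 1 (n%:R - cd (mH M) k)^-1.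
Proof.
apply: (ob_inv sc (k := -2)); rewrite -(n_z cx) expr1.
have nu2 := nu_ge2 cx; have n0 := n_gt0 cx.
have h : 2 * cd (mH M) k <= n%:R.
  by apply: (ob_le_n cx (k := -1) (c := 20)) => //; have := ob_y k => *; obt.
apply: le_trans (_ : n%:R / 2 <= _).
  by rewrite mulrC ler_pM2l // lef_pV2 ?posrE //; lra.
by apply: le_trans (ler_norm _); lra.
Qed.
End Reg.

Lemma small_lt c (x y : R) : ob 1 c x -> (c.+2 <= bigE)%N -> nu ^- 1 <= y -> 2 * x <= y.
Proof.
move=> h hc hy; have nu2 := nu_ge2 cx; have z0 := z_gt0 cx.
suff : `|2 * nu * x| <= 1.
  rewrite ler_norml => /andP[_ h1]; apply: le_trans hy; rewrite expr1.
  by rewrite -[leRHS]mul1r ler_pdivlMr ?(mulrAC 2 x) //; lra.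
have h2 : ob 1 (c.+2) (2 * nu * x) by eapply (ob_le sc); [obr | by [] | lia].
exact (ob_small sc bigE (csm cx) h2 hc isT).
Qed.

Lemma nu_p : nu ^- 1 <= p /\ nu ^- 1 <= 1 - p.
Proof.
have nu2 := nu_ge2 cx; have := cw cx; have p0 := cp0 cx; have p1 := cp1 cx => h.
rewrite expr1 -div1r !ler_pdivrMr; try lra.
split; apply: le_trans h _.
  by rewrite mulrC ler_pM2r; [nra | lra].
by rewrite mulrC ler_pM2r; [nra | lra].
Qed.

(** The ratio of the two counts is close to 1, hence not 0. *)
Lemma nz_mv i U a b : (i <= 80)%N -> a != b -> reg i U -> nz (mv a U) -> nz (mv b U).
Proof.
move=> hi ab rU h; have := rat_0 cx hi ab rU h => h1.
have h2 : ob 1 42 (- 2 * (rat U a b - 1)) by obt.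
have := ob_small sc bigE (csm cx) h2 isT isT.
rewrite ler_norml => /andP[_ h3].
have : 0 < rat U a b by lra.
rewrite /rat; have [//|hb] := boolP (nz (mv b U)).
by rewrite (Nb_eq0 hb) mul0r ltxx.
Qed.

(** Does not suppose that the models with [(b, k)] occupied are nonempty: that follows from [pr_0],
    whose proof uses this lemma. If [mv a U] is empty, so is [mv b U], and both sides vanish. *)
Lemma pr_diff_aux i M a b k : (i <= 78)%N -> a != b -> reg i M -> nz M ->
  (a, k) \notin mH M -> (b, k) \notin mH M ->
  let U := Urow M a b k in
  pr M (a, k) - pr M (b, k) = (rat U a b - 1) * (Nb (fb (a, k) (rem (b, k) M)) / Nb M).
Proof.
move=> hi ab rM h ha hb U.
have [e1 e2] := pr_sub ab ha hb; rewrite -/(Urow M a b k) -/U in e1 e2.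
have rU : reg (i + 2) U by apply: reg_U.
have N0 := Nb_gt0 h.
apply: (mulIf (lt0r_neq0 N0)); rewrite e1 -e2 mulrA divfK ?lt0r_neq0 //.
have [h1|h1] := boolP (nz (mv a U)).
  by rewrite /rat mulrBl mul1r divfK // lt0r_neq0 // Nb_gt0.
have hb' : ~~ nz (mv b U).
  apply: contra h1; apply: (nz_mv (i := i + 2)) => //; first lia.
  by rewrite eq_sym.
by rewrite !Nb_eq0 // subrr mulr0.
Qed.

(** All differences in [pr_identity] are O(z), so each probability is within O(z) of the average
    over the allowed cells of its column, which is p + O(z). *)
Lemma pr_0 i M a k : (i <= 78)%N -> reg i M -> nz M -> (a, k) \notin mH M ->
  ob 1 50 (pr M (a, k) - p).
Proof.
move=> hi rM h ha; have hi' : (i <= 128)%N by lia.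
have id := pr_identity h ha.
have hny := ob_ny hi' rM k; have hy := ob_y hi' rM k; have ht := ob_t hi' rM k.
have hp := ob_p.
have hS : ob (-1) 40 (\sum_(b | (b, k) \notin mH M) (pr M (a, k) - pr M (b, k))).
  apply: (ob_sum sc (k := 1)) => [|b hb]; first by rewrite card_ord.
  have [<-|ab] := eqVneq a b; first by rewrite subrr; apply: (ob_le sc (ob0 sc 1)).
  rewrite (pr_diff_aux hi ab rM h ha hb).
  have [h1|h1] := boolP (nz (mv a (Urow M a b k))); last first.
    have [_ <-] := pr_sub ab ha hb; rewrite (Nb_eq0 h1) mul0r mulr0.
    exact: (ob_le sc (ob0 sc 1)).
  have hr : ob 1 40 (rat (Urow M a b k) a b - 1).
    by apply: (rat_0 cx (i := i + 2)) => //; [lia | apply: reg_U].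
  rewrite -[40%N]addn0 -[1%R]addr0; apply: (obM sc) hr _; apply: ob_unit.
  have [_ <-] := pr_sub ab ha hb; have [_ e] := pr_sub ab ha hb.
  rewrite e ger0_norm ?divr_ge0 ?Nb_ge0 // ler_pdivrMr ?Nb_gt0 // mul1r ler_nat.
  apply: leq_trans (_ : #|gs (rem (b, k) M)| <= _)%N.
    by apply/subset_leq_card/subsetP => G; rewrite gs_fb => /andP[].
  by rewrite -(ler_nat R) -!/(Nb _) -pr_Nb // ler_piMl ?Nb_ge0 ?pr_le1.
have nz0 : n%:R - cd (mH M) k != 0.
  apply/eqP => e; have := hny; rewrite e.
  have h2 : 2 * cd (mH M) k <= n%:R.
    by apply: (ob_le_n cx (k := -1) (c := 20)) => //; obt.
  have := n_gt0 cx; have := cd_ge0 R (mH M) k; lra.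
have -> : pr M (a, k) - p = ((mt M k - p * n%:R) + p * cd (mH M) k +
   \sum_(b | (b, k) \notin mH M) (pr M (a, k) - pr M (b, k))) * (n%:R - cd (mH M) k)^-1.
  by rewrite -id; field.
obt.
Qed.

(** P is within O(z) of p, while p and 1 - p are at least [1 / nu], so both outcomes of a
    conditioning have positive probability. *)
Lemma nz_step i M c : (i <= 78)%N -> reg i M -> nz M -> c \notin mH M ->
  nz (rem c M) /\ nz (fb c M).
Proof.
case: c => a k hi rM h ha; have h0 := pr_0 hi rM h ha.
have [q1 q2] := nu_p; have p0 := cp0 cx; have p1 := cp1 cx.
have h1 : 2 * (pr M (a, k) - p) <= 1 - p by apply: small_lt h0 _ q2.
have h2 : 2 * (- (pr M (a, k) - p)) <= p by apply: small_lt (obN h0) _ q1.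
by split; [apply: nz_rem => //; lra | apply: nz_fb => //; lra].
Qed.

Lemma pr_diff i M a b k : (i <= 77)%N -> a != b -> reg i M -> nz M ->
  (a, k) \notin mH M -> (b, k) \notin mH M ->
  pr M (a, k) - pr M (b, k) = (rat (Urow M a b k) a b - 1) *
     (pr M (b, k) * (1 - pr (rem (b, k) M) (a, k)))
  /\ nz (mv a (Urow M a b k)).
Proof.
move=> hi ab rM h ha hb; have hi' : (i <= 78)%N by lia.
have [h1 _] := nz_step hi' rM h hb.
have e : Nb (fb (a, k) (rem (b, k) M)) = pr M (b, k) * (1 - pr (rem (b, k) M) (a, k)) * Nb M.
  by rewrite -pr_fb // -pr_Nb //; ring.
split.
  by rewrite (pr_diff_aux hi' ab rM h ha hb) e mulfK // lt0r_neq0 // Nb_gt0.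
rewrite /nz -(ltr0n R) -/(Nb _); have [_ ->] := pr_sub ab ha hb; rewrite ltr0n.
have ha' : (a, k) \notin mH (rem (b, k) M).
  by rewrite in_setU1 negb_or ha xpair_eqE (negbTE ab).
have hi1 : (i + 1 <= 78)%N by lia.
by have [] := nz_step hi1 (reg_rem hb rM) h1 ha'.
Qed.
End Step.

End FirstOrder.
Import FirstOrder.

(** * From an estimate of probabilities to a sharper estimate of ratios *)

Module RatioEstimate.

Section RatStep.
Variables (R : realFieldType) (n : nat) (nu z p : R).
Hypothesis cx : ctx n nu z p.
Local Notation cell := ('I_n * 'I_n)%type.
Implicit Types (G H : {set cell}).
Local Notation model := (model R n).
Implicit Types (M U : model).
Local Notation ind := (@indc R n).
Local Notation cnt := (@cnt R n).
Local Notation fr := (@fr R n).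
Local Notation rd := (@rd R n).
Local Notation cd := (@cd R n).
Local Notation ob := (ob nu z).
Local Notation reg := (@reg R n nu z p).
Local Notation ee := (@ee R nu z).
Local Notation P1h := (@P1h R n z p).
Local Notation dl := (@dl R n p).
Local Notation et := (@et R n p).
Let sc := cs cx.

Lemma reg_le i j M : (i <= j)%N -> reg i M -> reg j M.
Proof.
move=> ij; have h : i%:R <= j%:R :> R by rewrite ler_nat.
by case=> h1 h2 h3 h4 h5 h6 h7; split=> [a|a|a|a|||];
  first [apply: le_trans (h1 a) _|apply: le_trans (h2 a) _|apply: le_trans (h3 a) _
        |apply: le_trans (h4 a) _|apply: le_trans h5 _|apply: le_trans h6 _|apply: le_trans h7 _];
  rewrite ?lerD2l.
Qed.

Lemma P1h_rem M c r l : c \notin mH M ->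
  P1h (rem c M) r l - P1h M r l = - (((r == c.1)%:R + (l == c.2)%:R) * (1 - p) * z ^+ 2).
Proof. by move=> h; rewrite /FirstOrder.P1h /FirstOrder.dl /FirstOrder.et /= rd_add // cd_add // /decf; ring. Qed.

Lemma P1h_fb M c r l : c \notin mH M ->
  P1h (fb c M) r l - P1h M r l = ((r == c.1)%:R + (l == c.2)%:R) * p * z ^+ 2.
Proof. by move=> h; rewrite /FirstOrder.P1h /FirstOrder.dl /FirstOrder.et /= rd_add // cd_add //; ring. Qed.

Lemma ob_P1h_rem M c r l : c \notin mH M -> ob 2 3 (P1h (rem c M) r l - P1h M r l).
Proof. by move=> h; rewrite P1h_rem //; have := ob_p cx => *; obt. Qed.

Lemma ob_P1h_fb M c r l : c \notin mH M -> ob 2 3 (P1h (fb c M) r l - P1h M r l).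
Proof. by move=> h; rewrite P1h_fb //; have := ob_p cx => *; obt. Qed.

(** The bootstrap hypothesis. It quantifies over all models of slack [j], so that it applies to
    conditioned models too. *)
Definition approx1 j k c := forall M a l, reg j M -> nz M -> (a, l) \notin mH M ->
  ob k c (pr M (a, l) - P1h M a l).

Section Fix.
Variables (k : int) (c i : nat) (U : model) (a b : 'I_n).
Hypotheses (hk : k = 1 \/ k = 2) (hi : (i <= 70)%N) (rU : reg i U) (ab : a != b).
Hypotheses (HP : approx1 (i + 4) k c).
Let M := mv a U.
Let H := mH U.
Hypothesis nzM : nz M.
Let Q := P1h M.

(** Satisfied by [mv a U] and by the models obtained from it by conditioning on one cell, or on the
    two cells of a move. On all of these [P1h] varies by O(z^2) only, so the single reference [Q]
    serves every one of them. *)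
Definition near M' := [/\ reg (i + 3) M', nz M', {subset H <= mH M'},
  forall r l, ob 2 5 (P1h M' r l - Q r l) & forall r, rd (mH M') r <= rd H r + 2].

Lemma near_M : near M.
Proof.
split=> // [|r l|r]; first by apply: reg_le _ (reg_mv a rU); lia.
  by rewrite subrr; apply: (ob_le sc (ob0 sc 2)).
by rewrite lerDl.
Qed.

Lemma regM1 : reg (i + 1) M. Proof. exact: reg_mv. Qed.

Lemma rd_add_le c0 H0 r : c0 \notin H0 -> rd (c0 |: H0) r <= rd H0 r + 1.
Proof. by move=> h; rewrite rd_add // lerD2l; case: (r == _). Qed.

Lemma near_rem c0 : c0 \notin H -> near (rem c0 M).
Proof.
move=> h0'; have h0 : c0 \notin mH M by [].
have [h1 _] := nz_step cx (i := i + 1) ltac:(lia) regM1 nzM h0.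
split=> //.
- by apply: reg_le _ (reg_rem h0 regM1); lia.
- by move=> e he; rewrite in_setU1 he orbT.
- by move=> r l; apply: (ob_le sc (ob_P1h_rem r l h0)).
- by move=> r; apply: le_trans (rd_add_le r h0) _; lra.
Qed.

Lemma pair_notin l H0 : (a, l) \notin H0 -> (a, l) \notin (b, l) |: H0.
Proof. by move=> h; rewrite in_setU1 negb_or h xpair_eqE (negbTE ab). Qed.

Lemma near_fb_rem l : (a, l) \notin H -> (b, l) \notin H -> near (fb (a, l) (rem (b, l) M)).
Proof.
move=> ha hb; have [r1 n1 s1 q1 x1] := near_rem hb.
have ha' : (a, l) \notin mH (rem (b, l) M) by apply: pair_notin.
have r2 := reg_rem (hb : (b, l) \notin mH M) regM1.
have [_ h2] := nz_step cx (i := i + 1 + 1) ltac:(lia) r2 n1 ha'.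
split=> //.
- by apply: reg_le _ (reg_fb ha' r2); lia.
- by move=> e /s1 he; rewrite in_setU1 he orbT.
- move=> r l'; have h3 := ob_P1h_fb r l' ha'.
  have h4 := ob_P1h_rem r l' (hb : (b, l) \notin mH M).
  rewrite /Q (_ : _ - _ = (P1h (fb (a, l) (rem (b, l) M)) r l' - P1h (rem (b, l) M) r l') +
     (P1h (rem (b, l) M) r l' - P1h M r l')); last by ring.
  obt.
- move=> r; apply: le_trans (rd_add_le r ha') _.
  have := rd_add_le r hb; rewrite /= => ?; lra.
Qed.

Lemma ob_Q r l : ob 0 13 (Q r l).
Proof.
have h := ob_P1h cx (i := i + 1) ltac:(lia) regM1 r l.
by have hp := ob_p cx; rewrite (_ : Q r l = (P1h M r l - p) + p); [obt | rewrite /Q; ring].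
Qed.

Lemma near_pr M' r l : near M' -> (r, l) \notin mH M' ->
  ob k (c + 6) (pr M' (r, l) - Q r l).
Proof.
move=> [r1 n1 s1 q1 x1] h; have h1 := HP (reg_le (_ : i + 3 <= i + 4)%N r1) n1 h.
have {}h1 := h1 ltac:(lia); have h2 := q1 r l.
by rewrite (_ : _ - _ = (pr M' (r, l) - P1h M' r l) + (P1h M' r l - Q r l)); [obt2 hk | ring].
Qed.

Lemma near_pr_rem M' r l c0 : near M' -> c0 \notin mH M' -> (r, l) \notin mH (rem c0 M') ->
  ob k (c + 7) (pr (rem c0 M') (r, l) - Q r l).
Proof.
move=> [r1 n1 s1 q1 x1] h0 h.
have [n2 _] := nz_step cx (i := i + 3) ltac:(lia) r1 n1 h0.
have h1 := HP (reg_le (_ : i + 3 + 1 <= i + 4)%N (reg_rem h0 r1)) n2 h.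
have {}h1 := h1 ltac:(lia); have h2 := q1 r l; have h3 := ob_P1h_rem r l h0.
rewrite (_ : _ - _ = (pr (rem c0 M') (r, l) - P1h (rem c0 M') r l) +
   ((P1h (rem c0 M') r l - P1h M' r l) + (P1h M' r l - Q r l))); [obt2 hk | ring].
Qed.

Lemma ex_fr M' l : nz M' -> reg (i + 3) M' -> (a, l) \notin mH M' -> (b, l) \notin mH M' ->
  {subset H <= mH M'} ->
  ex M' (fun G => fr H b a G l) = pr M' (b, l) * (1 - pr (rem (b, l) M') (a, l)).
Proof.
move=> n1 r1 ha hb hs.
have [n2 _] := nz_step cx (i := i + 3) ltac:(lia) r1 n1 hb.
have e : ind H (a, l) = 0 by apply: ind_notin; apply: contra ha; apply: hs.
rewrite (eq_ex (g2 := fun G => ind G (b, l) * (1 - ind G (a, l)))); last first.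
  by move=> G _; rewrite /SwitchIdentities.fr e; ring.
rewrite ex_ind //; congr (_ * _); rewrite exB ex_cst //; congr (_ - _).
by apply: eq_ex => G _; rewrite ind_add_ne // xpair_eqE (negbTE ab).
Qed.

Definition wt l := (1 - ind H (a, l)) * (1 - ind H (b, l)).
(** Mean of [Dst] as predicted by [P1h]: in a column allowed in both rows, [(b, l)] is occupied and
    [(a, l)] empty. *)
Definition Dh := \sum_l wt l * (Q b l * (1 - Q a l)) + 1.

Lemma near_fr M' l : near M' -> (a, l) \notin mH M' -> (b, l) \notin mH M' ->
  ob k (c + 25) (ex M' (fun G => fr H b a G l) - Q b l * (1 - Q a l)).
Proof.
move=> nM ha hb; have [r1 n1 s1 q1 x1] := nM; rewrite ex_fr //.
have h1 := near_pr nM hb; have h2 := near_pr_rem nM hb (pair_notin ha).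
have hQ := ob_Q b l.
have h3 : ob 0 0 (1 - pr (rem (b, l) M') (a, l)).
  by apply: ob_unit; have := pr_ge0 (rem (b, l) M') (a, l); have := pr_le1 (rem (b, l) M') (a, l);
    rewrite ler_norml; lra.
set x := pr M' _ in h1 *; set y := pr _ _ in h2 h3 *.
by rewrite (_ : _ - _ = (x - Q b l) * (1 - y) - Q b l * (y - Q a l)); [obt2 hk | ring].
Qed.

Lemma near_D M' : near M' -> ob (k - 2) (c + 40) (ex M' (Dst U a b) - Dh).
Proof.
move=> nM; have [r1 n1 s1 q1 x1] := nM.
have -> : ex M' (Dst U a b) - Dh =
    \sum_l (ex M' (fun G => fr H b a G l) - wt l * (Q b l * (1 - Q a l))).
  by rewrite /Dst exD ex_cst // /SwitchIdentities.cnt ex_sum /Dh sumrB; ring.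
have [B [hB B0 BE]] : exists B : R, [/\ ob k (c + 25) B, 0 <= B & B = nu ^+ (c + 25) * z ^ k].
  exists (nu ^+ (c + 25) * z ^ k); have := ob_rhs_gt0 sc k (c + 25) => h.
  by split=> //; rewrite /OrderBounds.ob ?ger0_norm // ltW.
(* [E] marks the columns in which conditioning has forbidden cells beyond [H]. It totals at most 4,
   so there a crude bound [nu ^+ 30] is affordable. *)
pose E l := (ind (mH M') (a, l) - ind H (a, l)) + (ind (mH M') (b, l) - ind H (b, l)).
have hE : ob 0 4 (\sum_l E l).
  rewrite /E big_split !sumrB /= -!/(Conditioning.rd _ _ _).
  have mono r : rd H r <= rd (mH M') r.
    apply: ler_sum => l _; rewrite /indc ler_nat.
    by case h: (_ \in H) => //; rewrite (s1 _ h).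
  apply: (ob_abs_le (e := 4)); first obt.
  rewrite ger0_norm; last by have := mono a; have := mono b; lra.
  by have := x1 a; have := x1 b; lra.
apply: (ob_sum_le (G := fun l => B + nu ^+ 30 * E l)) => [l _|]; last first.
  by rewrite big_split /= -mulr_sumr; obt2 hk.
have hE0 : 0 <= E l.
  rewrite /E addr_ge0 // subr_ge0 /indc ler_nat.
    by case h: (_ \in H) => //; rewrite (s1 _ h).
  by case h: (_ \in H) => //; rewrite (s1 _ h).
have nu2 := nu_ge2 cx.
have n30 : 0 <= nu ^+ 30 by rewrite exprn_ge0; lra.
have exc (x : R) : 1 <= E l -> ob 0 30 x -> `|x| <= B + nu ^+ 30 * E l.
  rewrite /OrderBounds.ob expr0z mulr1 => e1 hx; apply: le_trans hx _.
  by rewrite -[leLHS]mulr1 -[leLHS]add0r; apply: lerD => //; apply: ler_wpM2l.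
have hQa := ob_Q a l; have hQb := ob_Q b l.
have hfr : ob 0 0 (ex M' (fun G => fr H b a G l)).
  apply: ob_unit; apply: le_trans (ex_norm _ _) _.
  rewrite -[leRHS](ex_cst 1 n1); apply: ex_le => G _.
  by rewrite ger0_norm ?fr_ge0 // fr_le1.
have hwt : ob 0 2 (wt l) by rewrite /wt /indc; obt.
have [ha|ha] := boolP ((a, l) \in H).
  rewrite /wt (ind_in _ ha) subrr !mul0r subr0 /ex big1 ?mul0r ?normr0 //.
    by rewrite addr_ge0 // mulr_ge0.
  by move=> G _; rewrite /SwitchIdentities.fr (ind_in _ ha); ring.
have [hb|hb] := boolP ((b, l) \in H).
  rewrite /wt (ind_in _ hb) subrr mulr0 !mul0r subr0 /ex big1 ?mul0r ?normr0 //.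
    by rewrite addr_ge0 // mulr_ge0.
  by move=> G hG; rewrite /SwitchIdentities.fr (ind_notin _ (gs_notin hG (s1 _ hb))); ring.
have [ha'|ha'] := boolP ((a, l) \in mH M').
  apply: exc; last obt.
  rewrite /E (ind_in _ ha') (ind_notin _ ha) subr0 lerDl subr_ge0 /indc ler_nat.
  by rewrite (negbTE hb).
have [hb'|hb'] := boolP ((b, l) \in mH M').
  apply: exc; last obt.
  rewrite /E (ind_in _ hb') (ind_notin _ hb) subr0 lerDr subr_ge0 /indc ler_nat.
  by rewrite (negbTE ha).
rewrite /wt (ind_notin _ ha) (ind_notin _ hb) subr0 !mul1r.
by apply: le_trans (near_fr nM ha' hb') _; rewrite -BE lerDl mulr_ge0.
Qed.

Lemma D_shift c0 G : c0 \notin G -> `|Dst U a b (c0 |: G) - Dst U a b G| <= 1.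
Proof.
move=> h; rewrite /Dst opprD addrACA subrr addr0 /SwitchIdentities.cnt -sumrB.
apply: le_trans (ler_norm_sum _ _ _) _; rewrite -(sum_eqr R c0.2); apply: ler_sum => l _.
have [->|ne] := eqVneq l c0.2.
  rewrite [leRHS](_ : _ = 1) // ler_norml; have := fr_ge0 R (mH U) b a (c0 |: G) c0.2; have := fr_le1 R (mH U) b a (c0 |: G) c0.2.
  by have := fr_ge0 R (mH U) b a G c0.2; have := fr_le1 R (mH U) b a G c0.2 => *; lra.
have ne2 r : (r, l) != c0 by case: c0 h ne => x y _ /=; rewrite xpair_eqE => /negbTE ->; rewrite andbF.
by rewrite /SwitchIdentities.fr !ind_add_ne // subrr normr0.
Qed.

Lemma near_Dshift M' c0 : near M' -> c0 \in mH M' ->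
  ob (k - 2) (c + 42) (ex M' (fun G => Dst U a b (c0 |: G) - Dh)).
Proof.
move=> nM h0; have [r1 n1 s1 q1 x1] := nM; have hD := near_D nM.
rewrite (_ : ex _ _ = (ex M' (Dst U a b) - Dh) +
     ex M' (fun G => Dst U a b (c0 |: G) - Dst U a b G)); last first.
  by rewrite -[X in _ - X + _](ex_cst Dh n1) -exB -exD; apply: eq_ex => G _; ring.
have h1 : ob 0 0 (ex M' (fun G => Dst U a b (c0 |: G) - Dst U a b G)).
  apply: ob_unit; apply: le_trans (ex_norm _ _) _.
  rewrite -[leRHS](ex_cst 1 n1); apply: ex_le => G hG; apply: D_shift.
  exact: gs_notin hG h0.
obt2 hk.
Qed.

Lemma ob_pr M' c0 : ob 0 0 (pr M' c0).
Proof. by apply: ob_unit; rewrite ger0_norm ?pr_ge0 ?pr_le1. Qed.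

Lemma cov_cell c0 : ob (k - 2) (c + 42) (ex M (fun G => ind G c0 * (Dst U a b G - Dh))).
Proof.
have [h0|h0] := boolP (c0 \in H).
  rewrite /ex big1 ?mul0r; last by move=> G hG; rewrite (ind_notin _ (gs_notin hG h0)) mul0r.
  by apply: (ob_le sc (ob0 sc (k - 2))).
rewrite ex_ind //; have h1 := near_Dshift (near_rem h0) (setU11 _ _); have h2 := ob_pr M c0.
obt2 hk.
Qed.

Lemma cov_fr l : ob (k - 2) (c + 42) (ex M (fun G => fr H b a G l * (Dst U a b G - Dh))).
Proof.
have z2 : ob (k - 2) (c + 42) 0 by apply: (ob_le sc (ob0 sc (k - 2))).
have [ha|ha] := boolP ((a, l) \in H).
  rewrite /ex big1 ?mul0r // => G hG; rewrite /SwitchIdentities.fr (ind_in _ ha); ring.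
have [hb|hb] := boolP ((b, l) \in H).
  by rewrite /ex big1 ?mul0r // => G hG; rewrite /SwitchIdentities.fr (ind_notin _ (gs_notin hG hb)); ring.
rewrite (eq_ex (g2 := fun G => ind G (b, l) * ((1 - ind G (a, l)) * (Dst U a b G - Dh)))); last first.
  by move=> G _; rewrite /SwitchIdentities.fr (ind_notin _ ha); ring.
rewrite ex_ind //.
have nM := near_fb_rem ha hb.
have [_ n1 _ _ _] := near_rem hb.
rewrite (eq_ex (g2 := fun G => (1 - ind G (a, l)) * (Dst U a b ((b, l) |: G) - Dh))); last first.
  by move=> G _; rewrite ind_add_ne // xpair_eqE (negbTE ab).
rewrite ex_fb //.
have h1 := near_Dshift nM (_ : (b, l) \in _); have {}h1 := h1 ltac:(by rewrite !inE eqxx orbT).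
have h2 := ob_pr M (b, l).
have h3 : ob 0 0 (1 - pr (rem (b, l) M) (a, l)).
  by apply: ob_unit; have := pr_ge0 (rem (b, l) M) (a, l); have := pr_le1 (rem (b, l) M) (a, l);
    rewrite ler_norml; lra.
obt2 hk.
Qed.

Lemma ob_Dh : ob (-2) 40 Dh.
Proof.
have hQ := ob_Q; rewrite /Dh.
by have hwt l : ob 0 2 (wt l); [rewrite /wt /indc; obt | obt].
Qed.

(** One factor [Dst] is written as a sum over columns of move indicators. Weighted with such an
    indicator, [Dst - Dh] becomes its mean in a nearby model, which [near_Dshift] already bounds;
    the n columns then cost [z ^ (-2)]. *)
Lemma var_D : ob (k - 4) (c + 90) (ex M (fun G => (Dst U a b G - Dh) ^+ 2)).
Proof.
have hD := near_D near_M; have hDh := ob_Dh; have hc := cov_fr.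
rewrite (_ : ex _ _ = \sum_l ex M (fun G => fr H b a G l * (Dst U a b G - Dh)) +
   (1 - Dh) * (ex M (Dst U a b) - Dh)); last first.
  rewrite -ex_sum -[X in _ * (_ - X)](ex_cst Dh nzM) -exB -exZ -exD; apply: eq_ex => G _.
  rewrite -mulr_suml (_ : Dst U a b G = \sum_l fr H b a G l + 1) //; ring.
obt2 hk.
Qed.

Definition Vh := ms U a - ms U b + \sum_l ind H (a, l) * ((1 - ind H (b, l)) * Q b l)
   - \sum_l ind H (b, l) * ((1 - ind H (a, l)) * Q a l).

Lemma ob_sumH r (F : 'I_n -> R) k' c' : (forall l, (r, l) \in H -> ob k' c' (F l)) ->
  ob (k' - 1) (c' + 8) (\sum_l ind H (r, l) * F l).
Proof.
move=> hF; apply: (ob_sum_le (G := fun l => ind H (r, l) * (nu ^+ c' * z ^ k'))) => [l _|].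
  rewrite normrM ger0_norm ?ind_ge0 //; case: (boolP ((r, l) \in H)) => h.
    by rewrite (ind_in _ h) !mul1r hF.
  by rewrite (ind_notin _ h) !mul0r.
rewrite -mulr_suml -/(Conditioning.rd _ _ _).
have h1 : ob (-1) 8 (rd H r) by apply: (ob_x cx (i := i) (M := U)) => //; lia.
have h2 : ob k' c' (nu ^+ c' * z ^ k').
  by rewrite /OrderBounds.ob ger0_norm // ltW // (ob_rhs_gt0 sc).
by have := obM sc h1 h2; rewrite (addnC 8%N) (addrC (-1)).
Qed.

Lemma exV_est r r' : ob (k - 1) (c + 30)
  (ex M (fH R H r r') - \sum_l ind H (r, l) * ((1 - ind H (r', l)) * Q r' l)).
Proof.
rewrite /fH ex_sum -sumrB.
rewrite (eq_bigr (fun l => ind H (r, l) * (pr M (r', l) - (1 - ind H (r', l)) * Q r' l))); last first.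
  by move=> l _; rewrite exZ -/(pr M (r', l)); ring.
suff h : ob (k - 1) (c + 6 + 8)
    (\sum_l ind H (r, l) * (pr M (r', l) - (1 - ind H (r', l)) * Q r' l)).
  by apply: (ob_le sc h) => //; lia.
apply: ob_sumH => l _.
have [h|h] := boolP ((r', l) \in H).
  by rewrite (ind_in _ h) subrr mul0r subr0 pr_in //; apply: (ob_le sc (ob0 sc k)).
by rewrite (ind_notin _ h) subr0 mul1r; apply: (near_pr near_M h).
Qed.

Lemma cov_VD r r' : ob (k - 3) (c + 50) (ex M (fun G => fH R H r r' G * (Dst U a b G - Dh))).
Proof.
rewrite (eq_ex (g2 := fun G => \sum_l ind H (r, l) * (ind G (r', l) * (Dst U a b G - Dh)))); last first.
  by move=> G _; rewrite /fH mulr_suml; apply: eq_bigr => l _; rewrite mulrA.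
rewrite ex_sum (eq_bigr _ (fun l _ => exZ M _ _)).
rewrite (_ : k - 3 = (k - 2) - 1); last by ring.
rewrite -[(c + 50)%N]/(c + (42 + 8))%N addnA; apply: ob_sumH => l _; exact: cov_cell.
Qed.

Lemma ob_sumQ r r' : ob (-1) 30 (\sum_l ind H (r, l) * ((1 - ind H (r', l)) * Q r' l)).
Proof.
apply: (ob_le sc (k := 0 - 1) (c := (20 + 8)%N)) => //; apply: ob_sumH => l _.
by have := ob_Q r' l; rewrite /indc => *; obt.
Qed.

Lemma ob_uab : ob (-1) 10 (ms U a - ms U b).
Proof.
have h1 := ob_s cx (i := i) ltac:(lia) rU a; have h2 := ob_s cx (i := i) ltac:(lia) rU b.
by rewrite (_ : _ - _ = (ms U a - p * n%:R) - (ms U b - p * n%:R)); [obt | ring].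
Qed.

Lemma ob_Vh : ob (-1) 35 Vh.
Proof.
have h1 := ob_uab; have h2 := ob_sumQ a b; have h3 := ob_sumQ b a; rewrite /Vh; obt.
Qed.

Lemma Dh_near : ob (-1) 40 (Dh - p * (1 - p) * n%:R).
Proof.
have hp := ob_p cx.
have e : \sum_(l < n) p * (1 - p) = p * (1 - p) * n%:R.
  by rewrite sumr_const card_ord -(mulr_natr (p * _)).
rewrite /Dh -e addrAC -sumrB.
apply: (ob_le sc (k := imin (-1) 0) (c := (maxn 38 0).+1)) => //; apply: (obD sc); last exact: ob1.
have hQ r l : ob 1 11 (Q r l - p) by apply: (ob_P1h cx (i := i + 1) ltac:(lia) regM1 r l).
have hE l : ob 0 1 (ind H (a, l) + ind H (b, l)).
  by rewrite /indc; obt.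
rewrite (eq_bigr (fun l => (1 - wt l) * - (p * (1 - p)) + wt l *
    ((Q b l - p) * (1 - p) - (Q a l - p) * p - (Q b l - p) * (Q a l - p)))); last by move=> l _; ring.
have hw l : ob 0 2 (wt l) by rewrite /wt /indc; obt.
rewrite big_split /= -mulr_suml.
have h1 : ob (-1) 12 (\sum_l (1 - wt l)).
  apply: (ob_sum_le (G := fun l => ind H (a, l) + ind H (b, l))) => [l _|].
    by rewrite /wt; case: (ind01 R H (a, l)) => ->; case: (ind01 R H (b, l)) => ->; rewrite ler_norml; lra.
  rewrite big_split /= -!/(Conditioning.rd _ _ _).
  have ha := ob_x cx (i := i) ltac:(lia) rU a; have hb := ob_x cx (i := i) ltac:(lia) rU b.
  obt.
have h2 : ob (-1) 30 (\sum_l wt l * ((Q b l - p) * (1 - p) - (Q a l - p) * p - (Q b l - p) * (Q a l - p))).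
  obt.
have h3 : ob (-1) 20 ((\sum_l (1 - wt l)) * - (p * (1 - p))) by obt.
exact: (ob_le sc (obD sc h3 h2)).
Qed.

Lemma Dh_ge : p * (1 - p) * n%:R / 2 <= Dh /\ 0 < p * (1 - p) * n%:R / 2.
Proof.
have h := Dh_near; set d := _ - _ in h.
have hpq : nu ^- 1 <= p * (1 - p).
  have := cw cx; have := nu_ge2 cx => nu2 hw; rewrite expr1 -div1r ler_pdivrMr ?(mulrC _ nu) //; lra.
have z0 := z_gt0 cx; have n0 := n_gt0 cx; have nu2 := nu_ge2 cx.
have hd : ob 1 40 (- d * z ^+ 2) by obt.
have := small_lt cx hd isT hpq; have := scale_n sc => nz1 h2.
have pq0 : 0 < p * (1 - p) by apply: lt_le_trans hpq; rewrite expr1 invr_gt0; lra.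
split; last by rewrite divr_gt0 // mulr_gt0.
have : 2 * (- d * z ^+ 2) * n%:R <= p * (1 - p) * n%:R by rewrite ler_pM2r.
have -> : 2 * (- d * z ^+ 2) * n%:R = - 2 * d * (n%:R * z ^+ 2) by ring.
rewrite nz1.
rewrite /d; lra.
Qed.

Lemma ob_Dh_inv : ob 2 2 Dh^-1.
Proof.
have [h1 h2] := Dh_ge; apply: (ob_inv sc (k := -2)); rewrite -(n_z cx).
apply: le_trans (ler_norm _); apply: le_trans h1.
have nu2 := nu_ge2 cx; have := n_pq cx => h3; have n0 := n_gt0 cx.
apply: le_trans (_ : n%:R / nu / 2 <= _); last lra.
rewrite -mulrA mulrC ler_pM2l // expr2 -invfM lef_pV2 ?posrE ?mulr_gt0 //; nra.
Qed.

(** V/D is expanded at ([Vh], [Dh]); the expansion [e] is exact, with remainder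
    [V (D - Dh)^2 / (Dh^2 D)]. Each correction term has order [k + 1], so ratios are known one power
    of [z] better than probabilities. *)
Lemma rat_est : ob (k + 1) (c + 140) (rat U a b - 1 - Vh / Dh).
Proof.
have h1 := rat_ex cx (i := i) ltac:(lia) ab rU nzM.
have r0 := rat_0 cx (i := i) ltac:(lia) ab rU nzM.
have hE : ob 3 42 (rat U a b - 1 - ex M (fun G => Vst U a b G / Dst U a b G)).
  apply: ob_abs_le h1; rewrite (_ : rat U a b = (rat U a b - 1) + 1); [obt | ring].
have D0 : Dh != 0 by have [? ?] := Dh_ge; rewrite gt_eqF //; lra.
pose V := Vst U a b; pose D := Dst U a b.
pose S1 := \sum_l ind H (a, l) * ((1 - ind H (b, l)) * Q b l).
pose S2 := \sum_l ind H (b, l) * ((1 - ind H (a, l)) * Q a l).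
have VE G : G \in gs M -> V G - Vh = (fH R H a b G - S1) - (fH R H b a G - S2).
  by move=> hG; rewrite /V VstE // /Vh -/H -/S1 -/S2; ring.
have e : ex M (fun G => V G / D G) = Vh / Dh + Dh^-1 * ex M (fun G => V G - Vh)
   + (- Vh * Dh^-1 ^+ 2) * ex M (fun G => D G - Dh)
   + (- Dh^-1 ^+ 2) * ex M (fun G => (V G - Vh) * (D G - Dh))
   + Dh^-1 ^+ 2 * ex M (fun G => V G * (D G - Dh) ^+ 2 / D G).
  rewrite -!exZ -{1}(ex_cst (Vh / Dh) nzM) -!exD; apply: eq_ex => G hG.
  have : D G != 0 by rewrite gt_eqF // (lt_le_trans ltr01) // Dst_ge1.
  by move=> d0; field; rewrite d0 D0.
have hi3 := ob_Dh_inv; have hVh := ob_Vh; have hvar := var_D.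
have hD : ob (k - 2) (c + 40) (ex M (fun G => D G - Dh)).
  by rewrite exB ex_cst //; exact: near_D near_M.
have hV : ob (k - 1) (c + 31) (ex M (fun G => V G - Vh)).
  rewrite (eq_ex VE) exB !exB !ex_cst //.
  have h2 := exV_est a b; have h3 := exV_est b a; rewrite -/S1 in h2; rewrite -/S2 in h3.
  obt2 hk.
have hVD : ob (k - 3) (c + 100) (ex M (fun G => (V G - Vh) * (D G - Dh))).
  rewrite (_ : ex _ _ = ex M (fun G => fH R H a b G * (D G - Dh)) - ex M (fun G => fH R H b a G * (D G - Dh))
     + (S2 - S1) * ex M (fun G => D G - Dh)).
    have h2 := cov_VD a b; have h3 := cov_VD b a; rewrite -/D in h2 h3.
    have h4 := ob_sumQ a b; have h5 := ob_sumQ b a; rewrite -/S1 in h4; rewrite -/S2 in h5.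
    obt2 hk.
  by rewrite -exZ -exB -exD; apply: eq_ex => G hG; rewrite VE //; ring.
have hlast : ob (k - 3) (c + 120) (ex M (fun G => V G * (D G - Dh) ^+ 2 / D G)).
  have hee : ob (-1) 8 (ee i) by apply: (ob_ee cx); lia.
  (* On graphs counted by [low], the denominator is only known to be at least 1, and [(D - Dh)^2] is
     bounded by [B ^+ 2] with [B] of order n; the probability [z ^+ 10] outweighs this. *)
  have hDh := ob_Dh; pose B := n%:R + 1 + `|Dh|.
  have hB : ob (-2) 42 B by have hDa := ob_abs hDh; rewrite /B; obt.
  apply: (@ob_of_le _ _ _ _ _ _ (4 * ee i * (64 * nu * z ^+ 2 * ex M (fun G => (D G - Dh) ^+ 2) + B ^+ 2 * z ^+ 10))); last first.
    obt2 hk.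
  have tb := tail_bound cx (i := i + 1) ltac:(lia) regM1 ab.
  have e0 := ee_ge0 cx i.
  apply: le_trans (ex_norm _ _) _.
  apply: (@le_trans _ _ (ex M (fun G => 4 * ee i * (64 * nu * z ^+ 2 * (D G - Dh) ^+ 2 + B ^+ 2 * low nu M a b G)))).
    apply: ex_le => G hG; have d1 := Dst_ge1 U a b G.
    rewrite normrM (normrM (V G)) normfV (ger0_norm (_ : 0 <= D G)) /D; last by lra.
    rewrite (ger0_norm (sqr_ge0 _)) -mulrA; apply: ler_pM => //.
    - by rewrite mulr_ge0 ?sqr_ge0 // invr_ge0; lra.
    - exact: (Vst_le ab rU hG).
    apply: (@le_trans _ _ ((Dst U a b G - Dh) ^+ 2 * (64 * nu * z ^+ 2 + low nu M a b G))).
      by apply: ler_wpM2l; [exact: sqr_ge0 | exact: (Dst_inv cx)].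
    rewrite mulrDr (mulrC _ (64 * nu * z ^+ 2)) lerD2l; apply: ler_wpM2r; first exact: ler0n.
    rewrite -[leLHS]real_normK ?num_real //; apply: lerXn2r; rewrite ?nnegrE ?normr_ge0 //.
      by rewrite /B !addr_ge0.
    apply: le_trans (ler_normB _ _) _; rewrite /B lerD2r ger0_norm; last by lra.
    have [d [ed dn]] := cnt_nat R (mH U) b a G.
    by rewrite /Dst ed lerD2r ler_nat.
  rewrite exZ exD !exZ; apply: ler_wpM2l; first by rewrite mulr_ge0.
  by rewrite lerD2l; apply: ler_wpM2l; [exact: sqr_ge0 | exact: tb].
have hE' : ob 3 42 (rat U a b - 1 - ex M (fun G => V G / D G)) := hE.
set X := ex M _ in e hE'.
have h5 : ob (k + 1) (c + 138) (X - Vh / Dh).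
  rewrite e; set X1 := ex M _ in hV *; set X2 := ex M _ in hD *; set X3 := ex M _ in hVD *.
  set X4 := ex M _ in hlast *.
  rewrite (_ : _ - Vh / Dh = Dh^-1 * X1 + - Vh * Dh^-1 ^+ 2 * X2 + - Dh^-1 ^+ 2 * X3 + Dh^-1 ^+ 2 * X4); last by ring.
  obt2 hk.
by rewrite (_ : _ - Vh / Dh = (rat U a b - 1 - X) + (X - Vh / Dh)); [obt2 hk | ring].
Qed.
End Fix.
End RatStep.

End RatioEstimate.
Import RatioEstimate.

(** * Explicit expansion of the predicted ratio *)

Module SecondOrder.

Section Expand.
Variables (R : realFieldType) (n : nat) (nu z p : R).
Hypothesis cx : ctx n nu z p.
Local Notation cell := ('I_n * 'I_n)%type.
Implicit Types (G H : {set cell}).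
Local Notation model := (model R n).
Implicit Types (M U : model).
Local Notation ind := (@indc R n).
Local Notation rd := (@rd R n).
Local Notation cd := (@cd R n).
Local Notation ob := (ob nu z).
Local Notation reg := (@reg R n nu z p).
Local Notation P1h := (@P1h R n z p).
Local Notation dl := (@dl R n p).
Local Notation et := (@et R n p).
Local Notation Vh := (@Vh R n z p).
Local Notation Dh := (@Dh R n z p).
Local Notation w := (p * (1 - p))^-1.
Let sc := cs cx.

Definition hrow M a := \sum_l ind (mH M) (a, l) * et M l.
Definition hcol M k := \sum_b ind (mH M) (b, k) * dl M b.
Definition Del M := \sum_b dl M b.
Definition mm M a := rd (mH M) a * dl M a + hrow M a.

(** [Vh / Dh] up to O(z^3). The last term reflects how [Dh] depends on the surpluses of the two
    rows; the effect of forbidden cells on numerator and denominator combines into [mm]. *)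
Definition rh M a b :=
  w * z ^+ 2 * (dl M a - dl M b) + w * z ^+ 4 * (mm M a - mm M b)
  - (w * z ^+ 2) ^+ 2 * ((dl M a - dl M b) * ((1 - p) * dl M b - p * dl M a)).

(** The solution of [pr_identity] when each difference is replaced by
    [rh M a b * (P1h M b k * (1 - P1h M a k))], kept through order z^2. *)
Definition P2h M a k :=
  p + (dl M a + et M k) * z ^+ 2
  + z ^+ 4 * (mm M a + cd (mH M) k * et M k + hcol M k - Del M)
  + w * z ^+ 4 * (1 - p - p) * dl M a * et M k.

(** Only about [(nu / z) ^+ 2] cells are forbidden, so this double sum costs [z ^ (-2)] instead of
    the [z ^ (-4)] of all cells. *)
Lemma ob_rd_sum i M k c (F : 'I_n -> 'I_n -> R) : (i <= 128)%N -> reg i M ->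
  (forall a l, ob k c (F a l)) ->
  ob (k - 2) (c + 10) (\sum_a \sum_l ind (mH M) (a, l) * F a l).
Proof.
move=> hi rM hF.
apply: (ob_sum_le (G := fun a => rd (mH M) a * (nu ^+ c * z ^ k))) => [a _|].
  rewrite /Conditioning.rd mulr_suml; apply: le_trans (ler_norm_sum _ _ _) _.
  apply: ler_sum => l _; rewrite normrM ger0_norm ?ind_ge0 //.
  by rewrite ler_wpM2l ?ind_ge0 //; exact: hF.
rewrite -mulr_suml.
have h1 : ob (-2) 10 (\sum_a rd (mH M) a).
  have hz : ob (-2) 9 ((nu / z) ^+ 2 + i%:R) by have := ob_index cx hi => *; obt.
  apply: (ob_le sc (k := -2) (c := 9%N)) => //; apply: ob_abs_le hz _.
  by rewrite ger0_norm ?(rX rM) // sumr_ge0 // => a _; exact: rd_ge0.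
have h2 : ob k c (nu ^+ c * z ^ k).
  by rewrite /OrderBounds.ob ger0_norm // ltW // (ob_rhs_gt0 sc).
by have := obM sc h1 h2; rewrite (addnC 10%N) (addrC (-2)).
Qed.

Lemma sum_cdE H : \sum_k cd H k = \sum_a rd H a.
Proof. exact: exchange_big. Qed.

Section Reg.
Variables (i : nat) (M : model).
Hypotheses (hi : (i <= 128)%N) (rM : reg i M).

Lemma ob_hrow a : ob (-2) 17 (hrow M a).
Proof.
apply: (ob_sum_le (G := fun l => ind (mH M) (a, l) * (nu ^+ 9 * z ^ (-1)))) => [l _|].
  rewrite normrM ger0_norm ?ind_ge0 // ler_wpM2l ?ind_ge0 //; exact: (ob_et cx hi rM).
rewrite -mulr_suml; have h1 := ob_x cx hi rM a.
have h2 : ob (-1) 9 (nu ^+ 9 * z ^ (-1)).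
  by rewrite /OrderBounds.ob ger0_norm // ltW // (ob_rhs_gt0 sc).
exact: (obM sc h1 h2).
Qed.

Lemma ob_hcol k : ob (-2) 17 (hcol M k).
Proof.
apply: (ob_sum_le (G := fun l => ind (mH M) (l, k) * (nu ^+ 9 * z ^ (-1)))) => [l _|].
  rewrite normrM ger0_norm ?ind_ge0 // ler_wpM2l ?ind_ge0 //; exact: (ob_dl cx hi rM).
rewrite -mulr_suml; have h1 := ob_y cx hi rM k.
have h2 : ob (-1) 9 (nu ^+ 9 * z ^ (-1)).
  by rewrite /OrderBounds.ob ger0_norm // ltW // (ob_rhs_gt0 sc).
exact: (obM sc h1 h2).
Qed.

Lemma ob_mm a : ob (-2) 20 (mm M a).
Proof.
by have := ob_hrow a; have := ob_x cx hi rM a; have := ob_dl cx hi rM a => *; rewrite /mm; obt.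
Qed.

Lemma ob_rdsum : ob (-2) 10 (\sum_a rd (mH M) a).
Proof.
have h : ob (0 - 2) (0 + 10) (\sum_a \sum_l ind (mH M) (a, l) * (1 : R)).
  by apply: ob_rd_sum hi rM _ => *; exact: ob1.
rewrite (_ : \sum_a rd _ a = \sum_a \sum_l ind (mH M) (a, l) * (1 : R)) //.
by apply: eq_bigr => a _; apply: eq_bigr => l _; rewrite mulr1.
Qed.

Lemma sum_cst (x : R) : \sum_(l < n) x = n%:R * x.
Proof. by rewrite sumr_const card_ord -(mulr_natl x). Qed.

Lemma ob_Del : ob (-2) 13 (Del M).
Proof.
have h1 := ob_rdsum; have h2 := ob_p cx.
have h3 : ob 0 7 (\sum_a ms M a - p * n%:R ^+ 2).
  by apply: ob_abs_le (ob_index cx hi) _; exact: rS rM.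
rewrite /Del /FirstOrder.dl big_split /= sumrB sum_cst -mulr_sumr.
rewrite (_ : n%:R * (p * n%:R) = p * n%:R ^+ 2); [obt | ring].
Qed.

Lemma ob_sumet : ob (-2) 13 (\sum_k et M k).
Proof.
have h1 := ob_rdsum; have h2 := ob_p cx.
have h3 : ob 0 7 (\sum_a mt M a - p * n%:R ^+ 2).
  by apply: ob_abs_le (ob_index cx hi) _; exact: rT rM.
rewrite /FirstOrder.et big_split /= sumrB sum_cst -mulr_sumr sum_cdE.
rewrite (_ : n%:R * (p * n%:R) = p * n%:R ^+ 2); [obt | ring].
Qed.

Lemma ob_rh a b : ob 1 40 (rh M a b).
Proof.
have := ob_mm a; have := ob_mm b; have := ob_dl cx hi rM a; have := ob_dl cx hi rM b.
by have := ob_p cx; have := ob_w cx => *; rewrite /rh; obt.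
Qed.

Lemma sum_mm (om : 'I_n -> R) : (forall b, ob 0 0 (om b)) ->
  ob (-3) 21 (\sum_b om b * mm M b).
Proof.
move=> hom.
have h1 : ob (-1 - 2) (9 + 10) (\sum_a \sum_l ind (mH M) (a, l) * (om a * dl M a)).
  apply: ob_rd_sum hi rM _ => a l; have := hom a; have := ob_dl cx hi rM a => h2 h3.
  exact: (obM sc h3 h2).
have h2 : ob (-1 - 2) (9 + 10) (\sum_a \sum_l ind (mH M) (a, l) * (om a * et M l)).
  apply: ob_rd_sum hi rM _ => a l; have := hom a; have := ob_et cx hi rM l => h2 h3.
  exact: (obM sc h3 h2).
have -> : \sum_b om b * mm M b = \sum_a \sum_l ind (mH M) (a, l) * (om a * dl M a) +
   \sum_a \sum_l ind (mH M) (a, l) * (om a * et M l).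
  rewrite -big_split; apply: eq_bigr => a _ /=.
  rewrite -mulr_suml -/(Conditioning.rd _ _ _) /mm mulrDr /hrow mulr_sumr; congr (_ + _); first by ring.
  by apply: eq_bigr => l _; ring.
obt.
Qed.
End Reg.

Lemma pq_neq0 : [/\ p != 0, 1 - p != 0 & z != 0].
Proof.
by have := cp0 cx; have := cp1 cx; have := z_gt0 cx => *; split; rewrite gt_eqF // subr_gt0.
Qed.

Section Rows.
Variables (i : nat) (U : model) (a b : 'I_n).
Hypotheses (hi : (i <= 70)%N) (rU : reg i U) (ab : a != b).
Let H := mH U.
Let al l := ind H (a, l).
Let be l := ind H (b, l).
Let g := \sum_l al l * be l.
Let eta := et U.

Lemma mixed_sum (x y : 'I_n -> R) (c0 : R) :
  \sum_l x l * ((1 - y l) * (c0 + z ^+ 2 * eta l)) =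
  c0 * (\sum_l x l - \sum_l x l * y l) + z ^+ 2 * (\sum_l x l * eta l - \sum_l x l * y l * eta l).
Proof.
rewrite -!sumrB !mulr_sumr -big_split /=; apply: eq_bigr => l _; ring.
Qed.

Lemma P1h_mva l : P1h (mv a U) a l = (p + (dl U a + 1) * z ^+ 2) + z ^+ 2 * eta l.
Proof. by rewrite /FirstOrder.P1h /FirstOrder.dl /= /incf eqxx /eta /FirstOrder.et /=; ring. Qed.

Lemma P1h_mvb l : P1h (mv a U) b l = (p + dl U b * z ^+ 2) + z ^+ 2 * eta l.
Proof. by rewrite /FirstOrder.P1h /FirstOrder.dl /= /incf (eq_sym b) (negbTE ab) /eta /FirstOrder.et /=; ring. Qed.

Lemma VhE : Vh U a b = (dl U a - dl U b) + z ^+ 2 * (- dl U a * rd H b + dl U b * rd H a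
  + g * (dl U a - dl U b) + hrow U a - hrow U b) - z ^+ 2 * (rd H b - g).
Proof.
rewrite /RatioEstimate.Vh (eq_bigr (fun l => al l * ((1 - be l) * ((p + dl U b * z ^+ 2) + z ^+ 2 * eta l)))); last first.
  by move=> l _; rewrite P1h_mvb.
rewrite [X in _ - X](eq_bigr (fun l => be l * ((1 - al l) * ((p + (dl U a + 1) * z ^+ 2) + z ^+ 2 * eta l)))); last first.
  by move=> l _; rewrite P1h_mva.
rewrite !mixed_sum -!/(Conditioning.rd _ _ _) -!/(hrow _ _).
have -> : \sum_l be l * al l = g by apply: eq_bigr => l _; rewrite mulrC.
have -> : \sum_l be l * al l * eta l = \sum_l al l * be l * eta l.
  by apply: eq_bigr => l _; rewrite (mulrC (be l)).
rewrite -/g /hrow /Conditioning.rd -/H /al /be /eta /FirstOrder.dl /Conditioning.rd; ring.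
Qed.

(** The part of [Dh - p (1 - p) n] of order z^(-1); by [DhE] the rest is bounded up to powers of
    [nu]. *)
Definition Frem := - (p * (1 - p)) * (rd H a + rd H b - g) + ((1 - p) * dl U b - p * dl U a).

Lemma DhE : ob 0 60 (Dh U a b - p * (1 - p) * n%:R - Frem).
Proof.
have hi' : (i <= 128)%N by lia.
have hda := ob_dl cx hi' rU a; have hdb := ob_dl cx hi' rU b; have hx := ob_x cx hi' rU a.
have hy := ob_x cx hi' rU b; have hp := ob_p cx; have hse := ob_sumet hi' rU.
have het l := ob_et cx hi' rU l.
have hal l : ob 0 0 (al l) by apply: ob_bool.
have hbe l : ob 0 0 (be l) by apply: ob_bool.
pose A l := (dl U a + 1) * z ^+ 2 + z ^+ 2 * eta l.
pose B l := dl U b * z ^+ 2 + z ^+ 2 * eta l.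
have hA l : ob 1 14 (A l) by rewrite /A /eta; obt.
have hB l : ob 1 14 (B l) by rewrite /B /eta; obt.
pose W l := (1 - al l) * (1 - be l).
have hW l : ob 0 2 (W l) by rewrite /W; obt.
have hu : ob (-1) 30 (\sum_l al l * ((1 - p) * B l - p * A l)).
  apply: (ob_sum_le (G := fun l => al l * (nu ^+ 16 * z ^ 1))) => [l _|].
    rewrite normrM ger0_norm ?ind_ge0 // ler_wpM2l ?ind_ge0 //.
    have h : ob 1 16 ((1 - p) * B l - p * A l) by have := hA l; have := hB l => *; obt.
    exact: h.
  rewrite -mulr_suml -/(Conditioning.rd _ _ _).
  have h2 : ob 1 16 (nu ^+ 16 * z ^ 1).
    by rewrite /OrderBounds.ob ger0_norm // ltW // (ob_rhs_gt0 sc).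
  obt.
have hu0 : ob 0 30 (\sum_l al l * ((1 - p) * B l - p * A l)).
  apply: (ob_sum_le (G := fun l => al l * (nu ^+ 16 * z ^ 1))) => [l _|].
    rewrite normrM ger0_norm ?ind_ge0 // ler_wpM2l ?ind_ge0 //.
    have h : ob 1 16 ((1 - p) * B l - p * A l) by have := hA l; have := hB l => *; obt.
    exact: h.
  rewrite -mulr_suml -/(Conditioning.rd _ _ _).
  have h2 : ob 1 16 (nu ^+ 16 * z ^ 1).
    by rewrite /OrderBounds.ob ger0_norm // ltW // (ob_rhs_gt0 sc).
  obt.
have hv0 : ob 0 30 (\sum_l be l * ((1 - al l) * ((1 - p) * B l - p * A l))).
  apply: (ob_sum_le (G := fun l => be l * (nu ^+ 17 * z ^ 1))) => [l _|].
    rewrite normrM ger0_norm ?ind_ge0 // ler_wpM2l ?ind_ge0 //.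
    have h : ob 1 17 ((1 - al l) * ((1 - p) * B l - p * A l)).
      by have := hA l; have := hB l; have := hal l => *; obt.
    exact: h.
  rewrite -mulr_suml -/(Conditioning.rd _ _ _).
  have h2 : ob 1 17 (nu ^+ 17 * z ^ 1).
    by rewrite /OrderBounds.ob ger0_norm // ltW // (ob_rhs_gt0 sc).
  obt.
have hAB : ob 0 40 (\sum_l W l * (A l * B l)) by obt.
clear hu.
have -> : Dh U a b - p * (1 - p) * n%:R - Frem =
   1 - p + (1 - p - p) * (z ^+ 2 * \sum_l eta l)
   - \sum_l al l * ((1 - p) * B l - p * A l) - \sum_l be l * ((1 - al l) * ((1 - p) * B l - p * A l))
   - \sum_l W l * (A l * B l).
  have nz2 : n%:R * z ^+ 2 = 1 := scale_n sc.
  have e1 : \sum_l ((1 - p) * B l - p * A l) = ((1 - p) * dl U b - p * dl U a) - p + (1 - p - p) * (z ^+ 2 * \sum_l eta l).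
    rewrite (eq_bigr (fun l => ((1 - p) * dl U b - p * (dl U a + 1)) * z ^+ 2 + ((1 - p - p) * z ^+ 2) * eta l)); last first.
      by move=> l _; rewrite /A /B; ring.
    rewrite big_split /= sum_cst -mulr_sumr.
    rewrite (_ : n%:R * (_ * z ^+ 2) = (n%:R * z ^+ 2) * ((1 - p) * dl U b - p * (dl U a + 1))); last by ring.
    by rewrite nz2; ring.
  have e2 : \sum_l p * (1 - p) * W l = p * (1 - p) * (n%:R - rd H a - rd H b + g).
    rewrite -mulr_sumr; congr (_ * _).
    rewrite -[n%:R]mulr1 -(sum_cst 1) /Conditioning.rd -!sumrB /g -big_split /=; apply: eq_bigr => l _.
    by rewrite /W /al /be; ring.
  have e3 : Dh U a b = \sum_l p * (1 - p) * W l + \sum_l ((1 - p) * B l - p * A l)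
     - \sum_l al l * ((1 - p) * B l - p * A l) - \sum_l be l * ((1 - al l) * ((1 - p) * B l - p * A l))
     - \sum_l W l * (A l * B l) + 1.
    rewrite /RatioEstimate.Dh -big_split -!sumrB; congr (_ + _); apply: eq_bigr => l _ /=.
    by rewrite P1h_mva P1h_mvb /RatioEstimate.wt -/H -/(al l) -/(be l) /W /A /B; ring.
  by rewrite e3 e1 e2 /Frem; ring.
rewrite /eta; obt.
Qed.

(** In [Vh - rh * Dh], the identity [e], the leading terms cancel exactly and O(z) remains; dividing
    by [Dh], of order z^(-2), gives O(z^3). *)
Lemma rat_main : nz (mv a U) -> ob 3 110 (Vh U a b / Dh U a b - rh U a b).
Proof.
move=> nzU; have hi' : (i <= 128)%N by lia.
have hE := DhE; have [p0 q0 z0] := pq_neq0.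
have hDi : ob 2 2 (Dh U a b)^-1 by apply: (ob_Dh_inv cx (k := 1) (or_introl erefl) hi rU ab).
have D0 : Dh U a b != 0.
  by have [? ?] := Dh_ge cx (k := 1) (or_introl erefl) hi rU ab nzU; rewrite gt_eqF //; lra.
set E := _ - Frem in hE.
have hda := ob_dl cx hi' rU a; have hdb := ob_dl cx hi' rU b; have hx := ob_x cx hi' rU a.
have hy := ob_x cx hi' rU b; have hp := ob_p cx; have hw := ob_w cx.
have hma := ob_mm hi' rU a; have hmb := ob_mm hi' rU b.
have hg : ob (-1) 8 g.
  apply: (ob_sum_le (G := fun l => al l)) => [l _|]; last exact: hx.
  rewrite ger0_norm ?mulr_ge0 ?ind_ge0 // -[leRHS]mulr1 ler_wpM2l ?ind_ge0 ?ind_le1 //.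
pose r2 := w * z ^+ 4 * (mm U a - mm U b)
  - (w * z ^+ 2) ^+ 2 * ((dl U a - dl U b) * ((1 - p) * dl U b - p * dl U a)).
have hr2 : ob 2 40 r2 by rewrite /r2; obt.
have hF : ob (-1) 20 Frem by rewrite /Frem; obt.
have nE : n%:R = z ^- 2.
  by apply: (mulIf (expf_neq0 2 z0)); rewrite mulVf ?expf_neq0 // (scale_n sc).
have DE : Dh U a b = p * (1 - p) * n%:R + Frem + E by rewrite /E; ring.
have e : Vh U a b - rh U a b * Dh U a b = - z ^+ 2 * (rd H b - g)
   - w * z ^+ 2 * (dl U a - dl U b) * E - r2 * (Frem + E).
  rewrite DE VhE nE /rh /r2 /Frem /mm -/H.
  by field; rewrite p0 q0 z0.
have -> : Vh U a b / Dh U a b - rh U a b = (Vh U a b - rh U a b * Dh U a b) * (Dh U a b)^-1.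
  by field.
rewrite e; obt.
Qed.
End Rows.
End Expand.

End SecondOrder.
Import SecondOrder.

(** * The bootstrap for occupation probabilities *)

Module EdgeProbability.

Section Levels.
Variables (R : realFieldType) (n : nat) (nu z p : R).
Hypothesis cx : ctx n nu z p.
Local Notation cell := ('I_n * 'I_n)%type.
Implicit Types (G H : {set cell}).
Local Notation model := (model R n).
Implicit Types (M U : model).
Local Notation ind := (@indc R n).
Local Notation rd := (@rd R n).
Local Notation cd := (@cd R n).
Local Notation ob := (ob nu z).
Local Notation reg := (@reg R n nu z p).
Local Notation P1h := (@P1h R n z p).
Local Notation P2h := (@P2h R n z p).
Local Notation rh := (@rh R n z p).
Local Notation dl := (@dl R n p).
Local Notation et := (@et R n p).
Local Notation mm := (@mm R n p).
Local Notation hrow := (@hrow R n p).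
Local Notation hcol := (@hcol R n p).
Local Notation Del := (@Del R n p).
Local Notation approx1 := (@approx1 R n nu z p).
Local Notation w := (p * (1 - p))^-1.
Let sc := cs cx.

Definition approx2 j k c := forall M a l, reg j M -> nz M -> (a, l) \notin mH M ->
  ob k c (pr M (a, l) - P2h M a l).

Lemma rat_rh k c i U a b : k = 1 \/ k = 2 -> (i <= 70)%N -> reg i U -> a != b ->
  approx1 (i + 4) k c -> nz (mv a U) ->
  ob (k + 1) (c + 142) (rat U a b - 1 - rh U a b).
Proof.
move=> hk hi rU ab HP h; have h1 := rat_est cx hk hi rU ab HP h.
have h2 := rat_main cx hi rU ab h.
set X := _ / _ in h1 h2.
by rewrite (_ : _ - rh U a b = (rat U a b - 1 - X) + (X - rh U a b)); [obt2 hk | ring].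
Qed.

Lemma mm_U M a b k r : a != b -> (a, k) \notin mH M -> (b, k) \notin mH M ->
  (r == a) || (r == b) ->
  [/\ dl (Urow M a b k) r = dl M r - (1 - p) &
   mm (Urow M a b k) r = mm M r + (dl M r - (1 - p) * rd (mH M) r - (1 - p) + et M k
      + (p + p - 1))].
Proof.
move=> ab ha hb hr; have ha' : (a, k) \notin (b, k) |: mH M.
  by rewrite in_setU1 negb_or ha xpair_eqE (negbTE ab).
have e1 : (r == a)%:R + (r == b)%:R = 1 :> R.
  case/orP: hr => /eqP ->; rewrite eqxx; first by rewrite (negbTE ab) addr0.
  by rewrite eq_sym (negbTE ab) add0r.
have hx : rd (mH (Urow M a b k)) r = rd (mH M) r + 1.
  by rewrite /= !rd_add //= -addrA [X in _ + X]addrC e1.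
have hd : dl (Urow M a b k) r = dl M r - (1 - p).
  rewrite /FirstOrder.dl hx /= /decf (_ : ms M r - _ - _ = ms M r - ((r == a)%:R + (r == b)%:R)); last by ring.
  by rewrite e1; ring.
split=> //.
have he l : et (Urow M a b k) l = et M l + (l == k)%:R * (p + p - 1).
  by rewrite /FirstOrder.et /= !cd_add //= /decf; ring.
have hi0 : ind (mH M) (r, k) = 0.
  by case/orP: hr => /eqP ->; apply: ind_notin.
have hi l : ind (mH (Urow M a b k)) (r, l) = ind (mH M) (r, l) + (l == k)%:R.
  rewrite /= !ind_add // !xpair_eqE -addrA; congr (_ + _).
  case: (l == k); rewrite ?andbT ?andbF ?addr0 //.
  by rewrite addrC e1.
have hh : hrow (Urow M a b k) r = hrow M r + et M k + (p + p - 1).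
  have dK (F : 'I_n -> R) : \sum_l (l == k)%:R * F l = F k.
    by rewrite (bigD1 k) //= eqxx mul1r big1 ?addr0 // => l /negbTE ->; rewrite mul0r.
  rewrite /SecondOrder.hrow (eq_bigr (fun l => ind (mH M) (r, l) * et M l +
    (l == k)%:R * (ind (mH M) (r, l) * (p + p - 1) + et M l + (p + p - 1)))); last first.
    move=> l _; rewrite hi he; case: (l == k) => /=; ring.
  by rewrite big_split /= dK hi0; ring.
by rewrite /SecondOrder.mm hx hd hh; ring.
Qed.

(** The ratio is taken in [Urow], but [rh] may be evaluated in [M]: the surplus [dl] drops by the
    same 1 - p in both rows, so the leading difference is unchanged. *)
Lemma rh_U i M a b k : (i <= 128)%N -> reg i M -> a != b ->
  (a, k) \notin mH M -> (b, k) \notin mH M ->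
  ob 3 60 (rh (Urow M a b k) a b - rh M a b).
Proof.
move=> hi rM ab ha hb.
have ra : (a == a) || (a == b) by rewrite eqxx.
have rb : (b == a) || (b == b) by rewrite eqxx orbT.
have [d1 m1] := mm_U ab ha hb ra; have [d2 m2] := mm_U ab ha hb rb.
have hda := ob_dl cx hi rM a; have hdb := ob_dl cx hi rM b; have hp := ob_p cx; have hw := ob_w cx.
have hxa := ob_x cx hi rM a; have hxb := ob_x cx hi rM b.
have -> : rh (Urow M a b k) a b - rh M a b =
   w * z ^+ 4 * ((dl M a - (1 - p) * rd (mH M) a) - (dl M b - (1 - p) * rd (mH M) b))
   - (w * z ^+ 2) ^+ 2 * ((dl M a - dl M b) * (p * (1 - p) - (1 - p) ^+ 2)).
  by rewrite /SecondOrder.rh d1 d2 m1 m2; ring.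
obt.
Qed.

Lemma rh_sum i M a k : (i <= 128)%N -> reg i M ->
  ob 1 110 (\sum_(b | (b, k) \notin mH M) rh M a b * (P1h M b k * (1 - P1h M a k))
    - (dl M a - z ^+ 2 * Del M - z ^+ 2 * cd (mH M) k * dl M a + z ^+ 2 * hcol M k
       + z ^+ 2 * mm M a + w * z ^+ 2 * (1 - p - p) * dl M a * et M k)).
Proof.
move=> hi rM; have [p0 q0 z0] := pq_neq0 cx.
have nz2 : n%:R * z ^+ 2 = 1 := scale_n sc.
have hd := ob_dl cx hi rM; have he := ob_et cx hi rM k; have hm := ob_mm cx hi rM.
have hp := ob_p cx; have hw := ob_w cx; have hy := ob_y cx hi rM k.
have hh := ob_hcol cx hi rM k; have hD := ob_Del cx hi rM.
pose om b := 1 - ind (mH M) (b, k).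
have hom b : ob 0 0 (om b).
  by apply: ob_unit; rewrite /om; case: (ind01 R (mH M) (b, k)) => ->; rewrite ?subrr ?subr0 ?normr0 ?normr1.
have E b : rh M a b * (P1h M b k * (1 - P1h M a k)) =
   z ^+ 2 * (dl M a - dl M b) + z ^+ 4 * (mm M a - mm M b)
   + w * z ^+ 4 * (1 - p - p) * et M k * (dl M a - dl M b)
   + (w * z ^+ 4 * (mm M a - mm M b) * (P1h M b k * (1 - P1h M a k) - p * (1 - p))
      - (w * z ^+ 2) ^+ 2 * ((dl M a - dl M b) * ((1 - p) * dl M b - p * dl M a)) *
         (P1h M b k * (1 - P1h M a k) - p * (1 - p))
      - w * z ^+ 2 * (dl M a - dl M b) * (z ^+ 4 * (dl M a + et M k) * (dl M b + et M k))).
  by rewrite /SecondOrder.rh /FirstOrder.P1h; field; rewrite p0 q0.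
pose T b := w * z ^+ 4 * (mm M a - mm M b) * (P1h M b k * (1 - P1h M a k) - p * (1 - p))
      - (w * z ^+ 2) ^+ 2 * ((dl M a - dl M b) * ((1 - p) * dl M b - p * dl M a)) *
         (P1h M b k * (1 - P1h M a k) - p * (1 - p))
      - w * z ^+ 2 * (dl M a - dl M b) * (z ^+ 4 * (dl M a + et M k) * (dl M b + et M k)).
have hT b : ob 3 70 (T b).
  have h1 := ob_P1h cx hi rM b k; have h2 := ob_P1h cx hi rM a k.
  have h3 : ob 1 30 (P1h M b k * (1 - P1h M a k) - p * (1 - p)).
    rewrite (_ : _ - _ = (P1h M b k - p) * (1 - p) - p * (P1h M a k - p) - (P1h M b k - p) * (P1h M a k - p)); last by ring.
    obt.
  have hma := hm a; have hmb := hm b; have hda := hd a; have hdb := hd b.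
  rewrite /T; obt.
have -> : \sum_(b | (b, k) \notin mH M) rh M a b * (P1h M b k * (1 - P1h M a k)) =
   (z ^+ 2 + w * z ^+ 4 * (1 - p - p) * et M k) *
        ((n%:R - cd (mH M) k) * dl M a - Del M + hcol M k)
   + z ^+ 4 * ((n%:R - cd (mH M) k) * mm M a - \sum_b om b * mm M b) + \sum_b om b * T b.
  rewrite big_mkcond (eq_bigr (fun b => (z ^+ 2 + w * z ^+ 4 * (1 - p - p) * et M k) *
     (om b * dl M a - (dl M b - ind (mH M) (b, k) * dl M b)) + z ^+ 4 * (om b * mm M a - om b * mm M b) + om b * T b)); last first.
    move=> b _; case: ifP => h; last first.
      by rewrite /om (ind_in _ (negbFE h)); ring.
    by rewrite E /om (ind_notin _ h) /T; ring.
  have hO : \sum_b om b = n%:R - cd (mH M) k by rewrite /om sumrB sum_cst mulr1.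
  rewrite !big_split /= -!mulr_sumr; congr (_ * _ + _ * _ + _).
    by rewrite sumrB -mulr_suml hO sumrB /Del /hcol; ring.
  by rewrite sumrB -mulr_suml hO.
have hS := sum_mm cx hi rM hom.
have hT2 : ob 1 71 (\sum_b om b * T b) by obt.
set S1 := \sum_b _ in hS *; set S2 := \sum_b _ in hT2 *.
have hma := hm a; have hda := hd a.
(* The last summand carries the factor [n%:R * z ^+ 2 - 1], which is 0; it is written out so that
   [ring] can check the identity without knowing that relation. *)
rewrite (_ : _ - _ = w * z ^+ 4 * (1 - p - p) * et M k * (- cd (mH M) k * dl M a - Del M + hcol M k)
   - z ^+ 4 * (cd (mH M) k * mm M a) - z ^+ 4 * S1 + S2
   + (n%:R * z ^+ 2 - 1) * (dl M a + w * z ^+ 2 * (1 - p - p) * et M k * dl M a + z ^+ 2 * mm M a)); last by ring.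
rewrite nz2 subrr mul0r addr0; obt.
Qed.

(** One round. Probabilities to order k give ratios, hence differences, to order k + 1;
    [pr_identity] adds at most n differences and divides by about n, so this order is kept. Of the 6
    units of slack, [Urow] takes 2 and the models near it take 4. *)
Lemma pr_level k c i : k = 1 \/ k = 2 -> (i <= 64)%N -> (20 <= c)%N -> approx1 (i + 6) k c ->
  approx2 i (k + 1) (c + 220).
Proof.
move=> hk hi hc HP M a l rM h ha.
have hi' : (i <= 128)%N by lia.
have reg_up j N : (j <= i + 6)%N -> reg j N -> reg (i + 6) N by apply: reg_le.
pose QQ b := P1h M b l * (1 - P1h M a l).
have hp := ob_p cx.
have hP1 b : ob 0 13 (P1h M b l).
  have h1 := ob_P1h cx hi' rM b l.
  by rewrite (_ : P1h M b l = (P1h M b l - p) + p); [obt | ring].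
have diff b : (b, l) \notin mH M -> ob (k + 1) (c + 190)
    (pr M (a, l) - pr M (b, l) - rh M a b * QQ b).
  move=> hb; have [<-|ab] := eqVneq a b.
    rewrite /SecondOrder.rh !subrr !mul0r !mulr0 addr0 subrr mul0r subr0.
    exact: (ob_le sc (ob0 sc (k + 1))).
  have [-> nzU] := pr_diff cx (i := i) ltac:(small_lia) ab rM h ha hb.
  have rU := reg_U ab ha hb rM.
  have h1 : ob (k + 1) (c + 142) (rat (Urow M a b l) a b - 1 - rh (Urow M a b l) a b).
    by apply: (rat_rh (i := i + 2) hk _ rU ab _ nzU); [lia | rewrite -addnA].
  have h2 := rh_U hi' rM ab ha hb.
  have h3 : ob k c (pr M (b, l) - P1h M b l).
    by apply: HP hb => //; apply: reg_up rM; lia.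
  have [n1 _] := nz_step cx (i := i) ltac:(small_lia) rM h hb.
  have h4 : ob k c (pr (rem (b, l) M) (a, l) - P1h (rem (b, l) M) a l).
    apply: HP => //; first by apply: reg_up (reg_rem hb rM); lia.
    by rewrite in_setU1 negb_or ha xpair_eqE (negbTE ab).
  have h5 := ob_P1h_rem cx a l hb.
  have h6 := ob_rh cx hi' rM a b; have h7 := hP1 b.
  have h8 : ob 0 0 (pr M (b, l)) by apply: ob_pr.
  have h9 : ob 0 0 (pr (rem (b, l) M) (a, l)) by apply: ob_pr.
  set x := pr M _ in h3 h8 *; set y := pr _ _ in h4 h9 *; set r := rat _ _ _ in h1 *.
  set y1 := P1h (rem _ _) _ _ in h4 h5; set r1 := rh (Urow _ _ _ _) _ _ in h1 h2.
  rewrite (_ : _ - _ = ((r - 1 - r1) + (r1 - rh M a b)) * (x * (1 - y))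
     + rh M a b * ((x - P1h M b l) * (1 - y) - P1h M b l * ((y - y1) + (y1 - P1h M a l)))); last first.
    by rewrite /QQ; ring.
  obt2 hk.
have hS : ob (k - 1) (c + 190) (\sum_(b | (b, l) \notin mH M) (pr M (a, l) - pr M (b, l) - rh M a b * QQ b)).
  rewrite (_ : k - 1 = (k + 1) - 2); last by ring.
  by apply: (ob_sum sc); rewrite ?card_ord.
have id := pr_identity h ha.
have hR := rh_sum a l hi' rM.
have hny := ob_ny cx hi' rM l.
have [p0 q0 z0] := pq_neq0 cx.
have ny0 : n%:R - cd (mH M) l != 0.
  apply/eqP => e; have := ob_y cx hi' rM l => hy.
  have h2 : 2 * cd (mH M) l <= n%:R.
    by apply: (ob_le_n cx (k := -1) (c := 20)) => //; obt.
  have := n_gt0 cx; have := cd_ge0 R (mH M) l; lra.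
set Y := dl M a - z ^+ 2 * Del M - z ^+ 2 * cd (mH M) l * dl M a + z ^+ 2 * hcol M l
       + z ^+ 2 * mm M a + w * z ^+ 2 * (1 - p - p) * dl M a * et M l in hR.
rewrite sumrB -id in hS; set S1 := \sum_(b | _) _ in hS hR.
have nz2 : n%:R * z ^+ 2 = 1 := scale_n sc.
have hy := ob_y cx hi' rM l; have hda := ob_dl cx hi' rM a; have he := ob_et cx hi' rM l.
have hm := ob_mm cx hi' rM a; have hh := ob_hcol cx hi' rM l; have hD := ob_Del cx hi' rM.
have hw := ob_w cx.
have hP : ob 1 60 ((n%:R - cd (mH M) l) * P2h M a l - mt M l - Y).
  rewrite (_ : _ - Y = - z ^+ 4 * cd (mH M) l * (mm M a + cd (mH M) l * et M l + hcol M l - Del M)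
     - cd (mH M) l * (w * z ^+ 4 * (1 - p - p) * dl M a * et M l)
     + (n%:R * z ^+ 2 - 1) * (dl M a + et M l + z ^+ 2 * (mm M a + cd (mH M) l * et M l + hcol M l - Del M)
        + w * z ^+ 2 * (1 - p - p) * dl M a * et M l)); last first.
    rewrite /Y /SecondOrder.P2h /FirstOrder.et; ring.
  rewrite nz2 subrr mul0r addr0; obt.
set X := (n%:R - _) * P2h _ _ _ - _ - _ in hP.
rewrite (_ : _ - _ = (((n%:R - cd (mH M) l) * pr M (a, l) - mt M l - S1) + (S1 - Y) - X) *
   (n%:R - cd (mH M) l)^-1); last by rewrite /X; field.
obt2 hk.
Qed.

Lemma P2h_P1h i M a k : (i <= 128)%N -> reg i M -> ob 2 60 (P2h M a k - P1h M a k).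
Proof.
move=> hi rM.
have hy := ob_y cx hi rM k; have hda := ob_dl cx hi rM a; have he := ob_et cx hi rM k.
have hm := ob_mm cx hi rM a; have hh := ob_hcol cx hi rM k; have hD := ob_Del cx hi rM.
have hw := ob_w cx; have hp := ob_p cx.
rewrite (_ : _ - _ = z ^+ 4 * (mm M a + cd (mH M) k * et M k + hcol M k - Del M)
  + w * z ^+ 4 * (1 - p - p) * dl M a * et M k); last by rewrite /SecondOrder.P2h /FirstOrder.P1h; ring.
obt.
Qed.

(** Starting from [pr_0], two rounds lower the slack from 70 to 64 and 58. Since [P2h] and [P1h]
    differ by O(z^2) only, the result of the first round is again of the form [approx1]; the final
    power of [nu] is 273 + 220. *)
Theorem pr_approx : approx2 58 3 500.
Proof.
have a1 : approx1 70 1 52.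
  move=> M a l rM h ha; have h1 := pr_0 cx (i := 70) isT rM h ha.
  have h2 := ob_P1h cx (i := 70) isT rM a l.
  by rewrite (_ : _ - _ = (pr M (a, l) - p) - (P1h M a l - p)); [obt | ring].
have a2 : approx2 64 2 272 by exact (pr_level (k := 1) (c := 52) (i := 64) (or_introl erefl) isT isT a1).
have a3 : approx1 64 2 273.
  move=> M a l rM h ha; have h1 := a2 M a l rM h ha.
  have h2 := P2h_P1h a l (i := 64) isT rM.
  by rewrite (_ : _ - _ = (pr M (a, l) - P2h M a l) + (P2h M a l - P1h M a l)); [obt | ring].
have h := pr_level (k := 2) (c := 273) (i := 58) (or_intror erefl) isT isT a3.
by move=> M a l rM h0 ha; apply: (ob_le sc (h M a l rM h0 ha)).
Qed.
End Levels.

End EdgeProbability.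
Import EdgeProbability.

(** * Common columns of two rows when few cells are forbidden *)

Module SparseModels.

Section Sparse.
Variables (R : realFieldType) (n : nat) (nu z p : R).
Hypothesis cx : ctx n nu z p.
Local Notation cell := ('I_n * 'I_n)%type.
Implicit Types (G H : {set cell}).
Local Notation model := (model R n).
Implicit Types (M U : model).
Local Notation ind := (@indc R n).
Local Notation rd := (@rd R n).
Local Notation cd := (@cd R n).
Local Notation ob := (ob nu z).
Local Notation reg := (@reg R n nu z p).
Local Notation P2h := (@P2h R n z p).
Local Notation dl := (@dl R n p).
Local Notation et := (@et R n p).
Local Notation kap := (@kap R n).
Local Notation w := (p * (1 - p))^-1.
Let sc := cs cx.

Definition sparse (j : nat) M := \sum_a rd (mH M) a <= j%:R.
(** What is left of [P2h] when boundedly many cells are forbidden: the terms [mm], [hcol] and [Del]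
    then contribute only O(z^3). *)
Definition P3h M a k := p + (dl M a + et M k) * z ^+ 2 + w * z ^+ 4 * (1 - p - p) * dl M a * et M k.

Lemma sparse_rem j M c : c \notin mH M -> sparse j M -> sparse j.+1 (rem c M).
Proof.
move=> h hs; rewrite /sparse /=; under eq_bigr do rewrite rd_add //.
by rewrite big_split /= sum_eqr -natr1 lerD2r.
Qed.

Lemma sparse_rd j M a : sparse j M -> rd (mH M) a <= j%:R.
Proof.
by apply: le_trans; rewrite (bigD1 a) //= lerDl sumr_ge0 // => *; exact: rd_ge0.
Qed.

Lemma sparse_cd j M a : sparse j M -> cd (mH M) a <= j%:R.
Proof.
rewrite /sparse -sum_cdE.
by apply: le_trans; rewrite (bigD1 a) //= lerDl sumr_ge0 // => *; exact: cd_ge0.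
Qed.

Section Reg.
Variables (i j : nat) (M : model).
Hypotheses (hi : (i <= 128)%N) (hj : (j <= 16)%N) (rM : reg i M) (sM : sparse j M).

Lemma ob_j : ob 0 4 (j%:R : R).
Proof. by apply: (ob_le sc (ob_nat sc j)) => //; exact: leq_trans (leq_up_log _ hj) _. Qed.
Lemma sp_x a : ob 0 4 (rd (mH M) a).
Proof. by apply: ob_abs_le ob_j _; rewrite ger0_norm ?rd_ge0 //; exact: sparse_rd. Qed.
Lemma sp_y a : ob 0 4 (cd (mH M) a).
Proof. by apply: ob_abs_le ob_j _; rewrite ger0_norm ?cd_ge0 //; exact: sparse_cd. Qed.
Lemma sp_X : ob 0 4 (\sum_a rd (mH M) a).
Proof.
by apply: ob_abs_le ob_j _; rewrite ger0_norm //; apply: sumr_ge0 => *; exact: rd_ge0.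
Qed.

Lemma sp_sumet : ob 0 13 (\sum_k et M k).
Proof.
have h1 := sp_X; have h2 := ob_p cx.
have h3 : ob 0 7 (\sum_a mt M a - p * n%:R ^+ 2).
  by apply: ob_abs_le (ob_index cx hi) _; exact: rT rM.
rewrite /FirstOrder.et big_split /= sumrB sum_cst -mulr_sumr sum_cdE.
rewrite (_ : n%:R * (p * n%:R) = p * n%:R ^+ 2); [obt | ring].
Qed.

Lemma sp_Del : ob 0 13 (Del p M).
Proof.
have h1 := sp_X; have h2 := ob_p cx.
have h3 : ob 0 7 (\sum_a ms M a - p * n%:R ^+ 2).
  by apply: ob_abs_le (ob_index cx hi) _; exact: rS rM.
rewrite /Del /FirstOrder.dl big_split /= sumrB sum_cst -mulr_sumr.
rewrite (_ : n%:R * (p * n%:R) = p * n%:R ^+ 2); [obt | ring].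
Qed.

Lemma sp_wsum (x : 'I_n -> R) (F : 'I_n -> R) k c : (forall l, 0 <= x l) ->
  ob 0 4 (\sum_l x l) -> (forall l, ob k c (F l)) -> ob k (c + 4) (\sum_l x l * F l).
Proof.
move=> x0 hx hF; apply: (ob_sum_le (G := fun l => x l * (nu ^+ c * z ^ k))) => [l _|].
  by rewrite normrM ger0_norm // ler_wpM2l //; exact: hF.
have h2 : ob k c (nu ^+ c * z ^ k).
  by rewrite /OrderBounds.ob ger0_norm // ltW // (ob_rhs_gt0 sc).
by rewrite -mulr_suml; have := obM sc hx h2; rewrite add0r addnC.
Qed.

Lemma P2h_P3h a k : ob 3 40 (P2h M a k - P3h M a k).
Proof.
have h1 := sp_x a; have h2 := sp_y k; have h3 := sp_Del.
have hda := ob_dl cx hi rM; have he := ob_et cx hi rM.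
have h4 : ob (-1) 13 (hrow p M a).
  by apply: (sp_wsum (k := -1) (c := 9%N) (x := fun l => ind (mH M) (a, l))) => [l||l]; [exact: ind_ge0 | exact: sp_x | exact: he].
have h5 : ob (-1) 13 (hcol p M k).
  by apply: (sp_wsum (k := -1) (c := 9%N) (x := fun l => ind (mH M) (l, k))) => [l||l]; [exact: ind_ge0 | exact: sp_y | exact: hda].
have hda' := hda a; have he' := he k; rewrite /SecondOrder.P2h /P3h /mm.
rewrite (_ : _ - _ = z ^+ 4 * (rd (mH M) a * dl M a + hrow p M a + cd (mH M) k * et M k
  + hcol p M k - Del p M)); last by ring.
obt.
Qed.
End Reg.

Lemma pr_P3 i j M a l : (i <= 58)%N -> (j <= 16)%N -> reg i M -> sparse j M -> nz M ->
  (a, l) \notin mH M -> ob 3 501 (pr M (a, l) - P3h M a l).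
Proof.
move=> hi hj rM sM h ha; have hi' : (i <= 128)%N by lia.
have h1 := P2h_P3h hi' hj rM sM a l.
have h2 := pr_approx cx (reg_le hi rM) h ha.
by rewrite (_ : _ - _ = (pr M (a, l) - P2h M a l) + (P2h M a l - P3h M a l)); [obt | ring].
Qed.

Section Pair.
Variables (a b : 'I_n).
Hypothesis ab : a != b.

Definition mu M := ex M (kap a b).
Definition piM M l := pr M (a, l) * pr (rem (a, l) M) (b, l).
Definition rem2 l M := rem (b, l) (rem (a, l) M).
Definition free M l := ((a, l) \notin mH M) && ((b, l) \notin mH M).
Definition gH M := \sum_l ind (mH M) (a, l) * ind (mH M) (b, l).
(** Predicted mean of [kap]. The sum of squares appears because both rows prefer the same columns;
    [- p * (1 - p)] appears because a point at [(a, l)] lowers the probability at [(b, l)] by about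
    [(1 - p) / n], in each of n columns. *)
Definition mu0 M := ms M a * ms M b * z ^+ 2 + p ^+ 2 * gH M + z ^+ 4 * (\sum_l et M l ^+ 2) - p * (1 - p).

Lemma bl_notin M l : (b, l) \notin mH M -> (b, l) \notin mH (rem (a, l) M).
Proof. by move=> h; rewrite in_setU1 negb_or h xpair_eqE eq_sym (negbTE ab). Qed.

Lemma kap_add c G r l : c \notin G -> c = (a, l) \/ c = (b, l) -> r != l ->
  ind (c |: G) (a, r) * ind (c |: G) (b, r) = ind G (a, r) * ind G (b, r).
Proof.
by move=> h [] -> ne; rewrite !ind_add_ne // xpair_eqE (negbTE ne) andbF.
Qed.

(** Size biasing: the factor [kap] selects a common column [l]. Conditioning on its two cells leads
    to [rem2 l M], where that column is no longer counted, hence the [+ 1]. *)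
Lemma ex_kap M g : ex M (fun G => kap a b G * g (kap a b G)) =
  \sum_(l | free M l) piM M l * ex (rem2 l M) (fun G => g (kap a b G + 1)).
Proof.
rewrite (eq_ex (g2 := fun G => \sum_l ind G (a, l) * (ind G (b, l) * g (kap a b G)))); last first.
  by move=> G _; rewrite {1}/Regularity.kap mulr_suml; apply: eq_bigr => l _; rewrite mulrA.
rewrite ex_sum [RHS]big_mkcond; apply: eq_bigr => l _; rewrite /free.
have [ha|ha] /= := boolP ((a, l) \in mH M).
  by rewrite /ex big1 ?mul0r // => G hG; rewrite (ind_notin _ (gs_notin hG ha)) mul0r.
rewrite ex_ind //.
have [hb|hb] /= := boolP ((b, l) \in mH M).
  rewrite /ex [X in _ * (X / _)]big1 ?mul0r ?mulr0 // => G hG.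
  have hb' : (b, l) \in mH (rem (a, l) M) by rewrite in_setU1 hb orbT.
  by rewrite ind_add_ne ?xpair_eqE 1?eq_sym ?(negbTE ab) // (ind_notin _ (gs_notin hG hb')) mul0r.
rewrite /piM -mulrA; congr (_ * _).
rewrite (eq_ex (g2 := fun G => ind G (b, l) * g (kap a b ((a, l) |: G)))); last first.
  by move=> G _; rewrite ind_add_ne // xpair_eqE eq_sym (negbTE ab).
rewrite ex_ind ?bl_notin //; congr (_ * _); apply: eq_ex => G hG.
have hbG : (b, l) \notin G by apply: gs_notin hG _; rewrite /= !inE eqxx.
have haG : (a, l) \notin G by apply: gs_notin hG _; rewrite /= !inE eqxx orbT.
congr g; rewrite /Regularity.kap (bigD1 l) // [in RHS](bigD1 l) //= addrAC; congr (_ + _).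
  have ne : (a, l) != (b, l) by rewrite xpair_eqE (negbTE ab).
  rewrite ind_add_eq (ind_add_ne _ (c0 := (a, l))); last by rewrite eq_sym.
  by rewrite ind_add_eq (ind_notin _ haG) (ind_notin _ hbG); ring.
apply: eq_bigr => r hr; rewrite !(kap_add _ _ hr) //; [by right | | by left].
by rewrite in_setU1 negb_or haG andbT xpair_eqE (negbTE ab).
Qed.

Lemma ex_kap1 M : mu M = \sum_(l | free M l) piM M l * ex (rem2 l M) (fun=> 1).
Proof. by rewrite -(ex_kap M (fun=> 1)); apply: eq_ex => G _; rewrite mulr1. Qed.

Lemma free_step i j M l : (i <= 58)%N -> reg i M -> sparse j M -> nz M -> free M l ->
  [/\ nz (rem (a, l) M), nz (rem2 l M), reg (i + 2) (rem2 l M) & sparse j.+2 (rem2 l M)].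
Proof.
move=> hi rM sM h /andP[ha hb].
have [n1 _] := nz_step cx (i := i) ltac:(small_lia) rM h ha.
have r1 := reg_rem ha rM; have hb' := bl_notin hb.
have [n2 _] := nz_step cx (i := i + 1) ltac:(small_lia) r1 n1 hb'.
split=> //; first by rewrite (_ : i + 2 = i + 1 + 1)%N; [exact: reg_rem | lia].
by do 2!apply: sparse_rem => //.
Qed.

Lemma mu_sum i j M : (i <= 58)%N -> reg i M -> sparse j M -> nz M ->
  mu M = \sum_(l | free M l) piM M l.
Proof.
move=> hi rM sM h; rewrite ex_kap1; apply: eq_bigr => l hl.
by have [_ n2 _ _] := free_step hi rM sM h hl; rewrite ex_cst // mulr1.
Qed.

(** Here the third-order precision of P is used: n columns with error O(z^3) each leave O(z). *)
Lemma mu_est i j M : (i <= 57)%N -> (j <= 14)%N -> reg i M -> sparse j M -> nz M ->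
  ob 1 560 (mu M - mu0 M).
Proof.
move=> hi hj rM sM h.
have hi' : (i <= 128)%N by lia. have hj' : (j <= 16)%N by lia.
have hp := ob_p cx; have hw := ob_w cx; have nz2 : n%:R * z ^+ 2 = 1 := scale_n sc.
have hd := ob_dl cx hi' rM; have he := ob_et cx hi' rM.
have hxa := sp_x hj' sM a; have hxb := sp_x hj' sM b.
have hse := sp_sumet hi' hj' rM sM.
pose A l := P3h M a l; pose B l := P3h M b l - (1 - p) * z ^+ 2.
have hA l : ob 1 25 (A l - p).
  have := hd a; have := he l => *; rewrite /A /P3h.
  rewrite (_ : _ - p = (dl M a + et M l) * z ^+ 2 + w * z ^+ 4 * (1 - p - p) * dl M a * et M l); last by ring.
  obt.
have hB l : ob 1 25 (B l - p).
  have := hd b; have := he l => *; rewrite /B /P3h.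
  rewrite (_ : _ - p = (dl M b + et M l) * z ^+ 2 + w * z ^+ 4 * (1 - p - p) * dl M b * et M l - (1 - p) * z ^+ 2); last by ring.
  obt.
have hA0 l : ob 0 27 (A l) by have := hA l => ?; rewrite (_ : A l = (A l - p) + p); [obt | ring].
have hB0 l : ob 0 27 (B l) by have := hB l => ?; rewrite (_ : B l = (B l - p) + p); [obt | ring].
have term l : free M l -> ob 3 540 (piM M l - A l * B l).
  move=> hl; have [n1 n2 r2 s2] := free_step (i := i) ltac:(small_lia) rM sM h hl.
  have /andP[ha hb] := hl.
  have h1 := pr_P3 (i := i) ltac:(small_lia) hj' rM sM h ha.
  have h2 := pr_P3 (i := i + 1) (j := j.+1) ltac:(small_lia) ltac:(small_lia) (reg_rem ha rM) (sparse_rem ha sM) n1 (bl_notin hb).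
  have h3 : ob 3 30 (P3h (rem (a, l) M) b l - B l).
    have := hd b => hdb.
    rewrite (_ : _ - _ = - (w * z ^+ 4 * (1 - p - p) * dl M b * (1 - p))); first obt.
    rewrite /B /P3h /FirstOrder.dl /FirstOrder.et /= rd_add // cd_add //= /decf eqxx (eq_sym b) (negbTE ab) /=; ring.
  rewrite /piM; have h4 : ob 0 0 (pr M (a, l)) by apply: ob_pr.
  have h5 := hB0 l.
  set x := pr _ _ in h1 h4 *; set y := pr _ _ in h2 *; set P := P3h (rem _ _) _ _ in h2 h3.
  rewrite (_ : _ - _ = (x - P3h M a l) * B l + x * ((y - P) + (P - B l))); last by rewrite /A; ring.
  obt.
have hS : ob 1 540 (mu M - \sum_(l | free M l) A l * B l).
  rewrite (mu_sum (i := i) (j := j)) //; last by lia.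
  rewrite -sumrB; apply: (ob_sum sc (k := 3)); first by rewrite card_ord.
  by move=> l hl; apply: term.
pose W l := ind (mH M) (a, l) + ind (mH M) (b, l) - ind (mH M) (a, l) * ind (mH M) (b, l).
have W0 l : 0 <= W l.
  by rewrite /W; case: (ind01 R (mH M) (a, l)) => ->; case: (ind01 R (mH M) (b, l)) => ->; lra.
have WE : \sum_l W l = rd (mH M) a + rd (mH M) b - gH M by rewrite /W sumrB big_split.
have hg : ob 0 4 (gH M).
  apply: (ob_abs_le (e := rd (mH M) a)); first exact: hxa.
  rewrite ger0_norm; last by apply: sumr_ge0 => l _; rewrite mulr_ge0 ?ind_ge0.
  by apply: ler_sum => l _; rewrite -[leRHS]mulr1 ler_wpM2l ?ind_ge0 ?ind_le1.
have hW : ob 1 80 (\sum_l W l * (A l * B l - p ^+ 2)).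
  have hAB l : ob 1 60 (A l * B l - p ^+ 2).
    rewrite (_ : _ - _ = (A l - p) * B l + p * (B l - p)); last by ring.
    by have := hA l; have := hB l; have := hB0 l => *; obt.
  apply: (ob_sum_le (G := fun l => W l * (nu ^+ 60 * z ^ 1))) => [l _|].
    by rewrite normrM ger0_norm // ler_wpM2l //; exact: hAB.
  have h2 : ob 1 60 (nu ^+ 60 * z ^ 1).
    by rewrite /OrderBounds.ob ger0_norm // ltW // (ob_rhs_gt0 sc).
  rewrite -mulr_suml WE; obt.
have eS : \sum_(l | free M l) A l * B l = \sum_l A l * B l - \sum_l W l * (A l * B l - p ^+ 2)
    - p ^+ 2 * (rd (mH M) a + rd (mH M) b - gH M).
  rewrite -WE mulr_sumr -!sumrB big_mkcond; apply: eq_bigr => l _; rewrite /free /W.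
  case: (boolP ((a, l) \in mH M)) => ha /=; case: (boolP ((b, l) \in mH M)) => hb /=;
    rewrite ?(ind_in _ ha) ?(ind_in _ hb) ?(ind_notin _ ha) ?(ind_notin _ hb); ring.
pose a0 := p + dl M a * z ^+ 2; pose a1 := z ^+ 2 + w * z ^+ 4 * (1 - p - p) * dl M a.
pose b0 := p + dl M b * z ^+ 2 - (1 - p) * z ^+ 2; pose b1 := z ^+ 2 + w * z ^+ 4 * (1 - p - p) * dl M b.
have eAB : \sum_l A l * B l = n%:R * (a0 * b0) + (a0 * b1 + a1 * b0) * (\sum_l et M l) + a1 * b1 * (\sum_l et M l ^+ 2).
  rewrite -sum_cst !mulr_sumr -!big_split /=; apply: eq_bigr => l _.
  by rewrite /A /B /P3h /a0 /a1 /b0 /b1; ring.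
have hda := hd a; have hdb := hd b.
have ha0 : ob 0 15 a0 by rewrite /a0; obt.
have hb0 : ob 0 15 b0 by rewrite /b0; obt.
have ha1 : ob 2 15 a1 by rewrite /a1; obt.
have hb1 : ob 2 15 b1 by rewrite /b1; obt.
have hee : ob (-4) 20 (\sum_l et M l ^+ 2) by obt.
have h11 : ob 5 40 (a1 * b1 - z ^+ 4).
  rewrite (_ : _ - _ = z ^+ 2 * (w * z ^+ 4 * (1 - p - p) * dl M b) + w * z ^+ 4 * (1 - p - p) * dl M a * b1); last by rewrite /a1 /b1; ring.
  obt.
have hs := ob_s cx hi' rM a; have hs' := ob_s cx hi' rM b.
set S := \sum_(l | _) _ in hS eS; set E2 := \sum_l _ ^+ 2 in hee eAB *.
rewrite (_ : mu M - mu0 M = (mu M - S) - \sum_l W l * (A l * B l - p ^+ 2)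
  + (a0 * b1 + a1 * b0) * (\sum_l et M l) + (a1 * b1 - z ^+ 4) * E2
  - (1 - p) * dl M a * z ^+ 2
  + z ^+ 2 * (p * rd (mH M) a * (ms M b - p * n%:R) + p * rd (mH M) b * (ms M a - p * n%:R)
     + p ^+ 2 * rd (mH M) a * rd (mH M) b)); first obt.
have e1 : n%:R * (a0 * b0) = z ^+ 2 * (ms M a + p * rd (mH M) a) * (ms M b + p * rd (mH M) b)
    - (1 - p) * (p + dl M a * z ^+ 2).
  have -> : n%:R * (a0 * b0) = (n%:R * z ^+ 2) * (n%:R * a0 * b0) by rewrite nz2 mul1r; ring.
  have -> : ms M a + p * rd (mH M) a = n%:R * a0.
    rewrite /a0 (_ : n%:R * _ = n%:R * p + (n%:R * z ^+ 2) * dl M a); last by ring.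
    by rewrite nz2 /FirstOrder.dl; ring.
  have -> : ms M b + p * rd (mH M) b = n%:R * b0 + (1 - p).
    rewrite /b0 /FirstOrder.dl (_ : n%:R * _ = n%:R * p + (n%:R * z ^+ 2) * (ms M b - p * n%:R + p * rd (mH M) b - (1 - p))); last by ring.
    by rewrite nz2; ring.
  rewrite -/a0.
  rewrite (_ : z ^+ 2 * (n%:R * a0) * _ = (n%:R * z ^+ 2) * (a0 * (n%:R * b0 + (1 - p)))); last by ring.
  by rewrite nz2; ring.
have e2 (x : R) : z ^+ 2 * (x * (p * n%:R)) = p * x.
  by transitivity ((n%:R * z ^+ 2) * (p * x)); [ring | rewrite nz2 mul1r].
rewrite eS eAB e1 /mu0 -/E2.
have := e2 (p * rd (mH M) a); have := e2 (p * rd (mH M) b) => f1 f2.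
rewrite (_ : z ^+ 2 * (p * rd (mH M) a * (ms M b - p * n%:R) + p * rd (mH M) b * (ms M a - p * n%:R) + p ^+ 2 * rd (mH M) a * rd (mH M) b) =
 z ^+ 2 * (p * rd (mH M) a * ms M b + p * rd (mH M) b * ms M a + p ^+ 2 * rd (mH M) a * rd (mH M) b)
 - z ^+ 2 * (p * rd (mH M) a * (p * n%:R)) - z ^+ 2 * (p * rd (mH M) b * (p * n%:R))); last by ring.
by rewrite f1 f2; ring.
Qed.

End Pair.
End Sparse.

End SparseModels.
Import SparseModels.

(** * Central moments of the number of common columns *)

Module Moments.

Section Moments.
Variables (R : realFieldType) (n : nat) (nu z p : R).
Hypothesis cx : ctx n nu z p.
Local Notation cell := ('I_n * 'I_n)%type.
Implicit Types (G H : {set cell}).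
Local Notation model := (model R n).
Implicit Types (M U : model).
Local Notation ind := (@indc R n).
Local Notation rd := (@rd R n).
Local Notation cd := (@cd R n).
Local Notation ob := (ob nu z).
Local Notation reg := (@reg R n nu z p).
Local Notation dl := (@dl R n p).
Local Notation et := (@et R n p).
Local Notation kap := (@kap R n).
Local Notation w := (p * (1 - p))^-1.
Let sc := cs cx.

Variables (a b : 'I_n).
Hypothesis ab : a != b.
Local Notation mu := (@mu R n a b).
Local Notation mu0 := (@mu0 R n z p a b).
Local Notation piM := (@piM R n a b).
Local Notation rem2 := (@rem2 R n a b).
Local Notation free := (@free R n a b).

Definition phi r M := ex M (fun G => (kap a b G - mu M) ^+ r).
(** Shift of the mean of [kap] when a common column is planted at [l]; by [sig_est] it is
    [(1 - p) ^+ 2] up to O(z), whatever [l] is. *)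
Definition sig M l := mu (rem2 l M) + 1 - mu M.

Lemma mu0_rem i M l : (i <= 128)%N -> reg i M -> free M l ->
  ob 1 60 (mu0 (rem2 l M) + 1 - mu0 M - (1 - p) ^+ 2).
Proof.
move=> hi rM /andP[ha hb]; have hb' := bl_notin ab hb.
have hs := ob_s cx hi rM a; have hs' := ob_s cx hi rM b; have hp := ob_p cx.
have he := ob_et cx hi rM l; have nz2 : n%:R * z ^+ 2 = 1 := scale_n sc.
have e1 : gH a b (rem2 l M) = gH a b M + 1.
  have ne : (a, l) != (b, l) by rewrite xpair_eqE (negbTE ab).
  rewrite /gH /= (bigD1 l) // [in RHS](bigD1 l) //= addrAC; congr (_ + _).
    rewrite ind_add_eq (ind_add_ne _ (c0 := (b, l))) // ind_add_eq.
    by rewrite (ind_notin _ ha) (ind_notin _ hb); ring.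
  by apply: eq_bigr => r hr; rewrite !ind_add_ne // xpair_eqE (negbTE hr) andbF.
have e2 r : et (rem2 l M) r = et M r + (r == l)%:R * (p + p - 2).
  by rewrite /FirstOrder.et /= !cd_add //= /decf; ring.
have e3 : \sum_r et (rem2 l M) r ^+ 2 = \sum_r et M r ^+ 2 + (p + p - 2) * (et M l *+ 2 + (p + p - 2)).
  rewrite (bigD1 l) // [in RHS](bigD1 l) //= addrAC; congr (_ + _).
    by rewrite e2 eqxx /=; ring.
  by apply: eq_bigr => r /negbTE hr; rewrite e2 hr mul0r addr0.
rewrite (_ : _ - (1 - p) ^+ 2 = - ((ms M a - p * n%:R) + (ms M b - p * n%:R)) * z ^+ 2
   - 2 * p * (n%:R * z ^+ 2 - 1) + z ^+ 2 + z ^+ 4 * ((p + p - 2) * (et M l + et M l + (p + p - 2)))).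
  by rewrite nz2 subrr mulr0 subr0; obt.
rewrite /SparseModels.mu0 e1 e3 /= /decf !eqxx (negbTE ab) (eq_sym b) (negbTE ab) /=; ring.
Qed.

Lemma sig_est i j M l : (i <= 55)%N -> (j <= 12)%N -> reg i M -> sparse j M -> nz M ->
  free M l -> ob 1 570 (sig M l - (1 - p) ^+ 2).
Proof.
move=> hi hj rM sM h hl; have [n1 n2 r2 s2] := free_step cx ab (i := i) ltac:(small_lia) rM sM h hl.
have h1 := mu_est cx ab (i := i) (j := j) ltac:(small_lia) ltac:(small_lia) rM sM h.
have h2 := mu_est cx ab (i := i + 2) (j := j.+2) ltac:(small_lia) ltac:(small_lia) r2 s2 n2.
have h3 := mu0_rem (i := i) ltac:(small_lia) rM hl.
rewrite (_ : _ - _ = (mu (rem2 l M) - mu0 (rem2 l M)) - (mu M - mu0 M) +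
   (mu0 (rem2 l M) + 1 - mu0 M - (1 - p) ^+ 2)); last by rewrite /sig; ring.
obt.
Qed.

Lemma ob_mu M : nz M -> ob (-2) 0 (mu M).
Proof.
move=> h; apply: (ob_abs_le (e := n%:R)); first exact: (ob_n sc).
rewrite ger0_norm; last first.
  by apply: ex_ge0 => G _; apply: sumr_ge0 => l _; rewrite mulr_ge0 ?ind_ge0.
rewrite -[leRHS](ex_cst _ h); apply: ex_le => G _.
rewrite -[leRHS]mulr1 -(sum_cst n 1); apply: ler_sum => l _.
by rewrite -[leRHS]mul1r ler_pM ?ind_ge0 ?ind_le1.
Qed.

Lemma ob_pi M l : ob 0 0 (piM M l).
Proof.
apply: ob_unit; rewrite /SparseModels.piM normrM -[leRHS]mul1r.
by apply: ler_pM; rewrite ?normr_ge0 // ger0_norm ?pr_ge0 ?pr_le1.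
Qed.

Lemma phi1 M : nz M -> phi 1 M = 0.
Proof. by move=> h; rewrite /phi; under eq_ex do rewrite expr1; rewrite exB ex_cst // subrr. Qed.

Section Rec.
Variables (i j : nat) (M : model).
Hypotheses (hi : (i <= 55)%N) (hj : (j <= 12)%N) (rM : reg i M) (sM : sparse j M) (nM : nz M).

(** [ex_kap] with the r-th power of the deviation turns the moment of order r + 1 into differences
    of r-th moments in [rem2 l M] and [M]. The main terms of these differences cancel, which drives
    the induction on the order. *)
Lemma phi_rec r : phi r.+1 M =
  \sum_(l | free M l) piM M l * (ex (rem2 l M) (fun G => (kap a b G - mu (rem2 l M) + sig M l) ^+ r) - phi r M).
Proof.
have -> : phi r.+1 M = ex M (fun G => kap a b G * (kap a b G - mu M) ^+ r) - mu M * phi r M.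
  by rewrite -exZ -exB; apply: eq_ex => G _; rewrite exprS mulrBl.
rewrite (ex_kap ab M (fun x => (x - mu M) ^+ r)) [X in X * phi r M](mu_sum cx ab (i := i) ltac:(small_lia) rM sM nM).
rewrite mulr_suml -sumrB; apply: eq_bigr => l _; rewrite mulrBr; congr (_ * _ - _).
by apply: eq_ex => G _; congr (_ ^+ _); rewrite /sig; ring.
Qed.

Lemma phi2E : phi 2 M = \sum_(l | free M l) piM M l * sig M l.
Proof.
rewrite phi_rec; apply: eq_bigr => l hl; congr (_ * _).
have [n1 n2 r2 s2] := free_step cx ab (i := i) ltac:(small_lia) rM sM nM hl.
under eq_ex do rewrite expr1.
by rewrite exD exB !ex_cst // phi1 // -/(mu _) subrr add0r subr0.
Qed.

(** The weights [piM] add up to [mu M], about [p ^+ 2 * n], and each shift is about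
    [(1 - p) ^+ 2]. *)
Lemma phi2_est : ob (-1) 600 (phi 2 M - (p * (1 - p)) ^+ 2 * n%:R).
Proof.
have hm := mu_est cx ab (i := i) (j := j) ltac:(small_lia) ltac:(small_lia) rM sM nM.
have hs l : free M l -> ob 1 570 (sig M l - (1 - p) ^+ 2) by apply: (sig_est hi hj).
have hp := ob_p cx; have hpi := ob_pi M.
have h0 : ob (-1) 575 (\sum_(l | free M l) piM M l * (sig M l - (1 - p) ^+ 2)).
  by apply: (ob_sum sc (k := 1)); rewrite ?card_ord // => l hl; have := hs l hl; have := hpi l => *; obt.
have hi' : (i <= 128)%N by lia.
have hsa := ob_s cx hi' rM a; have hsb := ob_s cx hi' rM b; have he := ob_et cx hi' rM.
have hxa : ob 0 4 (gH a b M).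
  apply: (ob_abs_le (e := rd (mH M) a)); first by apply: (sp_x cx (j := j)) => //; lia.
  rewrite ger0_norm; last by apply: sumr_ge0 => l _; rewrite mulr_ge0 ?ind_ge0.
  by apply: ler_sum => l _; rewrite -[leRHS]mulr1 ler_wpM2l ?ind_ge0 ?ind_le1.
have hm0 : ob (-1) 60 (mu0 M - p ^+ 2 * n%:R).
  have nz2 : n%:R * z ^+ 2 = 1 := scale_n sc.
  have hee : ob (-4) 20 (\sum_l et M l ^+ 2) by obt.
  rewrite (_ : _ - _ = (ms M a - p * n%:R) * (ms M b - p * n%:R) * z ^+ 2
    + (n%:R * z ^+ 2) * p * ((ms M a - p * n%:R) + (ms M b - p * n%:R)) + (n%:R * z ^+ 2 - 1) * p ^+ 2 * n%:R
    + p ^+ 2 * gH a b M + z ^+ 4 * (\sum_l et M l ^+ 2) - p * (1 - p)); last by rewrite /SparseModels.mu0; ring.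
  rewrite nz2 subrr !mul0r mul1r addr0; obt.
rewrite phi2E (_ : _ - _ = \sum_(l | free M l) piM M l * (sig M l - (1 - p) ^+ 2)
   + (1 - p) ^+ 2 * ((mu M - mu0 M) + (mu0 M - p ^+ 2 * n%:R))); first obt.
rewrite (mu_sum cx ab (i := i) ltac:(small_lia) rM sM nM).
rewrite (eq_bigr (fun l => piM M l * (sig M l - (1 - p) ^+ 2) + (1 - p) ^+ 2 * piM M l)); last by move=> l _; ring.
by rewrite big_split /= -mulr_sumr; ring.
Qed.
End Rec.

(** The variances in [rem2 l M] and in [M] have the same main term, so their difference is O(z^(-1))
    per column. *)
Lemma phi3_est i j M : (i <= 53)%N -> (j <= 10)%N -> reg i M -> sparse j M -> nz M ->
  ob (-3) 1200 (phi 3 M).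
Proof.
move=> hi hj rM sM nM; rewrite (phi_rec (i := i) (j := j) ltac:(small_lia) ltac:(small_lia) rM sM nM).
apply: (ob_sum sc (k := -1)); rewrite ?card_ord // => l hl.
have [n1 n2 r2 s2] := free_step cx ab (i := i) ltac:(small_lia) rM sM nM hl.
have h1 := phi2_est (i := i) (j := j) ltac:(small_lia) ltac:(small_lia) rM sM nM.
have h2 := phi2_est (i := i + 2) (j := j.+2) ltac:(small_lia) ltac:(small_lia) r2 s2 n2.
have h3 := sig_est (i := i) (j := j) ltac:(small_lia) ltac:(small_lia) rM sM nM hl.
have hp := ob_p cx; have hpi := ob_pi M l.
have hs : ob 0 572 (sig M l).
  by rewrite (_ : sig M l = (sig M l - (1 - p) ^+ 2) + (1 - p) ^+ 2); [obt | ring].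
have -> : ex (rem2 l M) (fun G => (kap a b G - mu (rem2 l M) + sig M l) ^+ 2) =
   phi 2 (rem2 l M) + sig M l ^+ 2.
  transitivity (phi 2 (rem2 l M) + 2 * sig M l * phi 1 (rem2 l M) + ex (rem2 l M) (fun=> sig M l ^+ 2)).
    by rewrite /phi -exZ -!exD; apply: eq_ex => G _; ring.
  by rewrite phi1 // mulr0 addr0 ex_cst.
set x := phi 2 _ in h2 *; set y := phi 2 _ in h1 *.
rewrite (_ : x + _ - y = (x - (p * (1 - p)) ^+ 2 * n%:R) - (y - (p * (1 - p)) ^+ 2 * n%:R) + sig M l ^+ 2); last by ring.
obt.
Qed.

(** Weaker than the Gaussian order z^(-4), yet enough: in the expansion of 1/D it is divided by the
    fifth power of a quantity of order z^(-2). *)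
Lemma phi4_est i j M : (i <= 51)%N -> (j <= 8)%N -> reg i M -> sparse j M -> nz M ->
  ob (-5) 2000 (phi 4 M).
Proof.
move=> hi hj rM sM nM; rewrite (phi_rec (i := i) (j := j) ltac:(small_lia) ltac:(small_lia) rM sM nM).
apply: (ob_sum sc (k := -3)); rewrite ?card_ord // => l hl.
have [n1 n2 r2 s2] := free_step cx ab (i := i) ltac:(small_lia) rM sM nM hl.
have h1 := phi3_est (i := i) (j := j) ltac:(small_lia) ltac:(small_lia) rM sM nM.
have h2 := phi3_est (i := i + 2) (j := j.+2) ltac:(small_lia) ltac:(small_lia) r2 s2 n2.
have h4 := phi2_est (i := i + 2) (j := j.+2) ltac:(small_lia) ltac:(small_lia) r2 s2 n2.
have h3 := sig_est (i := i) (j := j) ltac:(small_lia) ltac:(small_lia) rM sM nM hl.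
have hp := ob_p cx; have hpi := ob_pi M l.
have hs : ob 0 572 (sig M l).
  by rewrite (_ : sig M l = (sig M l - (1 - p) ^+ 2) + (1 - p) ^+ 2); [obt | ring].
have h5 : ob (-2) 610 (phi 2 (rem2 l M)).
  rewrite (_ : phi 2 _ = (phi 2 (rem2 l M) - (p * (1 - p)) ^+ 2 * n%:R) + (p * (1 - p)) ^+ 2 * n%:R); last by ring.
  obt.
have -> : ex (rem2 l M) (fun G => (kap a b G - mu (rem2 l M) + sig M l) ^+ 3) =
   phi 3 (rem2 l M) + 3 * sig M l * phi 2 (rem2 l M) + sig M l ^+ 3.
  transitivity (phi 3 (rem2 l M) + 3 * sig M l * phi 2 (rem2 l M) +
      3 * sig M l ^+ 2 * phi 1 (rem2 l M) + ex (rem2 l M) (fun=> sig M l ^+ 3)).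
    by rewrite /phi -!exZ -!exD; apply: eq_ex => G _; ring.
  by rewrite phi1 // mulr0 addr0 ex_cst.
obt.
Qed.

End Moments.

End Moments.
Import Moments.

(** * The ratio of a move to order n^(-2) when no cell is forbidden *)

Module SparseRatio.

Section SparseRatio.
Variables (R : realFieldType) (n : nat) (nu z p : R).
Hypothesis cx : ctx n nu z p.
Local Notation cell := ('I_n * 'I_n)%type.
Implicit Types (G H : {set cell}).
Local Notation model := (model R n).
Implicit Types (M U : model).
Local Notation ind := (@indc R n).
Local Notation rd := (@rd R n).
Local Notation cd := (@cd R n).
Local Notation ob := (ob nu z).
Local Notation reg := (@reg R n nu z p).
Local Notation dl := (@dl R n p).
Local Notation et := (@et R n p).
Local Notation kap := (@kap R n).
Local Notation w := (p * (1 - p))^-1.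
Let sc := cs cx.

Lemma nnu_gt0 : 0 < n%:R / nu / 2.
Proof. by have := n_gt0 cx; have := nu_ge2 cx => *; rewrite !divr_gt0 //; lra. Qed.

Lemma near_pq (x : R) c : ob (-1) c (x - p * (1 - p) * n%:R) -> (c.+2 <= bigE)%N ->
  n%:R / nu / 2 <= x.
Proof.
move=> hx hc; set y := x - _ in hx.
have hd : ob 1 c (- y * z ^+ 2) by eapply (ob_le sc); [obr | by [] | lia].
have hpq : nu ^- 1 <= p * (1 - p).
  have := cw cx; have := nu_ge2 cx => nu2 hw'.
  by rewrite expr1 -div1r ler_pdivrMr ?(mulrC _ nu) //; lra.
have h2 := small_lt cx hd hc hpq; have h3 := n_pq cx.
have : 2 * (- y * z ^+ 2) * n%:R <= p * (1 - p) * n%:R by rewrite ler_pM2r // (n_gt0 cx).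
rewrite (_ : 2 * _ * n%:R = (n%:R * z ^+ 2) * (- 2 * y)); last by ring.
by rewrite (scale_n sc) mul1r /y; lra.
Qed.

Lemma inv_pq (x : R) : n%:R / nu / 2 <= x -> ob 2 2 x^-1.
Proof.
move=> hx; apply: (ob_inv sc (k := -2)); rewrite -(n_z cx).
apply: le_trans (ler_norm _); apply: le_trans hx; have n0 := n_gt0 cx; have nu2 := nu_ge2 cx.
by rewrite -mulrA mulrC ler_pM2l // expr2 -invfM lef_pV2 ?posrE ?mulr_gt0 //; nra.
Qed.

Lemma e_lt_q i : (i <= 100)%N -> p * n%:R + (nu / z + i%:R) + 1 < n%:R.
Proof.
move=> hi; have hi' : (i <= 128)%N by apply: leq_trans hi _.
have h : ob (-1) 40 (2 * nu * (nu / z + i%:R + 1)) by have he := ob_ee cx hi'; rewrite /RatioBase.ee in he; obt.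
have h1 := ob_le_n cx h isT isT; have h2 := n_pq cx; have nu2 := nu_ge2 cx; have n0 := n_gt0 cx.
set e := _ + 1 in h1 *.
have h3 : 2 * e <= n%:R / nu by rewrite ler_pdivlMr ?(lt_le_trans _ nu2) // mulrAC.
have h4 : p * (1 - p) * n%:R <= (1 - p) * n%:R.
  by have := cp1 cx; have := cp0 cx => *; rewrite ler_pM2r // ler_piMl; lra.
have h5 : 0 < n%:R / nu by rewrite divr_gt0 //; lra.
by rewrite -addrA -/e; lra.
Qed.

Variables (a b : 'I_n).
Hypothesis ab : a != b.
Local Notation mu := (@mu R n a b).
Local Notation mu0 := (@mu0 R n z p a b).
Local Notation phi := (@phi R n a b).
Local Notation piM := (@piM R n a b).
Local Notation rem2 := (@rem2 R n a b).
Local Notation free := (@free R n a b).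

Section Ratio.
Variables (i : nat) (U : model).
Hypotheses (hi : (i <= 50)%N) (rU : reg i U) (H0 : mH U = set0) (nU : nz (mv a U)).
Let M := mv a U.
Let v := ms U a - ms U b.

Definition cc (t : 'I_n -> R) := w * z ^+ 4 * \sum_l (t l - p * n%:R) ^+ 2.
Definition BB (x y : R) := (y + 1) * (n%:R - x) * z ^+ 2.

Lemma fH_0 r r' G : fH R (mH U) r r' G = 0.
Proof. by rewrite H0 /fH big1 // => l _; rewrite {1}/indc inE mul0r. Qed.

Lemma sp0 : sparse 0 M.
Proof.
rewrite /sparse /M /= H0 big1 // => r _; rewrite /Conditioning.rd big1 // => l _.
by rewrite /indc inE.
Qed.

(** 1/D is expanded around its centre [Db] with remainder of degree four. The variance term
    [Db^-1 ^+ 3 * phi 2 M] is about [z ^+ 2 / B]. Moreover [Db] exceeds [B] by about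
    [K = (1 - cc (mt U)) * (p * (1 - p))], which produces the second term. Degrees three and four
    are errors of order z^5, and [v] costs one power of [z]. *)
Lemma rat_sparse : ob 4 2600 (rat U a b -
  (1 + v * ((1 + z ^+ 2) / BB (ms U a) (ms U b) - (1 - cc (mt U)) * w * z ^+ 4))).
Proof.
have rM : reg (i + 1) M by apply: reg_mv.
have hi' : (i <= 128)%N by lia.
have i55 : (i + 1 <= 55)%N by lia.
have i53 : (i + 1 <= 53)%N by lia.
have i51 : (i + 1 <= 51)%N by lia.
have i57 : (i + 1 <= 57)%N by lia.
have i80 : (i <= 80)%N by lia.
have i90 : (i + 1 <= 90)%N by lia.
have nz2 : n%:R * z ^+ 2 = 1 := scale_n sc.
have [p0 q0 z0] := pq_neq0 cx.
have nE : n%:R = z ^- 2.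
  by apply: (mulIf (expf_neq0 2 z0)); rewrite mulVf ?expf_neq0.
have hp := ob_p cx; have hw := ob_w cx.
have hsa := ob_s cx hi' rU a; have hsb := ob_s cx hi' rU b.
have f2 := phi2_est cx ab (j := 0) i55 isT rM sp0 nU.
have f3 := phi3_est cx ab (j := 0) i53 isT rM sp0 nU.
have f4 := phi4_est cx ab (j := 0) i51 isT rM sp0 nU.
have hm := mu_est cx ab (j := 0) i57 isT rM sp0 nU.
have h1 := rat_ex cx i80 ab rU nU.
have r0 := rat_0 cx i80 ab rU nU.
pose D := Dst U a b.
have hE : ob 10 42 (rat U a b - 1 - ex M (fun G => Vst U a b G / D G)).
  apply: ob_abs_le h1; rewrite (_ : rat U a b = (rat U a b - 1) + 1); [obt | ring].
have eV : ex M (fun G => Vst U a b G / D G) = v * ex M (fun G => (D G)^-1).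
  rewrite -exZ; apply: eq_ex => G hG; rewrite (VstE ab hG) !fH_0.
  by rewrite addr0 subr0.
have DE G : G \in gs M -> D G = (ms U b + 1 - mu M) - (kap a b G - mu M).
  move=> hG; rewrite /D /Dst (cntE a b hG) fH_0 /= /incf (eq_sym b) (negbTE ab) /=; ring.
set Db := ms U b + 1 - mu M in DE.
pose Nq := p * (1 - p) * n%:R.
pose K := (1 - cc (mt U)) * (p * (1 - p)).
pose B := BB (ms U a) (ms U b).
have het : ob (-4) 20 (\sum_l (mt U l - p * n%:R) ^+ 2).
  by have ht := ob_t cx hi' rU; obt.
have eE : \sum_l et M l ^+ 2 = \sum_l (mt U l - p * n%:R) ^+ 2.
  apply: eq_bigr => l _; rewrite /FirstOrder.et /M /= H0 (_ : cd set0 l = 0) ?mulr0 ?addr0 //.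
  by rewrite /Conditioning.cd big1 // => r _; rewrite /indc inE.
have gE : gH a b M = 0.
  by rewrite /gH big1 // => l _; rewrite /M /= H0 /indc inE mul0r.
have hK : ob 0 30 K by rewrite /K /cc; obt.
have hB : ob (-1) 40 (B - Nq).
  rewrite (_ : B - Nq = (n%:R * z ^+ 2) * (ms U b - p * n%:R + 1) * (1 - p)
     - (ms U b - p * n%:R + 1) * (ms U a - p * n%:R) * z ^+ 2 - (n%:R * z ^+ 2) * p * (ms U a - p * n%:R)
     + (n%:R * z ^+ 2 - 1) * p * (1 - p) * n%:R); last by rewrite /B /BB /Nq; ring.
  rewrite nz2 subrr !mul0r !mul1r; obt.
have hrho : ob 1 570 (Db - B - K).
  have -> : Db - B - K = - (mu M - mu0 M) + z ^+ 2 * v.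
    rewrite /Db /mu0 eE gE /B /BB /K /cc /M /= /incf eqxx (eq_sym b) (negbTE ab) /= /v.
    by rewrite nE; field; rewrite p0 q0 z0.
  have hv : ob (-1) 30 v.
    by rewrite (_ : v = (ms U a - p * n%:R) - (ms U b - p * n%:R)); [obt | rewrite /v; ring].
  obt.
have hDb : ob (-1) 580 (Db - Nq).
  by rewrite (_ : Db - Nq = (Db - B - K) + (B - Nq) + K); [obt | ring].
have n0 := n_gt0 cx; have nu2 := nu_ge2 cx.
have m0 := nnu_gt0.
have B0 : 0 < B by apply: lt_le_trans m0 _; exact: (near_pq hB).
have Db0 : 0 < Db by apply: lt_le_trans m0 _; exact: (near_pq hDb).
have hBi : ob 2 2 B^-1 by exact: (inv_pq (near_pq hB isT)).
have hDi : ob 2 2 Db^-1 by exact: (inv_pq (near_pq hDb isT)).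
pose e G := kap a b G - mu M.
have h4 : ob (-3) 2020 (ex M (fun G => e G ^+ 4 / D G)).
  pose X := 2 * n%:R : R; have hX : ob (-2) 2 X by rewrite /X; obt.
  apply: (@ob_of_le _ _ _ _ _ _ (64 * nu * z ^+ 2 * phi 4 M + X ^+ 4 * z ^+ 10)); last by obt.
  have tb := tail_bound cx i90 rM ab.
  apply: le_trans (ex_norm _ _) _.
  apply: (@le_trans _ _ (ex M (fun G => 64 * nu * z ^+ 2 * e G ^+ 4 + X ^+ 4 * low nu M a b G))).
    apply: ex_le => G hG; have d1 := Dst_ge1 U a b G.
    have e4 : 0 <= e G ^+ 4 by rewrite (exprM _ 2 2) sqr_ge0.
    rewrite normrM normfV (ger0_norm (_ : 0 <= D G)) /D; last by lra.
    rewrite (ger0_norm e4).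
    apply: (@le_trans _ _ (e G ^+ 4 * (64 * nu * z ^+ 2 + low nu M a b G))).
      by apply: ler_wpM2l => //; exact: (Dst_inv cx).
    rewrite mulrDr (mulrC _ (64 * nu * z ^+ 2)) lerD2l; apply: ler_wpM2r; first exact: ler0n.
    rewrite -(ger0_norm e4) normrX; apply: lerXn2r; rewrite ?nnegrE ?normr_ge0 ?mulr_ge0 //.
    apply: le_trans (ler_normB _ _) _.
    have k1 G' : 0 <= kap a b G' <= n%:R.
      rewrite sumr_ge0 /=; last by move=> l _; rewrite mulr_ge0 ?ind_ge0.
      rewrite -[leRHS]mulr1 -(sum_cst n 1); apply: ler_sum => l _.
      by rewrite -[leRHS]mul1r ler_pM ?ind_ge0 ?ind_le1.
    have /andP[k2 k3] := k1 G; have := ob_mu cx a b nU; rewrite /OrderBounds.ob expr0 mul1r -(n_z cx) => k4.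
    by rewrite ger0_norm // /X; have := k4; rewrite -/M; lra.
  rewrite exD !exZ; rewrite lerD2l; apply: ler_wpM2l; last exact: tb.
  by rewrite exprn_ge0 // mulr_ge0.
have hT : ob 5 2040 (ex M (fun G => (D G)^-1) - ((1 + z ^+ 2) / B - (1 - cc (mt U)) * w * z ^+ 4)).
  have -> : ex M (fun G => (D G)^-1) = Db^-1 + Db^-1 ^+ 3 * phi 2 M + Db^-1 ^+ 4 * phi 3 M
      + Db^-1 ^+ 4 * ex M (fun G => e G ^+ 4 / D G).
    transitivity (ex M (fun=> Db^-1) + Db^-1 ^+ 2 * phi 1 M + Db^-1 ^+ 3 * phi 2 M + Db^-1 ^+ 4 * phi 3 M
      + Db^-1 ^+ 4 * ex M (fun G => e G ^+ 4 / D G)); last by rewrite phi1 // ex_cst // mulr0 addr0.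
    rewrite /phi -!exZ -!exD; apply: eq_ex => G hG.
    have d0 : D G != 0 by rewrite gt_eqF // (lt_le_trans ltr01) // Dst_ge1.
    have := DE G hG; rewrite -/(e G) => eD; move: d0; rewrite eD => d0.
    by field; rewrite d0 gt_eqF.
  set E4 := ex M _ in h4 *; set F2 := phi 2 M in f2 *.
  set rho := Db - B - K in hrho; pose d1 := Db - Nq; pose d2 := B - Nq.
  rewrite -/d1 in hDb; rewrite -/d2 in hB; set g2 := F2 - _ in f2.
  have t1 : ob 5 900 (Db^-1 - B^-1 + (1 - cc (mt U)) * w * z ^+ 4).
    have -> : Db^-1 - B^-1 + (1 - cc (mt U)) * w * z ^+ 4 = (K * (w * z ^+ 2 * (d1 + d2) + w ^+ 2 * z ^+ 4 * (d1 * d2)) - rho) * (Db^-1 * B^-1).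
      have -> : (1 - cc (mt U)) * w * z ^+ 4 = K * w ^+ 2 * z ^+ 4.
        by rewrite /K; field; rewrite p0 q0.
      rewrite /rho /d1 /d2 /Nq nE; field; rewrite p0 q0 z0 gt_eqF // gt_eqF //.
    obt.
  have t2 : ob 5 1900 (Db^-1 ^+ 3 * F2 - z ^+ 2 / B).
    have hN : ob (-2) 3 Nq by rewrite /Nq; obt.
    have -> : Db^-1 ^+ 3 * F2 - z ^+ 2 / B = (z ^+ 2 * Nq ^+ 2 * d2 + g2 * B
       - z ^+ 2 * (3 * Nq ^+ 2 * d1 + 3 * Nq * d1 ^+ 2 + d1 ^+ 3)) * (Db^-1 ^+ 3 * B^-1).
      rewrite /g2 /d1 /d2 (_ : (p * (1 - p)) ^+ 2 * n%:R = z ^+ 2 * Nq ^+ 2); last first.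
        by rewrite /Nq nE; field.
      by field; rewrite !gt_eqF.
    have hB2 : ob (-2) 45 B by rewrite (_ : B = d2 + Nq); [obt | rewrite /d2; ring].
    obt.
  set Z1 := Db^-1 ^+ 4 * phi 3 M; have hZ1 : ob 5 1300 Z1 by rewrite /Z1; obt.
  set Z2 := Db^-1 ^+ 4 * E4; have hZ2 : ob 5 2030 Z2 by rewrite /Z2; obt.
  rewrite (_ : _ - _ = (Db^-1 - B^-1 + (1 - cc (mt U)) * w * z ^+ 4) + (Db^-1 ^+ 3 * F2 - z ^+ 2 / B) + Z1 + Z2); first obt.
  by rewrite mulrDl mul1r; ring.
have hv : ob (-1) 30 v.
  by rewrite (_ : v = (ms U a - p * n%:R) - (ms U b - p * n%:R)); [obt | rewrite /v; ring].
rewrite eV -/B in hE *; set T := ex M _ in hE hT.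
rewrite (_ : _ - _ = (rat U a b - 1 - v * T) + v * (T - ((1 + z ^+ 2) / B - (1 - cc (mt U)) * w * z ^+ 4))); last by ring.
obt.
Qed.
End Ratio.
End SparseRatio.

End SparseRatio.
Import SparseRatio.

From mathcomp Require Import reals.
From mathcomp.analysis Require Import sequences exp.

(** * Comparison of one move with the expected formula *)

Module RowStep.

Lemma expR_le_inv (R : realType) (x : R) : x < 1 -> expR x <= (1 - x)^-1.
Proof.
move=> h; have := expR_ge1Dx (- x); rewrite expRN => h1.
have h2 : 0 < 1 - x by lra.
by rewrite -[leLHS]invrK lef_pV2 ?posrE // invr_gt0 expR_gt0.
Qed.

Lemma expR_quad (R : realType) (x : R) : x <= 1 / 2 -> 0 <= expR x - 1 - x <= 2 * x ^+ 2.
Proof.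
move=> h; have h1 := expR_ge1Dx x; have h2 : x < 1 by lra.
apply/andP; split; first by lra.
have h3 := expR_le_inv h2.
have h4 : 0 < 1 - x by lra.
suff : (1 - x)^-1 <= 1 + x + 2 * x ^+ 2 by lra.
rewrite -div1r ler_pdivrMr //.
have : 0 <= x ^+ 2 * (1 - 2 * x) by rewrite mulr_ge0 ?sqr_ge0 //; lra.
by rewrite expr2; lra.
Qed.

Lemma le_half_double (F : realFieldType) (x : F) : x <= 2 * x / 2.
Proof. lra. Qed.

Lemma product_absorb (F : realFieldType) (r rho zeta e eps : F) :
  - (1 / 4) <= rho - 1 -> - (1 / 4) <= zeta -> 1 + zeta <= e -> 0 <= eps ->
  (r - rho - zeta) - (rho - 1) * zeta <= eps / 2 -> r <= (1 + eps) * (rho * e).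
Proof.
move=> h1 h2 h3 h4 h5.
have h6 : rho * (1 + zeta) <= rho * e by rewrite ler_wpM2l //; lra.
have h7 : (3 / 4) * (3 / 4) <= rho * (1 + zeta) by apply: ler_pM; lra.
have h8 : eps * (1 / 2) <= eps * (rho * e) by rewrite ler_wpM2l //; lra.
lra.
Qed.

Section Box.
Variables (R : realType) (n : nat) (nu z p : R).
Hypothesis cx : ctx n nu z p.
Local Notation cell := ('I_n * 'I_n)%type.
Local Notation model := (model R n).
Local Notation ob := (ob nu z).
Local Notation reg := (@reg R n nu z p).
Local Notation w := (p * (1 - p))^-1.
Let sc := cs cx.
Implicit Types (s t u : 'I_n -> nat).

Definition nr s : 'I_n -> R := fun j => (s j)%:R.
Definition M0 s t := Mod (nr s) (nr t) (set0 : {set cell}).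
Definition NN s t := Nb (M0 s t).
Definition bx s := forall j, `|nr s j - p * n%:R| <= nu / z.
(** As [w * z ^+ 4] is [1 / (p (1 - p) n^2)], this is R / (2An^2) of the theorem when p is lambda.
    [GG] is therefore the claimed formula for empty H, loops allowed, up to its constant. *)
Definition rr s := w * z ^+ 4 * \sum_j (nr s j - p * n%:R) ^+ 2.
Definition bprod s : R := \prod_j ('C(n, s j))%:R.
Definition GG s t := bprod s * bprod t * expR (- (1 / 2) * (1 - rr s) * (1 - rr t)).
Definition inc u a : 'I_n -> nat := fun j => (u j + (j == a))%N.

Lemma nrD u a j : nr (inc u a) j = nr u j + (j == a)%:R.
Proof. by rewrite /nr /inc natrD. Qed.

Lemma bin_ratio (m : nat) : (m < n)%N -> ('C(n, m.+1))%:R * (m%:R + 1) = ('C(n, m))%:R * (n%:R - m%:R) :> R.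
Proof.
move=> h; rewrite natr1 -natrB ?(ltnW h) // -!natrM; congr _%:R.
by have := mul_bin_left n m; rewrite mulnC => ->; rewrite mulnC.
Qed.

Lemma bprod_inc u a : (u a < n)%N -> 'C(n, u a)%:R != 0 :> R ->
  bprod (inc u a) = bprod u * ((n%:R - nr u a) / (nr u a + 1)).
Proof.
move=> h h0; rewrite /bprod (bigD1 a) // [in RHS](bigD1 a) //= mulrAC; congr (_ * _).
  rewrite /inc eqxx addn1 /nr mulrA -bin_ratio //.
  by rewrite mulfK // natr1 pnatr_eq0.
by apply: eq_bigr => j /negbTE nj; rewrite /inc nj addn0.
Qed.

Lemma bin_gt0 u a : (u a <= n)%N -> 0 < 'C(n, u a)%:R :> R.
Proof. by move=> h; rewrite ltr0n bin_gt0. Qed.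

Lemma bprod_gt0 s : (forall j, (s j <= n)%N) -> 0 < bprod s.
Proof. by move=> h; apply: prodr_gt0 => j _; exact: bin_gt0. Qed.

Lemma bx_le s : bx s -> forall j, (s j < n)%N.
Proof.
move=> h j; rewrite -(ltr_nat R); have := h j; have := e_lt_q cx (i := 0) isT.
by rewrite /nr ler_norml addr0 => h1 /andP[_ h2]; lra.
Qed.

Lemma GG_gt0 s t : bx s -> bx t -> 0 < GG s t.
Proof.
move=> hs ht; rewrite /GG !mulr_gt0 ?expR_gt0 ?bprod_gt0 // => j; exact/ltnW/bx_le.
Qed.

Lemma reg_M0 i s t : (forall j, `|nr s j - p * n%:R| <= nu / z + i%:R) ->
  (forall j, `|nr t j - p * n%:R| <= nu / z + i%:R) ->
  `|\sum_j nr s j - p * n%:R ^+ 2| <= i%:R -> `|\sum_j nr t j - p * n%:R ^+ 2| <= i%:R ->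
  reg i (M0 s t).
Proof.
have e0 : 0 <= nu / z + i%:R by exact: ee_ge0 cx i.
have r0 a : rd R (set0 : {set cell}) a = 0.
  by rewrite /rd big1 // => l _; rewrite /indc inE.
have c0 a : cd R (set0 : {set cell}) a = 0.
  by rewrite /cd big1 // => l _; rewrite /indc inE.
move=> h1 h2 h3 h4; split=> //= [a|a|]; rewrite ?r0 ?c0 //.
by rewrite big1 // addr_ge0 ?sqr_ge0 ?ler0n.
Qed.

(** Relative error of one move. The order z^4 matters because a path through the box has about
    z^(-3) moves. *)
Definition epsz : R := 2 * (nu ^+ 2699 * z ^+ 4).

Lemma ob4_le c (x : R) : ob 4 c x -> x <= nu ^+ c * z ^+ 4.
Proof. by move=> h; apply: le_trans (ler_norm _) _. Qed.

Lemma nuz_ge0 c k : 0 <= nu ^+ c * z ^+ k.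
Proof.
have z0 := z_gt0 cx; have nu2 := nu_ge2 cx.
by apply: mulr_ge0; apply: exprn_ge0; lra.
Qed.

Lemma epsz_ge0 : 0 <= epsz.
Proof. by apply: mulr_ge0 => //; exact: nuz_ge0. Qed.

(** A one-sided inequality is enough, since the opposite one is its instance with [a] and [b]
    exchanged; written as products it also covers empty models. *)
Lemma step_ratio u t a b : a != b -> reg 1 (M0 u t) -> bx (inc u a) -> bx (inc u b) -> bx t ->
  NN (inc u b) t * GG (inc u a) t <= (1 + epsz) * (NN (inc u a) t * GG (inc u b) t).
Proof.
move=> ab rU hsa hsb ht; set U := M0 u t in rU.
have eN c : Nb (mv c U) = NN (inc u c) t.
  by apply: Nb_eq => //= j; rewrite /incf nrD.
have Gb0 := GG_gt0 hsb ht; have Ga0 := GG_gt0 hsa ht.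
have e0 := epsz_ge0.
have [nU|nU] := boolP (nz (mv a U)); last first.
  have nU' : ~~ nz (mv b U).
    apply: contra nU => h; apply: (nz_mv cx (i := 1) (a := b)) => //; by rewrite eq_sym.
  by rewrite -!eN !Nb_eq0 // !mul0r mulr0.
have hr := rat_sparse cx ab (i := 1) isT rU erefl nU.
rewrite -!eN; have Na0 := Nb_gt0 nU.
rewrite (_ : Nb (mv b U) = rat U a b * Nb (mv a U)); last first.
  by rewrite /rat divfK // lt0r_neq0.
set va := nr u a; set vb := nr u b; set v := va - vb.
have ua : (u a < n)%N by have := bx_le hsa a; rewrite /inc eqxx addn1 => /ltnW.
have ub : (u b < n)%N by have := bx_le hsb b; rewrite /inc eqxx addn1 => /ltnW.
have ba0 : 'C(n, u a)%:R != 0 :> R by rewrite gt_eqF // bin_gt0 // ltnW.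
have bb0 : 'C(n, u b)%:R != 0 :> R by rewrite gt_eqF // bin_gt0 // ltnW.
have nva : 0 < n%:R - va by rewrite subr_gt0 ltr_nat.
have nvb : 0 < n%:R - vb by rewrite subr_gt0 ltr_nat.
have va0 : 0 < va + 1 by rewrite ltr_wpDl // ler0n.
have vb0 : 0 < vb + 1 by rewrite ltr_wpDl // ler0n.
have bu0 : 0 < bprod u.
  apply: bprod_gt0 => j; have [->|nj] := eqVneq j a; first exact: ltnW.
  by have := bx_le hsa j; rewrite /inc (negbTE nj) addn0 => /ltnW.
have bt0 : 0 < bprod t by apply: bprod_gt0 => j; exact/ltnW/bx_le.
(* By [eG], [rho] and [expR zeta] are exactly the factors by which the binomials and the exponential
   of [GG] change; [rhoE] and [zeta] are the two terms found in [rat_sparse]. *)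
pose zeta := - (1 - rr t) * v * w * z ^+ 4.
pose rho := (n%:R - vb) * (va + 1) / ((vb + 1) * (n%:R - va)).
have rrD : rr (inc u b) - rr (inc u a) = - (2 * v * w * z ^+ 4).
  have sq c : \sum_j (nr (inc u c) j - p * n%:R) ^+ 2 =
      \sum_j (nr u j - p * n%:R) ^+ 2 + 2 * (nr u c - p * n%:R) + 1.
    rewrite (bigD1 c) // [in RHS](bigD1 c) //= nrD eqxx /=.
    rewrite (eq_bigr (fun j => (nr u j - p * n%:R) ^+ 2)); first by ring.
    by move=> j /negbTE nj; rewrite nrD nj addr0.
  by rewrite /rr !sq /v /va /vb; ring.
have eG : GG (inc u b) t = rho * expR zeta * GG (inc u a) t.
  rewrite /GG !bprod_inc // -/va -/vb.
  have -> : - (1 / 2) * (1 - rr (inc u b)) * (1 - rr t) = zeta + - (1 / 2) * (1 - rr (inc u a)) * (1 - rr t).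
    rewrite (_ : rr (inc u b) = rr (inc u a) + (rr (inc u b) - rr (inc u a))); last by ring.
    by rewrite rrD /zeta; field; have [? ? ?] := pq_neq0 cx; apply/andP.
  rewrite expRD /rho; field; rewrite !gt_eqF //.
have nz2 : n%:R * z ^+ 2 = 1 := scale_n sc.
have [p0 q0 z0] := pq_neq0 cx.
have hp := ob_p cx; have hw := ob_w cx.
have hi' : (1 <= 128)%N by [].
have hsa' : ob (-1) 8 (va - p * n%:R) by exact: (ob_s cx hi' rU a).
have hsb' : ob (-1) 8 (vb - p * n%:R) by exact: (ob_s cx hi' rU b).
have hv : ob (-1) 10 v.
  by rewrite (_ : v = (va - p * n%:R) - (vb - p * n%:R)); [obt | rewrite /v; ring].
have hrt : ob 0 25 (rr t).
  by have htt := ob_t cx hi' rU; rewrite /rr; rewrite /= in htt; obt.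
have hz : ob 3 50 zeta by rewrite /zeta; obt.
pose B := BB n z va vb.
have hB : ob (-1) 40 (B - p * (1 - p) * n%:R).
  rewrite (_ : B - _ = (n%:R * z ^+ 2) * (vb - p * n%:R + 1) * (1 - p)
     - (vb - p * n%:R + 1) * (va - p * n%:R) * z ^+ 2 - (n%:R * z ^+ 2) * p * (va - p * n%:R)
     + (n%:R * z ^+ 2 - 1) * p * (1 - p) * n%:R); last by rewrite /B /BB; ring.
  rewrite nz2 subrr !mul0r !mul1r addr0; obt.
have hBi : ob 2 2 B^-1.
  by apply: (inv_pq cx); apply: (near_pq cx hB).
have rhoE : rho = 1 + v * ((1 + z ^+ 2) / B).
  have n0 := n_gt0 cx.
  rewrite /B /BB (_ : 1 + z ^+ 2 = (n%:R + 1) * z ^+ 2); last by rewrite mulrDl nz2 mul1r.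
  by rewrite /rho /v; field; rewrite z0 !gt_eqF.
have hrho : ob 1 30 (rho - 1) by rewrite rhoE addrAC subrr add0r; obt.
have hz1 : `|zeta| <= 1 / 4.
  have h : ob 1 60 (4 * zeta) by obt.
  have := ob_small sc bigE (csm cx) h isT isT.
  by rewrite normrM ger0_norm //; lra.
have hrho1 : `|rho - 1| <= 1 / 4.
  have h : ob 1 60 (4 * (rho - 1)) by obt.
  have := ob_small sc bigE (csm cx) h isT isT.
  by rewrite normrM ger0_norm //; lra.
move: hz1 hrho1; rewrite !ler_norml => /andP[z1 z2] /andP[r1 r2].
have ez := expR_ge1Dx zeta.
have hd : ob 4 2602 ((rat U a b - rho - zeta) - (rho - 1) * zeta).
  have h1 : ob 4 2600 (rat U a b - rho - zeta).
    rewrite (_ : _ - zeta = rat U a b - (1 + v * ((1 + z ^+ 2) / B - (1 - rr t) * w * z ^+ 4))) //.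
    by rewrite rhoE /zeta; ring.
  obt.
rewrite eG.
suff hh : rat U a b <= (1 + epsz) * (rho * expR zeta).
  rewrite (_ : (1 + epsz) * _ = ((1 + epsz) * (rho * expR zeta)) * (Nb (mv a U) * GG (inc u a) t)); last by ring.
  by rewrite -mulrA; apply: ler_wpM2r hh; rewrite mulr_ge0 // ltW.
have h2 : (rat U a b - rho - zeta) - (rho - 1) * zeta <= epsz / 2.
  have h3 : ob 4 2699 ((rat U a b - rho - zeta) - (rho - 1) * zeta) by obt.
  exact: le_trans (ob4_le h3) (le_half_double _).
exact: (product_absorb r1 z1 ez e0 h2).
Qed.

End Box.

End RowStep.
Import RowStep.

(** * Count over formula is nearly constant on the box *)

Module BoxConstancy.

Section BoxPath.
Variables (R : realType) (n : nat) (nu z p : R).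
Hypothesis cx : ctx n nu z p.
Local Notation cell := ('I_n * 'I_n)%type.
Local Notation model := (model R n).
Local Notation ob := (ob nu z).
Local Notation reg := (@reg R n nu z p).
Local Notation w := (p * (1 - p))^-1.
Let sc := cs cx.
Implicit Types (s t u : 'I_n -> nat).

Local Notation nr := (@nr R n).
Local Notation M0 := (@M0 R n).
Local Notation NN := (@NN R n).
Local Notation bx := (@bx R n nu z p).
Local Notation rr := (@rr R n z p).
Local Notation bprod := (@bprod R n).
Local Notation GG := (@GG R n z p).
Local Notation epsz := (@epsz R nu z).
Local Notation inc := (@inc n).

Definition l1 s s' := (\sum_j ((s j - s' j) + (s' j - s j)))%N.

(** Equal totals force a coordinate in excess and one in deficit; moving a unit between them lowers
    the distance by 2. [u] is the vector before the unit is put back. *)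
Lemma l1_step s s' : (\sum_j s j = \sum_j s' j)%N -> l1 s s' != 0%N ->
  exists u a b, [/\ a != b, inc u a =1 s, (s' a < s a)%N, (s b < s' b)%N &
     (l1 (inc u b) s').+2 = l1 s s'].
Proof.
move=> e h.
have [a ha] : exists a, (s' a < s a)%N.
  apply/existsP; apply: contraNT h; rewrite negb_exists => /forallP h.
  have le j : (s j <= s' j)%N by rewrite leqNgt.
  have e0 : (\sum_j (s' j - s j) = 0)%N by rewrite sumnB // e subnn.
  rewrite /l1 big_split /= e0 addn0 sum_nat_eq0; apply/forallP => j; apply/implyP => _.
  by rewrite subn_eq0.
have [b hb] : exists b, (s b < s' b)%N.
  apply/existsP; apply: contraNT h; rewrite negb_exists => /forallP h.
  have le j : (s' j <= s j)%N by rewrite leqNgt.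
  have e0 : (\sum_j (s j - s' j) = 0)%N by rewrite sumnB // e subnn.
  rewrite /l1 big_split /= e0 add0n sum_nat_eq0; apply/forallP => j; apply/implyP => _.
  by rewrite subn_eq0.
have ab : a != b by apply/eqP => eab; move: ha hb; rewrite eab => h1 /(ltn_trans h1); rewrite ltnn.
pose u : 'I_n -> nat := fun j => (s j - (j == a))%N.
have es : inc u a =1 s.
  by move=> j; rewrite /inc /u; case: eqP => [->|_]; rewrite ?subn0 ?addn0 // subnK // (leq_ltn_trans _ ha).
exists u, a, b; split=> //.
rewrite /l1 (bigD1 a) // (bigD1 b) 1?eq_sym //= [in RHS](bigD1 a) // [in RHS](bigD1 b) 1?eq_sym //=.
rewrite (eq_bigr (fun j => (s j - s' j + (s' j - s j))%N)).
  rewrite /inc /u eqxx (negbTE ab) (eq_sym b) (negbTE ab) eqxx /=; lia.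
by move=> j /andP[/negbTE ja /negbTE jb]; rewrite /inc /u ja jb subn0 addn0.
Qed.

Lemma NN_ext s s' t : s =1 s' -> NN s t = NN s' t.
Proof. by move=> h; apply: Nb_eq => //= j; rewrite /nr h. Qed.

Lemma GG_ext s s' t : s =1 s' -> GG s t = GG s' t.
Proof.
move=> h; rewrite /GG /bprod /rr /nr; congr (_ * _ * expR (_ * (1 - _ * _) * _)).
  by apply: eq_bigr => j _; rewrite h.
by apply: eq_bigr => j _; rewrite h.
Qed.

Hypothesis m : nat.
Hypothesis hm : m%:R = p * n%:R ^+ 2.

Lemma row_path L s s' t : (l1 s s' <= L.*2)%N -> (\sum_j s j = m)%N -> (\sum_j s' j = m)%N ->
  (\sum_j t j = m)%N -> bx s -> bx s' -> bx t ->
  NN s' t * GG s t <= (1 + epsz) ^+ L * (NN s t * GG s' t).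
Proof.
have e0 := epsz_ge0 cx.
elim: L s => [|L IH] s hl ms ms' mt bs bs' bt.
  have es : s' =1 s.
    move: hl; rewrite leqn0 sum_nat_eq0 => /forallP h j; have := h j; lia.
  by rewrite (NN_ext t es) (GG_ext t es) mul1r.
have [h0|h0] := eqVneq (l1 s s') 0%N.
  have IH0 := IH s ltac:(by rewrite h0) ms ms' mt bs bs' bt.
  apply: le_trans IH0 _; apply: ler_wpM2r.
    by apply: mulr_ge0; [exact: Nb_ge0 | exact/ltW/(GG_gt0 cx)].
  by rewrite exprS ler_peMl ?exprn_ge0 //; lra.
have [u [a [b [ab es ha hb hl']]]] := l1_step (etrans ms (esym ms')) h0.
pose s1 := inc u b.
have us j : (s j = u j + (j == a))%N by rewrite -es.
have s1E j : (s1 j = u j + (j == b))%N by [].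
(* Each coordinate of [s1] lies between those of [s] and [s'], and the box is a product of
   intervals, so the path never leaves it. *)
have bs1 : bx s1.
  move=> j; have := bs j; have := bs' j; rewrite /nr !ler_norml.
  have [jb|jb] := eqVneq j b.
    have h1 : (s j <= s1 j <= s' j)%N.
      by rewrite us s1E jb eqxx; move: hb; rewrite us eq_sym (negbTE ab); lia.
    move: h1 => /andP[]; rewrite -!(ler_nat R) => h1 h2 /andP[? ?] /andP[? ?]; lra.
  have [ja|ja] := eqVneq j a.
    have h1 : (s' j <= s1 j <= s j)%N.
      by rewrite us s1E ja eqxx (negbTE ab); move: ha; rewrite us eqxx; lia.
    move: h1 => /andP[]; rewrite -!(ler_nat R) => h1 h2 /andP[? ?] /andP[? ?]; lra.
  by rewrite s1E (negbTE jb) -(_ : s j = u j + 0)%N ?us ?(negbTE ja) // => _.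
have msum1 f : (\sum_j (u j + (j == f)) = (\sum_j u j).+1)%N.
  rewrite big_split /= (_ : (\sum_j (j == f) = 1)%N) ?addn1 //.
  by rewrite (bigD1 f) //= eqxx big1 // => j /negbTE ->.
have mu1 : ((\sum_j u j).+1 = m)%N by rewrite -ms -(msum1 a); apply: eq_bigr => j _; rewrite us.
have ms1 : (\sum_j s1 j = m)%N by rewrite -mu1 -(msum1 b); apply: eq_bigr.
have IH1 := IH s1 ltac:(by move: hl; rewrite -hl' doubleS !ltnS) ms1 ms' mt bs1 bs' bt.
have sumE (f : 'I_n -> nat) : \sum_j nr f j = (\sum_j f j)%N%:R by rewrite natr_sum.
have rU : reg 1 (M0 u t).
  apply: (reg_M0 cx).
  - move=> j; have := bs j; rewrite (_ : nr s j = nr u j + (j == a)%:R); last by rewrite -nrD /nr es.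
    have /andP[? ?] := b01 R (j == a); rewrite !ler_norml => /andP[? ?]; lra.
  - by move=> j; apply: le_trans (bt j) _; rewrite lerDl.
  - rewrite sumE -hm -mu1 -natr1 ler_norml; lra.
  - by rewrite sumE mt hm subrr normr0.
have bsa : bx (inc u a) by move=> j; rewrite /nr es; exact: bs.
have st := step_ratio cx ab rU bsa bs1 bt.
rewrite (NN_ext t es) (GG_ext t es) -/s1 in st.
have g1 := GG_gt0 cx bs1 bt; have gs' := GG_gt0 cx bs' bt; have gs := GG_gt0 cx bs bt.
rewrite -(ler_pM2r g1).
apply: (@le_trans _ _ ((1 + epsz) ^+ L * (NN s1 t * GG s' t) * GG s t)).
  by rewrite mulrAC ler_pM2r.
rewrite (_ : _ * GG s t = ((1 + epsz) ^+ L * GG s' t) * (NN s1 t * GG s t)); last by ring.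
rewrite (_ : _ * GG s1 t = ((1 + epsz) ^+ L * GG s' t) * ((1 + epsz) * (NN s t * GG s1 t))); last by rewrite exprS; ring.
by apply: ler_wpM2l st; rewrite mulr_ge0 ?exprn_ge0 ?ltW //; lra.
Qed.

Lemma trans_cell G (s t : 'I_n -> R) : (G \in gs (Mod s t set0)) =
  ([set c : cell | (c.2, c.1) \in G] \in gs (Mod t s set0)).
Proof.
have e1 j : rd R [set c : cell | (c.2, c.1) \in G] j = cd R G j.
  by apply: eq_bigr => k _; rewrite /indc inE.
have e2 j : cd R [set c : cell | (c.2, c.1) \in G] j = rd R G j.
  by apply: eq_bigr => k _; rewrite /indc inE.
apply/gsP/gsP => /= -[h1 h2 h3]; split=> *; rewrite ?e1 ?e2 ?inE //.
  by rewrite -e2.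
by rewrite -e1.
Qed.

(** Transposition of the matrix; it yields the statements about column sums from those about row
    sums. *)
Lemma NNC s t : NN s t = NN t s.
Proof.
pose tr (G : {set cell}) := [set c : cell | (c.2, c.1) \in G].
have trK : involutive tr by move=> G; apply/setP => -[x y]; rewrite !inE.
rewrite /NN /Nb -(card_imset _ (inv_inj trK)); congr _%:R; apply: eq_card => G.
apply/imsetP/idP => [[G' h ->]|h]; first by rewrite -trans_cell.
by exists (tr G); rewrite ?trK // -trans_cell.
Qed.

Lemma GGC s t : GG s t = GG t s.
Proof.
have e : - (1 / 2) * (1 - rr s) * (1 - rr t) = - (1 / 2) * (1 - rr t) * (1 - rr s) by ring.
by rewrite /RowStep.GG e (mulrC (bprod s)).
Qed.

Lemma l1_bound s s' : bx s -> bx s' -> (l1 s s')%:R <= n%:R * (2 * (nu / z)).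
Proof.
move=> h h'; rewrite /l1 natr_sum -(sum_cst n (2 * (nu / z))); apply: ler_sum => j _.
have := h j; have := h' j; rewrite /nr !ler_norml => /andP[? ?] /andP[? ?].
case: (leqP (s j) (s' j)) => hj.
  by rewrite (eqP hj) add0n natrB //; lra.
by rewrite (eqP (ltnW hj)) addn0 natrB ?(ltnW hj) //; lra.
Qed.

(** Total error along a path: at most [n * (2 * (nu / z))] moves, each with relative error
    [epsz]. *)
Definition epsN : R := nu ^+ 2750 * z.

Lemma pow_exp (x : R) L : 0 <= x -> (1 + x) ^+ L <= expR (L%:R * x).
Proof.
move=> x0; rewrite mulrC expRM_natr; apply: lerXn2r; rewrite ?nnegrE ?expR_ge0 ?addr_ge0 //.
exact: expR_ge1Dx.
Qed.

Lemma row_const s s' t : (\sum_j s j = m)%N -> (\sum_j s' j = m)%N ->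
  (\sum_j t j = m)%N -> bx s -> bx s' -> bx t ->
  NN s' t * GG s t <= expR epsN * (NN s t * GG s' t).
Proof.
move=> ms ms' mt bs bs' bt.
have z0 := z_gt0 cx; have nu2 := nu_ge2 cx.
have e0 := epsz_ge0 cx.
apply: le_trans (row_path (L := l1 s s') _ ms ms' mt bs bs' bt) _.
  by rewrite -addnn leq_addr.
apply: ler_wpM2r; first by rewrite mulr_ge0 ?Nb_ge0 // ltW // (GG_gt0 cx).
apply: le_trans (pow_exp _ e0) _; rewrite ler_expR.
apply: le_trans (ler_wpM2r e0 (l1_bound bs bs')) _.
have h : ob 1 2750 (n%:R * (2 * (nu / z)) * epsz) by rewrite /epsz; obt.
by apply: le_trans (ler_norm _) _; move: h; rewrite /OrderBounds.ob expr1z.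
Qed.

Lemma box_const s s' t t' : (\sum_j s j = m)%N -> (\sum_j s' j = m)%N ->
  (\sum_j t j = m)%N -> (\sum_j t' j = m)%N -> bx s -> bx s' -> bx t -> bx t' ->
  NN s' t' * GG s t <= expR (2 * epsN) * (NN s t * GG s' t').
Proof.
move=> ms ms' mt mt' bs bs' bt bt'.
have h1 := row_const ms ms' mt bs bs' bt.
have h2 := row_const mt mt' ms' bt bt' bs'.
rewrite !(NNC _ s') !(GGC _ s') in h2.
have g := GG_gt0 cx bs' bt; have g' := GG_gt0 cx bs bt; have g2 := GG_gt0 cx bs' bt'.
rewrite -(ler_pM2r g) (_ : 2 * epsN = epsN + epsN) ?expRD; last by ring.
apply: (@le_trans _ _ (expR epsN * (NN s' t * GG s' t') * GG s t)).
  by rewrite mulrAC ler_pM2r.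
rewrite (_ : _ * GG s t = expR epsN * GG s' t' * (NN s' t * GG s t)); last by ring.
rewrite (_ : _ * GG s' t = expR epsN * GG s' t' * (expR epsN * (NN s t * GG s' t))); last by ring.
by apply: ler_wpM2l h1; rewrite mulr_ge0 ?expR_ge0 // ltW.
Qed.
End BoxPath.

End BoxConstancy.
Import BoxConstancy.

(** * Tail bounds for independent binomial row sums *)

Module BinomialTails.

Section Binomial.
Variables (R : realType) (p : R).
Hypotheses (p0 : 0 < p) (p1 : p < 1).
Local Notation q := (1 - p).
Implicit Types (N i : nat) (h : nat -> R).

(** Expectation under the binomial law, defined by conditioning on one trial; variance and
    exponential moments then follow by short inductions, and [EbE] recovers the weights. *)
Fixpoint Eb N h : R :=
  if N is N'.+1 then Eb N' (fun i => p * h i.+1 + q * h i) else h 0%N.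

Definition bw N i : R := 'C(N, i)%:R * p ^+ i * q ^+ (N - i).

Lemma EbE N h : Eb N h = \sum_(i < N.+1) bw N i * h i.
Proof.
elim: N h => [|N IH] h /=.
  by rewrite big_ord_recl big_ord0 addr0 /bw bin0 subn0 !expr0 !mul1r.
rewrite IH.
have -> : \sum_(i < N.+2) bw N.+1 i * h i =
  \sum_(i < N.+2) ('C(N, i)%:R * p ^+ i * q ^+ (N.+1 - i)) * h i +
  \sum_(i < N.+1) ('C(N, i)%:R * p ^+ i.+1 * q ^+ (N - i)) * h i.+1.
  rewrite [LHS]big_ord_recl [X in _ = X + _]big_ord_recl /= -addrA -big_split /=; congr (_ + _).
    by rewrite /bw !bin0.
  apply: eq_bigr => i _; rewrite /bw /bump /= !add1n binS natrD subSS; ring.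
rewrite [X in _ = X + _]big_ord_recr /= bin_small // !mul0r addr0 -big_split /=; apply: eq_bigr => i _.
have hi : (i <= N)%N by rewrite -ltnS.
by rewrite /bw exprS subSn // exprS; ring.
Qed.

Lemma bw_ge0 N i : 0 <= bw N i.
Proof.
have p0' := p0; have p1' := p1.
apply: mulr_ge0; last by apply: exprn_ge0; lra.
by apply: mulr_ge0; [exact: ler0n | apply: exprn_ge0; lra].
Qed.

Lemma Eb_ext N h1 h2 : h1 =1 h2 -> Eb N h1 = Eb N h2.
Proof. by move=> e; rewrite !EbE; apply: eq_bigr => i _; rewrite e. Qed.

Lemma EbD N h1 h2 : Eb N (fun i => h1 i + h2 i) = Eb N h1 + Eb N h2.
Proof. by rewrite !EbE -big_split; apply: eq_bigr => i _; rewrite mulrDr. Qed.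

Lemma EbZ N x h : Eb N (fun i => x * h i) = x * Eb N h.
Proof. by rewrite !EbE mulr_sumr; apply: eq_bigr => i _; rewrite mulrCA. Qed.

Lemma Eb_le N h1 h2 : (forall i, (i <= N)%N -> h1 i <= h2 i) -> Eb N h1 <= Eb N h2.
Proof.
move=> h; rewrite !EbE; apply: ler_sum => i _; apply: ler_wpM2l; first exact: bw_ge0.
by apply: h; rewrite -ltnS.
Qed.

Lemma Eb1 N : Eb N (fun=> 1) = 1.
Proof.
elim: N => //= N IH; rewrite -[RHS]IH; apply: Eb_ext => i; ring.
Qed.

Lemma Eb_var N : Eb N (fun i => (i%:R - p * N%:R) ^+ 2) = N%:R * (p * q).
Proof.
elim: N => [|N IH] /=; first by rewrite mulr0 subrr expr0n mul0r.
rewrite (@Eb_ext N _ (fun i => (i%:R - p * N%:R) ^+ 2 + (p * q) * 1)); last first.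
  by move=> i; rewrite -!natr1; ring.
by rewrite EbD EbZ Eb1 IH -natr1; ring.
Qed.

Lemma Eb_mgf N th : Eb N (fun i => expR (th * (i%:R - p * N%:R))) =
  (p * expR (th * q) + q * expR (- (th * p))) ^+ N.
Proof.
elim: N => [|N IH] /=; first by rewrite mulr0 subrr mulr0 expR0.
rewrite (@Eb_ext N _ (fun i => (p * expR (th * q) + q * expR (- (th * p))) * expR (th * (i%:R - p * N%:R)))).
  by rewrite EbZ IH exprS.
move=> i; rewrite -!natr1.
rewrite (_ : th * (i%:R + 1 - p * (N%:R + 1)) = th * q + th * (i%:R - p * N%:R)); last by ring.
rewrite (_ : th * (i%:R - p * (N%:R + 1)) = - (th * p) + th * (i%:R - p * N%:R)); last by ring.
by rewrite !expRD; ring.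
Qed.

Lemma Eb_mgf_le N th : `|th| <= 1 / 2 ->
  Eb N (fun i => expR (th * (i%:R - p * N%:R))) <= expR (2 * th ^+ 2 * N%:R).
Proof.
rewrite ler_norml => /andP[t1 t2]; rewrite Eb_mgf expRM_natr.
have p0' := p0; have p1' := p1.
apply: lerXn2r; rewrite ?nnegrE ?expR_ge0 //.
  by apply: addr_ge0; apply: mulr_ge0; rewrite ?expR_ge0 //; lra.
have b (x : R) : 0 <= x <= 1 -> - (1 / 2) <= th * x <= 1 / 2.
  by move=> /andP[? ?]; apply/andP; split; nra.
have hq : 0 <= q <= 1 by lra.
have hp : 0 <= p <= 1 by lra.
have /andP[a1 a2] := b _ hq; have /andP[b1 b2] := b _ hp.
have /andP[_ e1] := expR_quad a2.
have b3 : - (th * p) <= 1 / 2 by lra.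
have /andP[_ e2] := expR_quad b3.
have e3 := expR_ge1Dx (2 * th ^+ 2).
set x := expR (th * q) in e1 *; set y := expR (- _) in e2 *.
apply: le_trans e3.
have h1 : p * x <= p * (1 + th * q + 2 * (th * q) ^+ 2) by rewrite ler_pM2l //; lra.
have h2 : q * y <= q * (1 - th * p + 2 * (- (th * p)) ^+ 2) by rewrite ler_pM2l //; lra.
have h3 : 0 <= th ^+ 2 * (1 - p * q) by rewrite mulr_ge0 ?sqr_ge0 //; nra.
by lra.
Qed.

Lemma bw_rec N i : (i < N)%N -> bw N i.+1 * (i.+1%:R * q) = bw N i * ((N%:R - i%:R) * p).
Proof.
move=> h; have hb : 'C(N, i.+1)%:R * i.+1%:R = 'C(N, i)%:R * (N%:R - i%:R) :> R.
  rewrite -natrB ?(ltnW h) // -!natrM; congr _%:R.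
  by have := mul_bin_left N i; rewrite mulnC => ->; rewrite mulnC.
rewrite /bw (_ : (N - i = (N - i.+1).+1)%N); last by lia.
rewrite exprS [q ^+ _.+1]exprS.
rewrite (_ : _ * _ * _ * _ = ('C(N, i.+1)%:R * i.+1%:R) * (p * p ^+ i * q ^+ (N - i.+1) * q)); last by ring.
by rewrite hb; ring.
Qed.

(** The mean pN is the integer m, so the weights increase up to m and decrease afterwards; the
    largest of N + 1 weights with sum 1 is at least 1 / (N + 1). *)
Lemma bw_mode N m : m%:R = p * N%:R -> (m <= N)%N -> 1 <= (N%:R + 1) * bw N m.
Proof.
move=> hm mN; have p0' := p0; have p1' := p1.
have up d : (d <= m)%N -> bw N (m - d) <= bw N m.
  elim: d => [|d IH] hd; first by rewrite subn0.
  apply: le_trans (IH (ltnW hd)); set i := (m - d.+1)%N.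
  have ei : (m - d = i.+1)%N by rewrite /i; lia.
  have iN : (i < N)%N by rewrite /i; lia.
  rewrite ei; have e := bw_rec iN.
  have hi : i%:R + 1 <= m%:R :> R by rewrite natr1 ler_nat /i; lia.
  have h1 : 0 < i.+1%:R * q by rewrite mulr_gt0 ?ltr0Sn //; lra.
  rewrite -(ler_pM2r h1) e; apply: ler_wpM2l; first exact: bw_ge0.
  rewrite -natr1; have : (N%:R - i%:R) * p = m%:R - p * i%:R by rewrite hm; ring.
  by move=> ->; nra.
have down d : (m + d <= N)%N -> bw N (m + d) <= bw N m.
  elim: d => [|d IH] hd; first by rewrite addn0.
  rewrite addnS in hd *; apply: le_trans (IH (ltnW hd)); set i := (m + d)%N in hd *.
  have e := bw_rec hd.
  have hi : m%:R <= i%:R :> R by rewrite ler_nat /i leq_addr.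
  have h1 : 0 < i.+1%:R * q by rewrite mulr_gt0 ?ltr0Sn //; lra.
  rewrite -(ler_pM2r h1) e; apply: ler_wpM2l; first exact: bw_ge0.
  rewrite -natr1; have : (N%:R - i%:R) * p = m%:R - p * i%:R by rewrite hm; ring.
  by move=> ->; nra.
have all (i : 'I_N.+1) : bw N i <= bw N m.
  have [h|h] := leqP i m; first by rewrite -(subKn h); apply: up; rewrite leq_subr.
  by rewrite -(subnKC (ltnW h)); apply: down; rewrite subnKC ?(ltnW h) // -ltnS.
rewrite -[leLHS](Eb1 N) EbE natr1.
apply: (@le_trans _ _ (\sum_(i < N.+1) bw N m)).
  by apply: ler_sum => i _; rewrite mulr1.
by rewrite sumr_const card_ord -(mulr_natl (bw N m)).
Qed.

Section Tails.
Variables (n : nat) (nu z : R).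
Hypotheses (z0 : 0 < z) (z1 : z <= 1 / 2) (nz2 : n%:R * z ^+ 2 = 1) (nu2 : 2 <= nu).
Hypothesis hexp : expR (- nu) <= z ^+ 20.

Local Notation S := {ffun 'I_n -> 'I_n.+1}.
Definition dv (i : nat) : R := i%:R - p * n%:R.
Definition outb (i : nat) : bool := nu / z < `|dv i|.
Definition WS (s : S) : R := \prod_a bw n (s a).
Definition Yv i := dv i ^+ 2 - n%:R * (p * q).

Lemma expR2_le : expR 2 <= 16 :> R.
Proof.
have h : (1 / 2 : R) < 1 by lra.
have := expR_le_inv h; rewrite (_ : 1 - 1 / 2 = 2^-1 :> R); last by field.
rewrite invrK => h2; rewrite [X in expR X](_ : _ = 1 / 2 * 4%:R); last by field.
rewrite expRM_natr.
have h4 : expR (1 / 2 : R) ^+ 4 <= 2 ^+ 4 by apply: lerXn2r; rewrite ?nnegrE ?expR_ge0.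
by apply: le_trans h4 _; rewrite -natrX ler_nat.
Qed.

Lemma mgf_z th : `|th| = z -> Eb n (fun i => expR (th * dv i)) <= 16.
Proof.
move=> ht; apply: le_trans (Eb_mgf_le n _) _; first by rewrite ht.
apply: le_trans expR2_le; rewrite ler_expR -(real_normK (num_real th)) ht.
by rewrite -mulrA (mulrC _ n%:R) nz2 mulr1.
Qed.

(** Exponential Markov inequality with parameters z and -z, where the exponential moment is bounded
    because [n%:R * z ^+ 2 = 1]. Leaving the box costs [expR (- nu)]. *)
Lemma out_tail : Eb n (fun i => (outb i)%:R) <= 32 * z ^+ 20.
Proof.
apply: (@le_trans _ _ (Eb n (fun i => expR (- nu) * expR (z * dv i) + expR (- nu) * expR (- z * dv i)))).
  apply: Eb_le => i _; rewrite /outb; case: ltP => h /=; last first.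
    by rewrite addr_ge0 ?mulr_ge0 ?expR_ge0.
  rewrite -!expRD; move: h; rewrite ltr_normr !ltr_pdivrMr // !(mulrC _ z) => h.
  have e1 := expR_ge0 (- nu + z * dv i); have e2 := expR_ge0 (- nu + - z * dv i).
  case/orP: h => h.
    have := expR_ge1Dx (- nu + z * dv i); lra.
  by have := expR_ge1Dx (- nu + - z * dv i); lra.
rewrite EbD !EbZ -mulrDr.
have h1 := mgf_z (gtr0_norm z0); have h2 := @mgf_z (- z) ltac:(by rewrite normrN gtr0_norm).
have e0 := expR_ge0 (- nu).
apply: (@le_trans _ _ (expR (- nu) * 32)); first by apply: ler_wpM2l => //; lra.
by rewrite mulrC ler_pM2l.
Qed.

Lemma distrW (F : 'I_n -> nat -> R) :
  \sum_(s : S) \prod_a F a (s a) = \prod_a \sum_(i < n.+1) F a i.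
Proof. by rewrite bigA_distr_bigA. Qed.

Definition inbox (s : S) : bool := [forall a, ~~ outb (s a)].

Lemma WS_ge0 s : 0 <= WS s.
Proof. by apply: prodr_ge0 => a _; exact: bw_ge0. Qed.

Lemma box_tail : \sum_(s | ~~ inbox s) WS s <= n%:R * (32 * z ^+ 20).
Proof.
apply: (@le_trans _ _ (\sum_(s : S) \sum_(a : 'I_n) (outb (s a))%:R * WS s)).
  rewrite big_mkcond; apply: ler_sum => s _; have w0 := WS_ge0 s.
  have s0 : 0 <= \sum_a (outb (s a))%:R * WS s.
    by apply: sumr_ge0 => a _; rewrite mulr_ge0 ?ler0n.
  case: ifP => // /forallPn[a]; rewrite negbK => ha.
  by rewrite (bigD1 a) //= ha mul1r lerDl sumr_ge0 // => b _; rewrite mulr_ge0 ?ler0n.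
rewrite exchange_big -(sum_cst n (32 * z ^+ 20)) /=; apply: ler_sum => a _.
pose F (b : 'I_n) i := (if b == a then (outb i)%:R else 1) * bw n i.
have e (s : S) : (outb (s a))%:R * WS s = \prod_b F b (s b).
  rewrite /F big_split /= -/(WS s); congr (_ * _).
  by rewrite (bigD1 a) //= eqxx big1 ?mulr1 // => b /negbTE ->.
rewrite (eq_bigr _ (fun s _ => e s)) distrW (bigD1 a) //= [X in _ * X]big1 ?mulr1.
  rewrite /F eqxx; apply: le_trans out_tail; rewrite EbE.
  by rewrite le_eqVlt; apply/orP; left; apply/eqP; apply: eq_bigr => i _; rewrite mulrC.
move=> b /negbTE nb; rewrite /F nb -[RHS](Eb1 n) EbE; apply: eq_bigr => i _; exact: mulrC.
Qed.

Lemma dv_le i : (i <= n)%N -> `|dv i| <= n%:R.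
Proof.
move=> hi; have h : i%:R <= n%:R :> R by rewrite ler_nat.
have h0 : 0 <= i%:R :> R by exact: ler0n.
by have p0' := p0; have p1' := p1; rewrite /dv ler_norml; apply/andP; split; nra.
Qed.

Lemma n_ge1 : 1 <= n%:R :> R.
Proof.
rewrite ler1n lt0n; apply/eqP => e; move: nz2; rewrite e mul0r => /eqP.
by rewrite eq_sym oner_eq0.
Qed.

Lemma Yv_le i : (i <= n)%N -> `|Yv i| <= n%:R ^+ 2.
Proof.
move=> /dv_le h; have n1 := n_ge1; have p0' := p0; have p1' := p1.
have h2 : dv i ^+ 2 <= n%:R ^+ 2.
  by rewrite -(real_normK (num_real (dv i))) lerXn2r // ?nnegrE.
have h3 : 0 <= dv i ^+ 2 by exact: sqr_ge0.
have h4 : 0 <= n%:R * (p * q) <= n%:R ^+ 2.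
  have : 0 <= p * q <= 1 by apply/andP; split; nra.
  by move=> /andP[? ?]; apply/andP; split; rewrite ?expr2; nra.
move: h4 => /andP[? ?]; rewrite /Yv ler_norml; lra.
Qed.

Lemma n2z k : n%:R ^+ 2 * z ^+ (k + 4) = z ^+ k.
Proof.
rewrite exprD (_ : _ * _ = (n%:R * z ^+ 2) ^+ 2 * z ^+ k); first by rewrite nz2 expr1n mul1r.
by ring.
Qed.

(** Chosen to keep [th0 * Yv i] below z/2 in the box, where [Yv] is at most [(nu / z) ^+ 2], while
    making the exponent exactly [nu] at the threshold of [var_tail]. *)
Definition th0 : R := z ^+ 3 / (2 * nu ^+ 2).

Lemma th0_bounds : 0 <= th0 <= 1 /\ th0 * nu ^+ 2 = z ^+ 3 / 2.
Proof.
have nup : 0 < nu by have := nu2; lra.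
have h : 0 < nu ^+ 2 by rewrite exprn_gt0.
have nu0 : nu != 0 by rewrite gt_eqF //; have := nu2; lra.
split; last by rewrite /th0; field.
have z3 : 0 <= z ^+ 3 <= 1.
  have z1' : z <= 1 by have := z1; lra.
  by apply/andP; split; [apply/exprn_ge0/ltW | apply: exprn_ile1 => //; exact: ltW].
have n4 : 4 <= nu ^+ 2 by have := nu2; rewrite expr2; nra.
move: z3 => /andP[? ?].
rewrite /th0; apply/andP; split; first by apply: divr_ge0 => //; nra.
by rewrite ler_pdivrMr ?mulr_gt0 //; nra.
Qed.

Lemma box_factor th : `|th| = th0 ->
  \sum_(i < n.+1) (~~ outb i)%:R * bw n i * expR (th * Yv i) <= 1 + 2 * z ^+ 2.
Proof.
move=> ht; have [/andP[t0 t1] tn] := th0_bounds.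
have n1 := n_ge1.
have inY i : ~~ outb i -> `|Yv i| <= (nu / z) ^+ 2.
  rewrite /outb -leNgt => h; have h3 : 0 <= dv i ^+ 2 by exact: sqr_ge0.
  have h2 : dv i ^+ 2 <= (nu / z) ^+ 2.
    rewrite -(real_normK (num_real (dv i))) lerXn2r // ?nnegrE //.
    have nu0 : 0 <= nu by have := nu2; lra.
    by rewrite divr_ge0 // ltW.
  have h4 : 0 <= n%:R * (p * q) <= n%:R * nu ^+ 2.
    have p0' := p0; have p1' := p1.
    have : 0 <= p * q <= 1 by apply/andP; split; nra.
    have : 1 <= nu ^+ 2 by have := nu2; rewrite expr2; nra.
    by move=> ? /andP[? ?]; apply/andP; split; nra.
  have e : (nu / z) ^+ 2 = n%:R * nu ^+ 2.
    have zz : z ^+ 2 != 0 by rewrite expf_neq0 ?gt_eqF.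
    by apply: (mulIf zz); rewrite (mulrAC n%:R) nz2 mul1r expr_div_n mulfVK.
  move: h4 h2; rewrite e => /andP[? ?] ?; rewrite /Yv ler_norml; lra.
have z2n : z ^+ 3 / 2 * n%:R = z / 2.
  by rewrite [RHS](_ : _ = n%:R * z ^+ 2 * (z / 2)); [ring | by rewrite nz2 mul1r].
have thY i : ~~ outb i -> `|th * Yv i| <= z / 2.
  move=> /inY h; rewrite normrM ht; apply: le_trans (ler_wpM2l t0 h) _.
  have -> : th0 * (nu / z) ^+ 2 = z / 2.
    by rewrite expr_div_n mulrA tn (_ : z ^+ 3 = z * z ^+ 2) ?exprS //; field; rewrite gt_eqF.
  by [].
(* In the box, [exp x <= 1 + x + 2x^2] applies. Outside, the left side is 0 and the term with
   [n%:R ^+ 2] keeps the right side nonnegative; summing over all [i] then allows the use of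
   [Eb n Yv = 0]. *)
have pt (i : 'I_n.+1) : (~~ outb i)%:R * bw n i * expR (th * Yv i) <=
    bw n i * (1 + (th * Yv i + (z ^+ 2 / 2 + (outb i)%:R * (n%:R ^+ 2)))).
  have b0 := bw_ge0 n i; rewrite [_ * bw n i]mulrC -mulrA; apply: ler_wpM2l => //.
  case ho: (outb i); rewrite /= ?mul0r ?mul1r.
    have hin : (i <= n)%N by rewrite -ltnS.
    have hY := Yv_le hin.
    have : `|th * Yv i| <= n%:R ^+ 2.
      by rewrite normrM ht -[leRHS]mul1r; apply: ler_pM.
    have : 0 <= z ^+ 2 by exact: sqr_ge0.
    by rewrite ler_norml => ? /andP[? ?]; lra.
  have hY := thY i (negbT ho).
  have /andP[hy1 hy2] : - (z / 2) <= th * Yv i <= z / 2 by rewrite -ler_norml.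
  have z1' := z1; have z0' := z0.
  have h12 : th * Yv i <= 1 / 2 by lra.
  have /andP[_ h] := expR_quad h12.
  have : (th * Yv i) ^+ 2 <= (z / 2) ^+ 2.
    by rewrite -(real_normK (num_real (th * _))) lerXn2r // ?nnegrE // divr_ge0 // ltW.
  by rewrite expr_div_n; lra.
apply: (@le_trans _ _ (Eb n (fun i => 1 + (th * Yv i + (z ^+ 2 / 2 + (outb i)%:R * n%:R ^+ 2))))).
  by rewrite EbE; apply: ler_sum => i _; exact: pt.
have eY : Eb n Yv = 0.
  rewrite /Yv (@Eb_ext n _ (fun i => dv i ^+ 2 + (- (n%:R * (p * q))) * 1)); last by move=> i; ring.
  by rewrite EbD EbZ Eb1 Eb_var; ring.
rewrite EbD Eb1 EbD EbZ eY mulr0 add0r EbD.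
rewrite (@Eb_ext n (fun=> z ^+ 2 / 2) (fun=> (z ^+ 2 / 2) * 1)); last by move=> i; rewrite mulr1.
rewrite EbZ Eb1 mulr1 (@Eb_ext n _ (fun i => n%:R ^+ 2 * (outb i)%:R)); last by move=> i; rewrite mulrC.
rewrite EbZ.
have h : n%:R ^+ 2 * Eb n (fun i => (outb i)%:R) <= 32 * z ^+ 16.
  apply: le_trans (ler_wpM2l (sqr_ge0 _) out_tail) _.
  by rewrite mulrCA (n2z 16).
have h16 : 32 * z ^+ 16 <= z ^+ 2.
  rewrite (_ : 16 = 14 + 2)%N // exprD mulrA ler_piMl ?sqr_ge0 //.
  have z0' := z0; have z1' := z1.
  have : z ^+ 14 <= (1 / 2) ^+ 14 by apply: lerXn2r; rewrite ?nnegrE ?divr_ge0 // ltW.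
  have : (1 / 2) ^+ 14 <= (1 / 2) ^+ 5 :> R by rewrite ler_wiXn2l //; lra.
  have -> : (1 / 2) ^+ 5 = 32^-1 :> R by field.
  lra.
have := sqr_ge0 z; lra.
Qed.

Lemma th0_neq0 : th0 != 0.
Proof.
have nu0 : nu != 0 by rewrite gt_eqF //; have := nu2; lra.
apply: mulf_neq0; first by rewrite expf_neq0 ?gt_eqF.
by apply: invr_neq0; apply: mulf_neq0; rewrite ?pnatr_eq0 // expf_neq0.
Qed.

(** Restricted to the box, the exponential moment of the sum of [Yv] factors over the coordinates
    into n factors of at most [1 + 2 * z ^+ 2], with product at most e^2. Without the restriction
    [Yv] would be too large for [th0]. *)
Lemma var_tail : \sum_(s | inbox s && (2 * nu ^+ 3 / z ^+ 3 < `|\sum_a dv (s a) ^+ 2 - n%:R ^+ 2 * (p * q)|)) WS s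
  <= 512 * z ^+ 20.
Proof.
have [/andP[t0 t1] tn] := th0_bounds.
pose X (s : S) : R := \sum_a Yv (s a).
have XE (s : S) : \sum_a dv (s a) ^+ 2 - n%:R ^+ 2 * (p * q) = X s.
  rewrite /X /Yv sumrB sum_cst; ring.
pose F th (s : S) := \prod_a ((~~ outb (s a))%:R * bw n (s a) * expR (th * Yv (s a))).
have F0 th (s : S) : 0 <= F th s.
  apply: prodr_ge0 => a _; apply: mulr_ge0; last exact: expR_ge0.
  by apply: mulr_ge0; [exact: ler0n | exact: bw_ge0].
have FE th (s : S) : inbox s -> F th s = WS s * expR (th * X s).
  move=> /forallP h; rewrite /F /WS big_split /= -expR_sum -mulr_sumr; congr (_ * expR _).
    by apply: eq_bigr => a _; rewrite h mul1r.
have Fs th : `|th| = th0 -> \sum_s F th s <= 16.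
  move=> ht; rewrite /F (distrW (fun _ i => (~~ outb i)%:R * bw n i * expR (th * Yv i))).
  have hb := box_factor ht.
  apply: (@le_trans _ _ (\prod_(a < n) (1 + 2 * z ^+ 2))).
    apply: ler_prod => a _; rewrite hb andbT; apply: sumr_ge0 => i _.
    by apply: mulr_ge0; [apply: mulr_ge0; [exact: ler0n | exact: bw_ge0] | exact: expR_ge0].
  rewrite prodr_const card_ord; apply: le_trans expR2_le.
  have z2 : 0 <= 2 * z ^+ 2 by rewrite mulr_ge0 ?sqr_ge0.
  apply: le_trans (pow_exp n z2) _.
  by rewrite mulrCA nz2 mulr1.
have n3 : 0 < nu ^+ 2 by rewrite exprn_gt0 //; have := nu2; lra.
pose L := 2 * nu ^+ 3 / z ^+ 3.
have thL : th0 * L = nu.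
  have nu0 : nu != 0 by rewrite gt_eqF //; have := nu2; lra.
  by rewrite /th0 /L; field; rewrite nu0 gt_eqF.
have e0 := expR_ge0 (- nu).
apply: (@le_trans _ _ (\sum_s (expR (- nu) * F th0 s + expR (- nu) * F (- th0) s))).
  rewrite big_mkcond; apply: ler_sum => s _.
  have f1 := F0 th0 s; have f2 := F0 (- th0) s; have w0 := WS_ge0 s.
  case: ifP => [/andP[hs hX]|_]; last by rewrite addr_ge0 ?mulr_ge0.
  rewrite !FE // -!mulrDr mulrCA -[leLHS]mulr1; apply: ler_wpM2l => //.
  rewrite mulrDr -!expRD.
  have e1 := expR_ge0 (- nu + th0 * X s); have e2 := expR_ge0 (- nu + - th0 * X s).
  have hX2 : nu < th0 * `|X s|.
    by rewrite -thL -XE ltr_pM2l // lt_neqAle t0 andbT eq_sym th0_neq0.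
  have [h|h] := lerP 0 (X s).
    by move: hX2; rewrite ger0_norm // => h2; have := expR_ge1Dx (- nu + th0 * X s); lra.
  by move: hX2; rewrite ltr0_norm // => h2; have := expR_ge1Dx (- nu + - th0 * X s); lra.
rewrite big_split /= -!mulr_sumr -mulrDr.
have h1 := Fs _ (ger0_norm t0); have h2 := Fs (- th0) ltac:(by rewrite normrN ger0_norm).
apply: (@le_trans _ _ (expR (- nu) * 512)); first by apply: ler_wpM2l => //; lra.
by rewrite mulrC ler_pM2l.
Qed.
End Tails.
End Binomial.

End BinomialTails.
Import BinomialTails.

(** * Determination of the constant by summation over typical degree vectors *)

Module Normalization.

Lemma card_outdeg n (s : 'I_n -> nat) :
  #|[set G : digraph n | [forall a, outdeg G a == s a]]| = (\prod_a 'C(n, s a))%N.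
Proof.
pose F (a : 'I_n) : {set {set 'I_n}} := [set A : {set 'I_n} | #|A| == s a].
pose f (g : {ffun 'I_n -> {set 'I_n}}) : digraph n := [set c | c.2 \in g c.1].
have fK a g : [set k | (a, k) \in f g] = g a.
  by apply/setP => k; rewrite !inE.
have finj : injective f.
  by move=> g1 g2 e; apply/ffunP => a; rewrite -!fK e.
transitivity #|(family F : simpl_pred _)|.
  rewrite -(card_imset _ finj); apply: eq_card => G; rewrite inE; apply/forallP/imsetP.
    move=> h; exists [ffun a => [set k | (a, k) \in G]].
      by apply/familyP => a; rewrite ffunE inE; exact: h.
    by apply/setP => -[a k]; rewrite !inE ffunE inE.
  by move=> [g /familyP hg ->] a; rewrite /outdeg fK; have := hg a; rewrite inE.
rewrite card_family foldrE big_map big_enum; apply: eq_bigr => a _.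
by rewrite -[n in RHS]card_ord -card_draws; apply: eq_card => A; rewrite inE.
Qed.

Lemma card_sum_outdeg n (G : digraph n) : #|G| = (\sum_a outdeg G a)%N.
Proof.
rewrite -sum1_card (eq_bigr (fun a => (\sum_(k | (a, k) \in G) 1)%N)); last first.
  by move=> a _; rewrite /outdeg sum1dep_card.
by rewrite pair_big_dep; apply: eq_bigl => -[a k].
Qed.

Definition swap n (G : digraph n) : digraph n := [set c | (c.2, c.1) \in G].

Lemma swapK n : involutive (@swap n).
Proof. by move=> G; apply/setP => -[x y]; rewrite !inE. Qed.

Lemma outdeg_swap n (G : digraph n) a : outdeg (swap G) a = indeg G a.
Proof. by apply: eq_card => k; rewrite !inE. Qed.

Lemma card_swap n (G : digraph n) : #|swap G| = #|G|.
Proof.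
have h : injective (fun c : 'I_n * 'I_n => (c.2, c.1)) by move=> [? ?] [? ?] [-> ->].
rewrite -(card_imset G h); apply: eq_card => -[x y]; rewrite inE; apply/idP/imsetP.
  by move=> h1; exists (y, x).
by move=> [[x' y'] h1 [-> ->]].
Qed.

Lemma card_digraph n m : #|[set G : digraph n | #|G| == m]| = 'C(n ^ 2, m).
Proof.
have -> : (n ^ 2)%N = #|{: 'I_n * 'I_n}| by rewrite card_prod card_ord mulnn.
by rewrite -card_draws -cardsE; apply: eq_card => G; rewrite !inE.
Qed.

Lemma rdE (R : realFieldType) n (G : digraph n) a : rd R G a = (outdeg G a)%:R.
Proof.
rewrite /rd /outdeg -sum1dep_card natr_sum [RHS]big_mkcond; apply: eq_bigr => k _.
by rewrite /indc; case: ifP.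
Qed.

Lemma cdE (R : realFieldType) n (G : digraph n) a : cd R G a = (indeg G a)%:R.
Proof. by rewrite -outdeg_swap -rdE; apply: eq_bigr => k _; rewrite /indc inE. Qed.

Section Norm.
Variables (R : realType) (n : nat) (nu z p : R).
Hypothesis cx : ctx n nu z p.
Variable m : nat.
Hypothesis hm : m%:R = p * n%:R ^+ 2.
Hypothesis hexp : expR (- nu) <= z ^+ 20.
Local Notation S := {ffun 'I_n -> 'I_n.+1}.
Local Notation bx := (@bx R n nu z p).
Local Notation NN := (@NN R n).
Local Notation GG := (@GG R n z p).
Local Notation dv := (dv p n).
Local Notation q := (1 - p).

(** Besides membership in the box, the sum of squares is required to be near its mean. Then [rr] is
    near 1 and the exponential in [GG] is near 1, so that on typical pairs [GG] is practically a
    product of a function of [s] and one of [t]. *)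
Definition typ (s : S) : bool := inbox p nu z s &&
  (`|\sum_a dv (s a) ^+ 2 - n%:R ^+ 2 * (p * q)| <= 2 * nu ^+ 3 / z ^+ 3).
Definition sq (s : S) : 'I_n -> nat := fun a => s a.

Lemma typ_bx s : typ s -> bx (sq s).
Proof. by move=> /andP[/forallP h _] a; have := h a; rewrite /outb -leNgt. Qed.

Lemma z0 : 0 < z. Proof. exact: scale_z0 (cs cx). Qed.
Lemma nu2 : 2 <= nu. Proof. exact: scale_nu (cs cx). Qed.
Lemma n_z2 : n%:R * z ^+ 2 = 1. Proof. exact: scale_n (cs cx). Qed.
Lemma nuz_small : nu ^+ bigE * z <= 1. Proof. exact: csm cx. Qed.
Lemma z_quarter : z <= 1 / 4.
Proof.
have h1 := nuz_small; have h2 := nu2; have h3 := z0; have n1 : 1 <= nu by lra.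
have h4 : 4 <= nu ^+ bigE.
  apply: (@le_trans _ _ (nu ^+ 2)); first by rewrite expr2; nra.
  by apply: ler_weXn2l => //; rewrite /bigE.
move: (nu ^+ bigE) h1 h4 => x h1 h4; nra.
Qed.

Lemma z_half : z <= 1 / 2. Proof. have := z_quarter; have := z0; lra. Qed.

Lemma typ_tail : \sum_(s | ~~ typ s) WS p s <= n%:R * (32 * z ^+ 20) + 512 * z ^+ 20.
Proof.
rewrite (bigID (fun s => inbox p nu z s)) /= addrC; apply: lerD.
  apply: le_trans (box_tail (cp0 cx) (cp1 cx) z0 z_half n_z2 hexp).
  rewrite [leRHS]big_mkcond [leLHS]big_mkcond /=; apply: ler_sum => s _.
  have w0 := WS_ge0 (cp0 cx) (cp1 cx) s.
  by rewrite /typ; case: (inbox _ _ _ _); case: (~~ _).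
apply: le_trans (var_tail (cp0 cx) (cp1 cx) z0 z_half n_z2 nu2 hexp).
rewrite [leRHS]big_mkcond [leLHS]big_mkcond /=; apply: ler_sum => s _.
by rewrite /typ ltNge; case: (inbox _ _ _ _); case: (`|_| <= _).
Qed.

Definition rowf (G : digraph n) : S := [ffun a => inord (outdeg G a)].

Lemma rowfE G a : rowf G a = outdeg G a :> nat.
Proof.
by rewrite ffunE inordK // ltnS (leq_trans (max_card _)) // card_ord.
Qed.

Lemma rowf_eq G (s : S) : (rowf G == s) = [forall a, outdeg G a == s a].
Proof.
apply/eqP/forallP => [<- a|h]; first by rewrite rowfE.
by apply/ffunP => a; apply: val_inj; rewrite /= rowfE (eqP (h a)).
Qed.

Local Notation tot := ('C(n ^ 2, m)%:R : R).

Lemma WS_bprod (s : S) : (\sum_a s a)%N = m ->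
  WS p s = bprod R (sq s) * (p ^+ m * q ^+ (n ^ 2 - m)).
Proof.
move=> hs; rewrite /WS /bw big_split big_split /= /bprod -mulrA; congr (_ * (_ * _)).
  by rewrite -hs expr_sum.
rewrite -hs -expr_sum; congr (_ ^+ _); rewrite sumnB ?sum_nat_const ?card_ord ?mulnn //.
by move=> a _; rewrite -ltnS.
Qed.

Lemma card_rowf (s : S) : #|[set G : digraph n | (#|G| == m) && (rowf G == s)]|%:R =
  (if (\sum_a s a)%N == m then bprod R (sq s) else 0).
Proof.
case: eqP => hs.
  rewrite /bprod -natr_prod -card_outdeg; congr _%:R; apply: eq_card => G.
  rewrite !inE rowf_eq andbC; case: forallP => //= h.
  by rewrite card_sum_outdeg -hs; apply/eqP/eq_bigr => a _; rewrite (eqP (h a)).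
rewrite eq_card0 // => G; rewrite !inE rowf_eq; apply/negP => /andP[/eqP h1 /forallP h2].
apply: hs; rewrite -h1 card_sum_outdeg; apply/eq_bigr => a _; by rewrite (eqP (h2 a)).
Qed.

Lemma row_part (P : pred S) : #|[set G : digraph n | (#|G| == m) && P (rowf G)]|%:R =
  \sum_(s | P s && ((\sum_a s a)%N == m)) bprod R (sq s).
Proof.
rewrite big_mkcondr /= -sum1dep_card.
rewrite (partition_big rowf P) /=; last by move=> G /andP[].
rewrite natr_sum; apply: eq_bigr => s Ps; rewrite -card_rowf sum1dep_card; congr _%:R.
apply: eq_card => G; rewrite !inE; case: (rowf G =P s) => [->|]; rewrite ?andbF ?andbT //.
by rewrite Ps andbT.
Qed.

Lemma pq_pos : 0 < p ^+ m * q ^+ (n ^ 2 - m).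
Proof.
have p0 := cp0 cx; have p1 := cp1 cx.
by rewrite mulr_gt0 ?exprn_gt0 //; lra.
Qed.

Lemma m_le : (m <= n ^ 2)%N.
Proof.
rewrite -(ler_nat R) hm natrX; have p1 := cp1 cx.
by apply: ler_piMl; [exact: exprn_ge0 | exact: ltW].
Qed.

Lemma tot_gt0 : 0 < tot.
Proof. by rewrite ltr0n binomial.bin_gt0 m_le. Qed.

Lemma tail_num : (n%:R ^+ 2 + 1) * (n%:R * (32 * z ^+ 20) + 512 * z ^+ 20) <= z.
Proof.
have zz := z_half; have z0' := z0; have nz := n_z2.
have n1 : 1 <= n%:R :> R by exact: n_ge1 nz.
apply: (@le_trans _ _ ((2 * n%:R ^+ 2) * (544 * n%:R * z ^+ 20))).
  have h20 : 0 <= z ^+ 20 by apply: exprn_ge0; exact: ltW.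
  apply: ler_pM.
  - by apply: addr_ge0 => //; exact: exprn_ge0.
  - by apply: addr_ge0; apply: mulr_ge0 => //; apply: mulr_ge0.
  - have : 1 <= n%:R ^+ 2 :> R by exact: exprn_ege1.
    by lra.
  have : z ^+ 20 <= n%:R * z ^+ 20 by apply: ler_peMl.
  move: (z ^+ 20) => x; rewrite -mulrA; lra.
have -> : 2 * n%:R ^+ 2 * (544 * n%:R * z ^+ 20) = 1088 * (n%:R * z ^+ 2) ^+ 3 * z ^+ 13 * z by ring.
rewrite nz expr1n mulr1 -[leRHS]mul1r ler_pM2r //.
have : z ^+ 13 <= (1 / 2) ^+ 13 by apply: lerXn2r; rewrite ?nnegrE ?divr_ge0 // ltW.
have -> : (1 / 2) ^+ 13 = 8192^-1 :> R by field.
lra.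
Qed.

(** Conditioning independent cells on exactly m ones costs at most the factor [n ^ 2 + 1], by
    [bw_mode]; the tails of order [z ^+ 20] absorb it. *)
Lemma bad_rows : #|[set G : digraph n | (#|G| == m) && ~~ typ (rowf G)]|%:R <= z * tot.
Proof.
have w0 s := WS_ge0 (cp0 cx) (cp1 cx) s.
rewrite (row_part (fun s => ~~ typ s)) -(ler_pM2r pq_pos) mulr_suml.
have tw : tot * (p ^+ m * q ^+ (n ^ 2 - m)) = bw p (n ^ 2) m by rewrite /bw mulrA.
rewrite -[leRHS]mulrA tw.
apply: (@le_trans _ _ (\sum_(s | ~~ typ s) WS p s)).
  rewrite big_mkcondr; apply: ler_sum => s _; case: eqP => // hs.
  by rewrite WS_bprod.
apply: le_trans typ_tail _.
have hN : m%:R = p * (n ^ 2)%:R :> R by rewrite natrX.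
have hmode := bw_mode (cp0 cx) (cp1 cx) hN m_le.
have b0 := bw_ge0 (cp0 cx) (cp1 cx) (n ^ 2) m.
rewrite natrX in hmode.
have t0 : 0 <= n%:R * (32 * z ^+ 20) + 512 * z ^+ 20.
  have h20 : 0 <= z ^+ 20 by apply: exprn_ge0; exact: ltW z0.
  by apply: addr_ge0; apply: mulr_ge0 => //; apply: mulr_ge0.
apply: le_trans (ler_peMr t0 hmode) _.
move: (bw _ _ _) b0 => x b0; rewrite [leLHS]mulrA; apply: ler_wpM2r => //.
by rewrite mulrC; exact: tail_num.
Qed.

Lemma bad_cols : #|[set G : digraph n | (#|G| == m) && ~~ typ (rowf (swap G))]|%:R <= z * tot.
Proof.
apply: le_trans bad_rows; rewrite ler_nat -(card_imset _ (inv_inj (@swapK n))).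
apply: subset_leq_card; apply/subsetP => G /imsetP[G' h ->].
by move: h; rewrite !inE card_swap.
Qed.

Definition good := [set G : digraph n | [&& #|G| == m, typ (rowf G) & typ (rowf (swap G))]].
Definition bsum := \sum_(s : S | typ s && ((\sum_a s a)%N == m)) bprod R (sq s).

Lemma card_m : #|[set G : digraph n | #|G| == m]|%:R = tot.
Proof. by rewrite card_digraph. Qed.

Lemma good_le : #|good|%:R <= tot.
Proof.
rewrite -card_m ler_nat; apply: subset_leq_card; apply/subsetP => G.
by rewrite !inE => /and3P[].
Qed.

Lemma good_ge : (1 - 2 * z) * tot <= #|good|%:R.
Proof.
have b1 := bad_rows; have b2 := bad_cols; move: b1 b2.
set B1 := [set G | _ && ~~ typ (rowf G)]; set B2 := [set G | _ && _] => b1 b2.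
have : tot <= #|good|%:R + #|B1|%:R + #|B2|%:R.
  rewrite -card_m -!natrD ler_nat.
  apply: leq_trans (leq_add (leq_card_setU good B1) (leqnn _)).
  apply: leq_trans (leq_card_setU _ _).
  apply: subset_leq_card; apply/subsetP => G; rewrite !inE => ->.
  by case: (typ _); case: (typ _).
lra.
Qed.

Lemma bsumE : bsum = #|[set G : digraph n | (#|G| == m) && typ (rowf G)]|%:R.
Proof. by rewrite row_part. Qed.

Lemma bsum_bounds : (1 - z) * tot <= bsum <= tot.
Proof.
rewrite bsumE; apply/andP; split; last first.
  rewrite -card_m ler_nat; apply: subset_leq_card; apply/subsetP => G.
  by rewrite !inE => /andP[].
have b1 := bad_rows; move: b1; set B1 := [set G | _ && _] => b1.
set B := [set G | _ && _].
have : tot <= #|B|%:R + #|B1|%:R.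
  rewrite -card_m -natrD ler_nat; apply: leq_trans (leq_card_setU _ _).
  apply: subset_leq_card; apply/subsetP => G; rewrite !inE => ->.
  by case: (typ _).
lra.
Qed.

Local Notation tot_m s := ((\sum_a s a)%N == m).

Lemma goodE : #|good|%:R =
  \sum_(s : S | typ s && tot_m s) \sum_(t : S | typ t && tot_m t) NN (sq s) (sq t).
Proof.
have rm (G : digraph n) : #|G| == m -> tot_m (rowf G).
  by move=> /eqP <-; rewrite card_sum_outdeg; apply/eqP/eq_bigr => a _; rewrite rowfE.
rewrite -sum1dep_card (partition_big rowf (fun s => typ s && tot_m s)) /=; last first.
  by move=> G /and3P[h1 h2 h3]; rewrite h2 rm.
rewrite natr_sum; apply: eq_bigr => s /andP[ts ms].
rewrite (partition_big (fun G => rowf (swap G)) (fun s => typ s && tot_m s)) /=; last first.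
  by move=> G /andP[/and3P[h1 h2 h3] _]; rewrite h3 rm // card_swap.
rewrite natr_sum; apply: eq_bigr => t /andP[tt mt].
rewrite sum1dep_card; congr _%:R; apply: eq_card => G; rewrite !inE.
apply/idP/and3P.
  move=> /andP[/andP[/and3P[h1 h2 h3] /eqP h4] /eqP h5]; split.
  - by apply/forallP => a; rewrite rdE -rowfE h4.
  - by apply/forallP => a; rewrite cdE -outdeg_swap -rowfE h5.
  - by rewrite /= disjoint_sym disjoints_subset sub0set.
move=> [/forallP h1 /forallP h2 _].
have e1 : rowf G = s.
  by apply/eqP; rewrite rowf_eq; apply/forallP => a; have := h1 a; rewrite rdE eqr_nat.
have e2 : rowf (swap G) = t.
  apply/eqP; rewrite rowf_eq; apply/forallP => a.
  by have := h2 a; rewrite cdE eqr_nat outdeg_swap.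
rewrite e1 e2 ts tt !eqxx !andbT card_sum_outdeg -(eqP ms).
by apply/eqP/eq_bigr => a _; rewrite -e1 rowfE.
Qed.

Lemma rr_typ s : typ s -> `|1 - rr z p (sq s)| <= nu ^+ 5 * z.
Proof.
move=> /andP[_ h]; have z0' := z0; have nu2' := nu2; have nz := n_z2.
have zn0 : z != 0 by rewrite gt_eqF.
have [p_neq0 q_neq0 _] := pq_neq0 cx.
have -> : 1 - rr z p (sq s) =
    - (p * q)^-1 * z ^+ 4 * (\sum_a dv (s a) ^+ 2 - n%:R ^+ 2 * (p * q)).
  rewrite /RowStep.rr (_ : \sum_j _ = \sum_a dv (s a) ^+ 2); last by apply: eq_bigr.
  have e : 1 = (p * q)^-1 * z ^+ 4 * (n%:R ^+ 2 * (p * q)).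
    have -> : (p * q)^-1 * z ^+ 4 * (n%:R ^+ 2 * (p * q)) = (n%:R * z ^+ 2) ^+ 2 * ((p * q)^-1 * (p * q)) by ring.
    by rewrite nz expr1n mul1r mulVf ?mulf_neq0.
  rewrite {1}e; ring.
have wn : 0 <= (p * q)^-1 <= nu.
  have c := cw cx; have pq0 : 0 < p * q.
    by apply: mulr_gt0; [exact: cp0 cx | rewrite subr_gt0; exact: cp1 cx].
  by rewrite invr_ge0 (ltW pq0) /= -[leLHS]mul1r ler_pdivrMr.
move: wn => /andP[w1 w2].
have -> : `|- (p * q)^-1 * z ^+ 4 * (\sum_a dv (s a) ^+ 2 - n%:R ^+ 2 * (p * q))| =
    (p * q)^-1 * z ^+ 4 * `|\sum_a dv (s a) ^+ 2 - n%:R ^+ 2 * (p * q)|.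
  rewrite normrM; congr (_ * _); rewrite mulNr normrN ger0_norm //.
  by apply: mulr_ge0 => //; apply: exprn_ge0; exact: ltW.
apply: (@le_trans _ _ (nu * z ^+ 4 * (2 * nu ^+ 3 / z ^+ 3))).
  apply: ler_pM => //; first by apply: mulr_ge0 => //; apply: exprn_ge0; exact: ltW.
  by apply: ler_wpM2r => //; apply: exprn_ge0; exact: ltW.
have -> : nu * z ^+ 4 * (2 * nu ^+ 3 / z ^+ 3) = 2 * (nu ^+ 4 * z) by field.
have -> : nu ^+ 5 * z = nu * (nu ^+ 4 * z) by ring.
by apply: ler_wpM2r => //; apply: mulr_ge0; [apply: exprn_ge0; lra | exact: ltW].
Qed.

Definition etaN : R := nu ^+ 10 * z.

Lemma GG_typ s t : typ s -> typ t ->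
  expR (- etaN) * (bprod R (sq s) * bprod R (sq t)) <= GG (sq s) (sq t) <=
  expR etaN * (bprod R (sq s) * bprod R (sq t)).
Proof.
move=> hs ht; have r1 := rr_typ hs; have r2 := rr_typ ht.
have z0' := z0; have z1 := z_half.
have b (u : S) : 0 < bprod R (sq u) by apply: bprod_gt0 => a; exact: (ltn_ord (u a)).
have h : `|- (1 / 2) * (1 - rr z p (sq s)) * (1 - rr z p (sq t))| <= etaN.
  rewrite !normrM; have : `|- (1 / 2) : R| <= 1 by rewrite normrN ger0_norm; lra.
  move=> h12; apply: (@le_trans _ _ (1 * (nu ^+ 5 * z) * (nu ^+ 5 * z))).
    by apply: ler_pM => //; [exact: mulr_ge0 | exact: ler_pM].
  have -> : 1 * (nu ^+ 5 * z) * (nu ^+ 5 * z) = etaN * z by rewrite /etaN; ring.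
  apply: ler_piMr; last by lra.
  by rewrite /etaN; apply: mulr_ge0; [apply: exprn_ge0; have := nu2; lra | exact: ltW].
move: h; rewrite ler_norml => /andP[h1 h2].
rewrite /RowStep.GG mulrC ![expR _ * (_ * _)]mulrC.
by apply/andP; split; apply: ler_wpM2l; rewrite ?ler_expR // ltW ?mulr_gt0.
Qed.

Definition kapN : R := nu ^+ 2800 * z.

Lemma kapN_ge : 4 * z + 2 * epsN nu z + etaN <= kapN.
Proof.
have n2 := nu2; have z0' := z0; have n1 : 1 <= nu by lra.
rewrite /BoxConstancy.epsN /etaN /kapN mulrA -!mulrDl; apply: ler_wpM2r; first exact: ltW.
have -> : nu ^+ 2800 = nu ^+ 50 * nu ^+ 2750 by rewrite -exprD.
have h1 : nu ^+ 10 <= nu ^+ 2750 by apply: ler_weXn2l.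
have h2 : 16 <= nu ^+ 50.
  apply: (@le_trans _ _ (2 ^+ 4)); first by rewrite -natrX ler_nat.
  by apply: (@le_trans _ _ (nu ^+ 4)); [apply: lerXn2r; rewrite ?nnegrE //; lra | apply: ler_weXn2l].
have h3 : 1 <= nu ^+ 10 by exact: exprn_ege1.
move: (nu ^+ 10) (nu ^+ 2750) (nu ^+ 50) h1 h2 h3 => x y t h1 h2 h3.
have : 16 * y <= t * y by apply: ler_wpM2r => //; lra.
lra.
Qed.

(** Over typical pairs [NN] adds up to nearly [tot], and [GG] to nearly [bsum * bsum], that is,
    nearly [tot * tot]. As [NN / GG] is nearly constant, the constant must be [1 / tot]. *)
Lemma NN_norm (s t : 'I_n -> nat) : (\sum_j s j = m)%N -> (\sum_j t j = m)%N ->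
  bx s -> bx t ->
  expR (- kapN) * GG s t <= NN s t * tot <= expR kapN * GG s t.
Proof.
move=> ms mt bs bt.
have z0' := z0; have z1 := z_half; have T0 := tot_gt0.
have G0 := GG_gt0 cx bs bt.
have N0 : 0 <= NN s t by rewrite /RowStep.NN /Nb ler0n.
have hg := goodE; have gl := good_le; have gg := good_ge.
have /andP[B1 B2] := bsum_bounds.
pose SG := \sum_(s' : S | typ s' && tot_m s') \sum_(t' : S | typ t' && tot_m t') GG (sq s') (sq t').
have BB : bsum * bsum = \sum_(s' : S | typ s' && tot_m s') \sum_(t' : S | typ t' && tot_m t')
    (bprod R (sq s') * bprod R (sq t')).
  by rewrite /bsum mulr_suml; apply: eq_bigr => s' _; rewrite mulr_sumr.
have SG1 : expR (- etaN) * (bsum * bsum) <= SG.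
  rewrite BB mulr_sumr; apply: ler_sum => s' /andP[ts' _]; rewrite mulr_sumr.
  by apply: ler_sum => t' /andP[tt' _]; have /andP[] := GG_typ ts' tt'.
have SG2 : SG <= expR etaN * (bsum * bsum).
  rewrite BB mulr_sumr; apply: ler_sum => s' /andP[ts' _]; rewrite mulr_sumr.
  by apply: ler_sum => t' /andP[tt' _]; have /andP[] := GG_typ ts' tt'.
set E := expR (2 * epsN nu z).
have C1 : #|good|%:R * GG s t <= E * NN s t * SG.
  rewrite hg mulr_suml mulr_sumr; apply: ler_sum => s' /andP[ts' /eqP ms'].
  rewrite mulr_suml mulr_sumr; apply: ler_sum => t' /andP[tt' /eqP mt'].
  rewrite -mulrA; apply: (box_const cx hm ms ms' mt mt' bs _ bt); exact: typ_bx.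
have C2 : NN s t * SG <= E * (#|good|%:R * GG s t).
  rewrite hg mulr_sumr mulr_suml mulr_sumr; apply: ler_sum => s' /andP[ts' /eqP ms'].
  rewrite mulr_sumr mulr_suml mulr_sumr; apply: ler_sum => t' /andP[tt' /eqP mt'].
  apply: (box_const cx hm ms' ms mt' mt _ bs _ bt); exact: typ_bx.
have B0 : 0 <= bsum by apply: le_trans B1; apply: mulr_ge0; [lra | exact: ltW].
have z4 := z_quarter.
have e4 : expR (- (4 * z)) <= 1 - 2 * z.
  have := expR_ge1Dx (4 * z); rewrite expRN => h.
  have hp : 0 < 1 + 4 * z by lra.
  apply: (@le_trans _ _ (1 + 4 * z)^-1).
    by rewrite lef_pV2 ?posrE ?expR_gt0.
  by rewrite -div1r ler_pdivrMr //; nra.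
have hk := kapN_ge.
have kE : expR (- kapN) <= expR (- (4 * z)) * expR (- (2 * epsN nu z)) * expR (- etaN).
  by rewrite -!expRD ler_expR; lra.
have kE2 : E * expR etaN * expR (4 * z) <= expR kapN.
  by rewrite -!expRD ler_expR; lra.
have EV : expR (- (2 * epsN nu z)) * E = 1 by rewrite -expRD addNr expR0.
have eV : expR (- etaN) * expR etaN = 1 by rewrite -expRD addNr expR0.
have fV : expR (4 * z) * expR (- (4 * z)) = 1 by rewrite -expRD subrr expR0.
have E0 : 0 < E by exact: expR_gt0.
have e0 : 0 < expR etaN by exact: expR_gt0.
have em0 : 0 < expR (- etaN) by exact: expR_gt0.
have Em0 : 0 < expR (- (2 * epsN nu z)) by exact: expR_gt0.
have f0 : 0 < expR (4 * z) by exact: expR_gt0.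
have bb : bsum * bsum <= tot * tot by apply: ler_pM.
have bb2 : (1 - 2 * z) * (tot * tot) <= bsum * bsum.
  apply: (@le_trans _ _ (((1 - z) * tot) * ((1 - z) * tot))).
    have -> : (1 - z) * tot * ((1 - z) * tot) = (1 - 2 * z + z ^+ 2) * (tot * tot) by ring.
    by apply: ler_wpM2r; [apply: mulr_ge0; exact: ltW | have := sqr_ge0 z; lra].
  have : 0 <= (1 - z) * tot by apply: mulr_ge0; [lra | exact: ltW].
  by move=> ?; apply: ler_pM.
apply/andP; split.
  apply: le_trans (ler_wpM2r (ltW G0) kE) _.
  have h : expR (- (4 * z)) * GG s t <= E * expR etaN * (NN s t * tot).
    rewrite -(ler_pM2r T0).
    apply: (@le_trans _ _ (#|good|%:R * GG s t)).
      rewrite mulrAC; apply: ler_wpM2r; first exact: ltW.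
      by apply: le_trans gg; apply: ler_wpM2r => //; exact: ltW.
    apply: le_trans C1 _.
    apply: (@le_trans _ _ (E * NN s t * (expR etaN * (tot * tot)))).
      apply: ler_wpM2l; first by apply: mulr_ge0 => //; exact: ltW.
      by apply: le_trans SG2 _; apply: ler_wpM2l => //; exact: ltW.
    by rewrite le_eqVlt; apply/orP; left; apply/eqP; ring.
  rewrite [leLHS](_ : _ = expR (- (2 * epsN nu z)) * expR (- etaN) * (expR (- (4 * z)) * GG s t)); last by ring.
  apply: le_trans (ler_wpM2l _ h) _; first by apply: mulr_ge0; exact: ltW.
  rewrite [leLHS](_ : _ = (expR (- (2 * epsN nu z)) * E) * (expR (- etaN) * expR etaN) * (NN s t * tot)); last by ring.
  by rewrite EV eV !mul1r.
apply: le_trans (_ : _ <= E * expR etaN * expR (4 * z) * GG s t) _; last first.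
  by apply: ler_wpM2r kE2; exact: ltW.
have h : NN s t * (expR (- etaN) * (expR (- (4 * z)) * tot)) <= E * GG s t.
  rewrite -(ler_pM2r T0).
  apply: (@le_trans _ _ (NN s t * SG)).
    rewrite -mulrA; apply: ler_wpM2l => //; apply: le_trans SG1.
    rewrite -!mulrA; apply: ler_wpM2l; first exact: ltW.
    apply: le_trans bb2; apply: ler_wpM2r => //; apply: mulr_ge0; exact: ltW.
  apply: le_trans C2 _; rewrite -mulrA; apply: ler_wpM2l; first exact: ltW.
  by rewrite mulrC; apply: ler_wpM2l => //; exact: ltW.
have h2 := ler_wpM2l (mulr_ge0 (ltW e0) (ltW f0)) h.
rewrite (_ : NN s t * tot = (expR (4 * z) * expR (- (4 * z))) * (expR (- etaN) * expR etaN) * (NN s t * tot)); last first.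
  by rewrite fV eV !mul1r.
rewrite (_ : _ * (NN s t * tot) = expR etaN * expR (4 * z) * (NN s t * (expR (- etaN) * (expR (- (4 * z)) * tot)))); last by ring.
apply: le_trans h2 _.
by rewrite le_eqVlt; apply/orP; left; apply/eqP; ring.
Qed.
End Norm.

End Normalization.
Import Normalization.

(** * Forbidding the cells of H one at a time *)

Module Insertion.

Lemma sum_pick (R : pzSemiRingType) (I : finType) (a : I) (f : I -> R) :
  \sum_b (b == a)%:R * f b = f a.
Proof.
rewrite (bigD1 a) //= eqxx mul1r big1 ?addr0 // => b /negbTE ->; exact: mul0r.
Qed.

Lemma inv_expand (F : fieldType) (x y q : F) : 1 - x != 0 ->
  q - y / (1 - x) = q - y * (1 + x) - y * x ^+ 2 * (1 - x)^-1.
Proof. by move=> h; field. Qed.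

Lemma expR_1pm (R : realType) (e x : R) : e <= 1 / 2 -> - e <= x -> x <= e ->
  [/\ 0 < 1 + x, 1 + x <= expR (2 * e) & expR (- (2 * e)) <= 1 + x].
Proof.
move=> he h1 h2; split; first by lra.
  by apply: le_trans (expR_ge1Dx _); lra.
rewrite expRN; have h := expR_ge1Dx (2 * e).
apply: (@le_trans _ _ (1 + 2 * e)^-1); first by rewrite lef_pV2 ?posrE ?expR_gt0 //; lra.
by rewrite -div1r ler_pdivrMr; [nra | lra].
Qed.

Section AddH.
Variables (R : realType) (n : nat) (nu z p : R).
Hypothesis cx : ctx n nu z p.
Variable m : nat.
Hypothesis hm : m%:R = p * n%:R ^+ 2.
Local Notation cell := ('I_n * 'I_n)%type.
Local Notation ob := (ob nu z).
Local Notation reg := (@reg R n nu z p).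
Local Notation ind := (@indc R n).
Local Notation rd := (@rd R n).
Local Notation cd := (@cd R n).
Local Notation dl := (@dl R n p).
Local Notation et := (@et R n p).
Local Notation hrow := (@hrow R n p).
Local Notation hcol := (@hcol R n p).
Local Notation P2h := (@P2h R n z p).
Local Notation q := (1 - p).
Local Notation w := (p * (1 - p))^-1.
Let sc := cs cx.
Variables (s t : 'I_n -> nat).
Hypotheses (ms : (\sum_j s j = m)%N) (mt : (\sum_j t j = m)%N).
Implicit Types (H : digraph n) (c : cell).

Definition MH H := Mod (nr R s) (nr R t) H.
Definition YY H : R := \sum_b \sum_l ind H (b, l) * (dl (MH H) b * et (MH H) l).
Definition Frow H : R := \prod_j 'C(n - outdeg H j, s j)%:R.
Definition Fcol H : R := \prod_j 'C(n - indeg H j, t j)%:R.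
(** The H-dependent part of the formula, normalised for cells that need not avoid the diagonal. Once
    [H] includes the diagonal, [n - outdeg H j] becomes n - x_j - 1 and [n ^ 2 - #|H|] becomes n^2 -
    X - n. *)
Definition FF H : R := ('C(n ^ 2 - #|H|, m)%:R)^-1 * Frow H * Fcol H * expR (- (w * z ^+ 4 * YY H)).

Lemma YY_step H a k : (a, k) \notin H ->
  YY ((a, k) |: H) = YY H + (p * (hrow (MH H) a + hcol (MH H) k)
    + (dl (MH H) a + p) * (et (MH H) k + p)).
Proof.
move=> hc.
have hd b : dl (MH ((a, k) |: H)) b = dl (MH H) b + p * (b == a)%:R.
  by rewrite /FirstOrder.dl /= rd_add //=; ring.
have he l : et (MH ((a, k) |: H)) l = et (MH H) l + p * (l == k)%:R.
  by rewrite /FirstOrder.et /= cd_add //=; ring.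
pose F1 b l := p * (ind H (b, l) * et (MH H) l).
pose F2 b l := p * (ind H (b, l) * dl (MH H) b).
pose F3 b l := (dl (MH H) b + p) * (et (MH H) l + p) + p ^+ 2 * ind H (b, l).
transitivity (\sum_b \sum_l (ind H (b, l) * (dl (MH H) b * et (MH H) l)
    + ((b == a)%:R * F1 b l + ((l == k)%:R * F2 b l + (b == a)%:R * ((l == k)%:R * F3 b l))))).
  apply: eq_bigr => b _; apply: eq_bigr => l _.
  rewrite ind_add // hd he xpair_eqE /F1 /F2 /F3.
  by case: (b == a); case: (l == k); rewrite /=; ring.
have pr1 (F : 'I_n -> 'I_n -> R) : \sum_b \sum_l (b == a)%:R * F b l = \sum_l F a l.
  by rewrite -(sum_pick a (fun b => \sum_l F b l)); apply: eq_bigr => b _; rewrite mulr_sumr.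
have pr2 (F : 'I_n -> 'I_n -> R) : \sum_b \sum_l (l == k)%:R * F b l = \sum_b F b k.
  by apply: eq_bigr => b _; exact: sum_pick.
rewrite (eq_bigr (fun b => \sum_l ind H (b, l) * (dl (MH H) b * et (MH H) l) +
  (\sum_l (b == a)%:R * F1 b l + (\sum_l (l == k)%:R * F2 b l
   + \sum_l (b == a)%:R * ((l == k)%:R * F3 b l))))); last by move=> b _; rewrite !big_split.
rewrite !big_split /= -/(YY H) pr1 pr2 pr1 (sum_pick k (F3 a)) /F1 /F2 /F3 -!mulr_sumr.
have e0 : ind H (a, k) = 0 by rewrite /indc (negbTE hc).
rewrite /SecondOrder.hrow /SecondOrder.hcol /= e0; ring.
Qed.

Lemma prod_down (N : nat) (f : 'I_n -> nat) (x x' : 'I_n -> nat) a :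
  (forall j, x' j = (x j + (j == a))%N) -> (x a < N)%N -> (f a <= N - x a)%N ->
  \prod_j 'C(N - x' j, f j)%:R * (N%:R - (x a)%:R) =
  \prod_j 'C(N - x j, f j)%:R * (N%:R - (x a)%:R - (f a)%:R) :> R.
Proof.
move=> hx h1 h2; rewrite (bigD1 a) // [in RHS](bigD1 a) //= mulrAC [in RHS]mulrAC; congr (_ * _).
  rewrite hx eqxx addn1 subnS.
  have e := mul_bin_down (N - x a) (f a).
  rewrite -natrB 1?ltnW // -natrB // -!natrM; congr _%:R.
  by rewrite mulnC e mulnC.
by apply: eq_bigr => j /negbTE nj; rewrite hx nj addn0.
Qed.

Section Step.
Variables (H : digraph n) (a k : 'I_n).
Hypotheses (hc : (a, k) \notin H) (rM : reg 58 (MH H)).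
Local Notation c := (a, k).
Let X := rd H a * z ^+ 2.
Let Y := cd H k * z ^+ 2.
Let D := dl (MH H) a * z ^+ 2.
Let E := et (MH H) k * z ^+ 2.
Let g := #|H|%:R * z ^+ 4.
Let zeta := w * z ^+ 4 * (p * (hrow (MH H) a + hcol (MH H) k) + (dl (MH H) a + p) * (et (MH H) k + p)).
(** The exact factor gained by [FF] when the cell is added ([FF_step]): the contributions of the
    total binomial, the row, the column and the exponential, in variables scaled to be small. *)
Definition rho := (1 - g) / (q - g) * (q - D / (1 - X)) * (q - E / (1 - Y)) * expR (- zeta).

Lemma cardE : #|H|%:R = \sum_b rd H b.
Proof. by rewrite card_sum_outdeg natr_sum; apply: eq_bigr => b _; rewrite rdE. Qed.

Lemma Del_card : Del p (MH H) = p * #|H|%:R.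
Proof.
rewrite /SecondOrder.Del /FirstOrder.dl big_split sumrB /= sum_cst.
have -> : \sum_i p * rd H i = p * #|H|%:R by rewrite -mulr_sumr -cardE.
by rewrite /nr -natr_sum ms hm; ring.
Qed.

Lemma ob_iq : ob 0 1 q^-1.
Proof.
have p0 := cp0 cx; have p1 := cp1 cx; have := cw cx; have q0 : 0 < q by lra.
move=> hw; have n0 := nu_ge2 cx; rewrite /OrderBounds.ob expr1 expr0z mulr1 gtr0_norm ?invr_gt0 //.
rewrite -div1r ler_pdivrMr //; apply: le_trans hw _; apply: ler_wpM2l; first lra.
by apply: ler_piMl; exact: ltW.
Qed.

Lemma ob_ip : ob 0 1 p^-1.
Proof.
have p0 := cp0 cx; have p1 := cp1 cx; have := cw cx; have q0 : 0 < q by lra.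
move=> hw; have n0 := nu_ge2 cx; rewrite /OrderBounds.ob expr1 expr0z mulr1 gtr0_norm ?invr_gt0 //.
rewrite -div1r ler_pdivrMr //; apply: le_trans hw _; apply: ler_wpM2l; first lra.
by apply: ler_piMr; [exact: ltW | lra].
Qed.

Lemma q_lb : 1 <= nu * q.
Proof.
have p0 := cp0 cx; have p1 := cp1 cx; apply: le_trans (cw cx) _; have n0 := nu_ge2 cx.
apply: ler_wpM2l; first lra. by apply: ler_piMl; lra.
Qed.

Lemma inv_near1 x : ob 1 100 x -> ob 0 1 (1 - x)^-1 /\ 1 / 2 <= 1 - x.
Proof.
move=> hx; have h2 : ob 1 101 (2 * x) by obt.
have := ob_small sc bigE (csm cx) h2 isT isT; rewrite normrM ger0_norm // => h3.
have h4 := ler_norm x; have h5 : 1 / 2 <= 1 - x by lra.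
have h6 : 0 < 1 - x by lra.
split=> //; have n0 := nu_ge2 cx.
rewrite /OrderBounds.ob expr1 expr0z mulr1 gtr0_norm ?invr_gt0 //.
by rewrite -div1r ler_pdivrMr //; nra.
Qed.

Lemma obX_ : ob 1 8 X.
Proof. have h := ob_x cx (i := 58) isT rM a; rewrite /X; obt. Qed.
Lemma obY_ : ob 1 8 Y.
Proof. have h := ob_y cx (i := 58) isT rM k; rewrite /Y; obt. Qed.
Lemma obD_ : ob 1 9 D.
Proof. have h := ob_dl cx (i := 58) isT rM a; rewrite /D; obt. Qed.
Lemma obE_ : ob 1 9 E.
Proof. have h := ob_et cx (i := 58) isT rM k; rewrite /E; obt. Qed.
Lemma obg_ : ob 2 10 g.
Proof.
have h : ob (-2) 10 (\sum_b rd H b) by exact: (ob_rdsum cx (i := 58) isT rM).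
rewrite /g cardE; obt.
Qed.

Lemma q_g : ob 0 2 (q - g)^-1 /\ 1 / nu / 2 <= q - g.
Proof.
have hg := obg_; have h2 : ob 1 12 (2 * nu * g) by obt.
have := ob_small sc bigE (csm cx) h2 isT isT; have n0 := nu_ge2 cx; have hq := q_lb.
rewrite normrM ger0_norm ?mulr_ge0 //; last lra.
move=> h3; have h4 : 2 * nu * g <= 1.
  by apply: le_trans h3; apply: ler_wpM2l; [lra | exact: ler_norm].
have h5 : 1 / nu / 2 <= q - g.
  by rewrite -mulrA -invfM ler_pdivrMr ?mulr_gt0 //; lra.
split=> //; apply: (ob_inv sc (k := 0)); rewrite expr0z mulr1.
apply: le_trans (ler_norm _); apply: le_trans h5.
rewrite expr2 invfM div1r; apply: ler_wpM2l; first by rewrite invr_ge0; lra.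
by rewrite lef_pV2 ?posrE; lra.
Qed.

Lemma zeta_ob : ob 2 30 zeta.
Proof.
have hw := ob_w cx; have hp := ob_p cx; have hd := ob_dl cx (i := 58) isT rM a.
have he := ob_et cx (i := 58) isT rM k; have h1 := ob_hrow cx (i := 58) isT rM a.
have h2 := ob_hcol cx (i := 58) isT rM k.
rewrite /zeta; obt.
Qed.

Lemma ob_expR_quad x : ob 2 30 x -> ob 4 61 (expR (- x) - (1 - x)).
Proof.
move=> hx; have h2 : ob 1 31 (2 * x) by obt.
have := ob_small sc bigE (csm cx) h2 isT isT; rewrite normrM ger0_norm // => h3.
have h4 : - x <= 1 / 2 by have := ler_norm (- x); rewrite normrN; lra.
have /andP[e1 e2] := expR_quad h4.
have h5 : ob 4 61 (2 * x ^+ 2) by obt.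
apply: ob_of_le h5; rewrite ger0_norm; first by rewrite sqrrN in e2; lra.
by lra.
Qed.

(** The agreement that makes the formula correct: its one-cell factor matches the probability that
    the cell is empty through order z^2. [B], [T] and [z1] carry the terms that matter, and [r1] to
    [r5] collect those of order z^3 and beyond. *)
Lemma rho_P2h : ob 3 200 (rho - (1 - P2h (MH H) a k)).
Proof.
have [p_neq0 q_neq0 z_neq0] := pq_neq0 cx.
have hX := obX_; have hY := obY_; have hD := obD_; have hE := obE_; have hg := obg_.
have [hqg hqg'] := q_g; have hz := zeta_ob; have hz4 := ob_expR_quad hz.
have hp := ob_p cx; have hiq := ob_iq; have hip := ob_ip.
have [hiX hX2] : ob 0 1 (1 - X)^-1 /\ 1 / 2 <= 1 - X by apply: inv_near1; obt.
have [hiY hY2] : ob 0 1 (1 - Y)^-1 /\ 1 / 2 <= 1 - Y by apply: inv_near1; obt.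
have X_neq0 : 1 - X != 0 by rewrite gt_eqF //; lra.
have Y_neq0 : 1 - Y != 0 by rewrite gt_eqF //; lra.
have qg_neq0 : q - g != 0.
  by rewrite gt_eqF // (lt_le_trans _ hqg') // !divr_gt0 //; have := nu_ge2 cx; lra.
have hH4 : ob 2 20 (z ^+ 4 * (hrow (MH H) a + hcol (MH H) k)).
  have h1 := ob_hrow cx (i := 58) isT rM a; have h2 := ob_hcol cx (i := 58) isT rM k; obt.
set H4 := z ^+ 4 * _ in hH4.
have hP : 1 - P2h (MH H) a k = q - (D * (1 + X) + E * (1 + Y)) + p * g - H4 - (p^-1 - q^-1) * D * E.
  rewrite /SecondOrder.P2h /SecondOrder.mm Del_card /H4 /D /E /X /Y /g /=; field.
  by rewrite p_neq0 q_neq0.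
pose zeta2 := p^-1 * q^-1 * z ^+ 2 * (p * (D + E) + p ^+ 2 * z ^+ 2).
have hz2 : ob 3 30 zeta2 by rewrite /zeta2; obt.
have hzE : zeta = p^-1 * q^-1 * (p * H4 + D * E) + zeta2.
  rewrite /zeta /zeta2 /H4 /D /E; field; by rewrite p_neq0 q_neq0.
pose A1 := g ^+ 2 * p * q^-1 ^+ 2 * (q - g)^-1.
have hA1 : ob 4 30 A1 by rewrite /A1; obt.
pose A2 := D * X ^+ 2 * (1 - X)^-1.
have hA2 : ob 3 30 A2 by rewrite /A2; obt.
pose A3 := E * Y ^+ 2 * (1 - Y)^-1.
have hA3 : ob 3 30 A3 by rewrite /A3; obt.
move: hz4; set A4 := expR _ - _ => hA4.
have rE : rho = (q^-1 * (1 + g * p * q^-1) + A1) * (q - D * (1 + X) - A2) * (q - E * (1 + Y) - A3)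
    * (1 - zeta + A4).
  rewrite /rho; congr (_ * _ * _ * _).
  - by rewrite /A1; field; rewrite qg_neq0 q_neq0.
  - exact: inv_expand.
  - exact: inv_expand.
  - by rewrite /A4 addrC subrK.
pose B := q^-1 * (1 + g * p * q^-1); pose T := D * (1 + X) + E * (1 + Y).
have hB : ob 0 20 B by rewrite /B; obt.
have hT : ob 1 20 T by rewrite /T; obt.
pose z1 := p^-1 * q^-1 * (p * H4 + D * E).
have hz1 : ob 2 30 z1 by rewrite /z1; obt.
pose U := (q - D * (1 + X)) * (q - E * (1 + Y)).
have hU : ob 0 40 U by rewrite /U; obt.
pose U3 := D * E * (X + Y + X * Y).
have hU3 : ob 3 40 U3 by rewrite /U3; obt.
pose V := q - T + D * E * q^-1.
have UV : q^-1 * U = V + U3 * q^-1.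
  by rewrite /U /V /U3 /T; field.
pose r1 := A1 * (q - D * (1 + X) - A2) * (q - E * (1 + Y) - A3) * (1 - zeta + A4).
have hr1 : ob 3 190 r1 by rewrite /r1; obt.
pose r2 := B * (- A2 * (q - E * (1 + Y) - A3) - A3 * (q - D * (1 + X))) * (1 - zeta + A4).
have hr2 : ob 3 190 r2 by rewrite /r2; obt.
pose r3 := B * U * (A4 - zeta2).
have hr3 : ob 3 190 r3 by rewrite /r3; obt.
pose r4 := (1 + g * p * q^-1) * (U3 * q^-1) * (1 - z1).
have hr4 : ob 3 190 r4 by rewrite /r4; obt.
pose r5 := (D * E * q^-1 - T) * (g * p * q^-1 - z1) - V * (g * p * q^-1) * z1.
have hr5 : ob 3 190 r5 by rewrite /r5 /V; obt.
have -> : rho - (1 - P2h (MH H) a k) = r1 + r2 + r3 + r4 + r5.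
  rewrite hP rE hzE -/z1 -/B.
  have -> : (B + A1) * (q - D * (1 + X) - A2) * (q - E * (1 + Y) - A3) * (1 - (z1 + zeta2) + A4) =
    r1 + r2 + r3 + q^-1 * U * (1 + g * p * q^-1) * (1 - z1).
    by rewrite /r1 /r2 /r3 /U hzE -/z1 /B; ring.
  rewrite UV /r4 /r5 /V /z1 /T; field.
  by rewrite p_neq0 q_neq0.
obt.
Qed.

Lemma rho_lb : 1 / 2 <= nu * rho.
Proof.
have h1 := rho_P2h; have h2 := P2h_P1h cx a k (i := 58) isT rM.
have h3 := ob_P1h cx (i := 58) isT rM a k; have n0 := nu_ge2 cx.
have h4 : ob 1 250 (2 * nu * (rho - q)).
  rewrite (_ : rho - q = (rho - (1 - P2h (MH H) a k)) - ((P2h (MH H) a k - P1h z p (MH H) a k)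
     + (P1h z p (MH H) a k - p))); last by ring.
  obt.
have := ob_small sc bigE (csm cx) h4 isT isT; rewrite normrM ger0_norm; last by rewrite mulr_ge0 //; lra.
move=> h5; have h6 : 2 * nu * (q - rho) <= 1.
  apply: le_trans h5; apply: ler_wpM2l; first lra.
  by rewrite -normrN opprB; exact: ler_norm.
have hq := q_lb; lra.
Qed.

Lemma rho_gt0 : 0 < rho.
Proof.
have hr := rho_lb; have n0 := nu_ge2 cx; have n1 : 0 < nu by lra.
by rewrite -(pmulr_rgt0 _ n1); apply: lt_le_trans hr; rewrite divr_gt0.
Qed.

(** Relative error per cell; [H] together with the diagonal has at most about [nu ^+ 10 * z ^ (-2)]
    cells, so the total stays of order z. *)
Definition epsH : R := nu ^+ 510 * z ^+ 3.

Lemma pr_rho : nz (MH H) -> exists2 th, `|th| <= epsH & 1 - pr (MH H) c = rho * (1 + th).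
Proof.
move=> hz; have h1 := rho_P2h; have h2 := pr_approx cx rM hz hc; have hr := rho_lb.
have n0 := nu_ge2 cx.
have r0 := rho_gt0.
exists ((1 - pr (MH H) c - rho) / rho); last by field; rewrite gt_eqF.
have h3 : ob 3 505 (1 - pr (MH H) c - rho).
  rewrite (_ : _ - rho = - ((pr (MH H) c - P2h (MH H) a k) + (rho - (1 - P2h (MH H) a k)))); last by ring.
  obt.
have h4 : ob 0 2 rho^-1.
  apply: (ob_inv sc (k := 0)); rewrite expr0z mulr1 gtr0_norm //.
  rewrite -div1r ler_pdivrMr ?exprn_gt0 //; last lra.
  rewrite expr2; nra.
have h5 : ob 3 510 ((1 - pr (MH H) c - rho) / rho) by obt.
exact: h5.
Qed.

Lemma D_eq : (s a)%:R * z ^+ 2 = p + D - p * X.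
Proof.
rewrite /D /FirstOrder.dl /= /nr /X [RHS](_ : _ = p * (1 - n%:R * z ^+ 2) + (s a)%:R * z ^+ 2); last by ring.
by rewrite (scale_n sc) subrr mulr0 add0r.
Qed.

Lemma E_eq : (t k)%:R * z ^+ 2 = p + E - p * Y.
Proof.
rewrite /E /FirstOrder.et /= /nr /Y [RHS](_ : _ = p * (1 - n%:R * z ^+ 2) + (t k)%:R * z ^+ 2); last by ring.
by rewrite (scale_n sc) subrr mulr0 add0r.
Qed.

Lemma deg_bounds : [/\ (outdeg H a < n)%N, (s a <= n - outdeg H a)%N, (indeg H k < n)%N,
  (t k <= n - indeg H k)%N & (#|H| + m < n ^ 2)%N].
Proof.
have hX := obX_; have hY := obY_; have hD := obD_; have hE := obE_; have [_ hqg'] := q_g.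
have [_ hX2] : ob 0 1 (1 - X)^-1 /\ 1 / 2 <= 1 - X by apply: inv_near1; obt.
have [_ hY2] : ob 0 1 (1 - Y)^-1 /\ 1 / 2 <= 1 - Y by apply: inv_near1; obt.
have hq := q_lb; have n0 := nu_ge2 cx; have p1 := cp1 cx.
have sm x : ob 1 9 x -> 2 * x < q.
  move=> hx; have h : ob 1 13 (3 * nu * x) by obt.
  have := ob_small sc bigE (csm cx) h isT isT; rewrite normrM ger0_norm; last by rewrite mulr_ge0 //; lra.
  move=> h5; have h6 : 3 * nu * x <= 1.
    by apply: le_trans h5; apply: ler_wpM2l; [lra | exact: ler_norm].
  have : nu * (2 * x) < nu * q by lra.
  by rewrite ltr_pM2l //; lra.
have z2 : 0 < z ^+ 2 by rewrite exprn_gt0 // (z_gt0 cx).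
have nz2 : n%:R * z ^+ 2 = 1 by exact: (scale_n sc).
have x1 : (outdeg H a)%:R < n%:R :> R.
  by rewrite -(ltr_pM2r z2) nz2 -rdE; move: hX2; rewrite /X; lra.
have y1 : (indeg H k)%:R < n%:R :> R.
  by rewrite -(ltr_pM2r z2) nz2 -cdE; move: hY2; rewrite /Y; lra.
have x2 : (s a)%:R <= n%:R - (outdeg H a)%:R :> R.
  rewrite -(ler_pM2r z2) mulrBl nz2 -rdE -/X.
  rewrite D_eq.
  by have := sm _ hD; nra.
have y2 : (t k)%:R <= n%:R - (indeg H k)%:R :> R.
  rewrite -(ler_pM2r z2) mulrBl nz2 -cdE -/Y.
  rewrite E_eq.
  by have := sm _ hE; nra.
rewrite !ltr_nat in x1 y1; split=> //.
- by rewrite -natrB ?(ltnW x1) // ler_nat in x2.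
- by rewrite -natrB ?(ltnW y1) // ler_nat in y2.
rewrite -(ltr_nat R) natrD natrX hm.
have z4 : 0 < z ^+ 4 by rewrite exprn_gt0 // (z_gt0 cx).
rewrite -(ltr_pM2r z4) mulrDl -/g (_ : p * n%:R ^+ 2 * z ^+ 4 = p * (n%:R * z ^+ 2) ^+ 2); last by ring.
rewrite (_ : n%:R ^+ 2 * z ^+ 4 = (n%:R * z ^+ 2) ^+ 2); last by ring.
rewrite nz2 expr1n mulr1.
have : 0 < 1 / nu / 2 by rewrite !divr_gt0 //; lra.
lra.
Qed.

Lemma FF_step : FF (c |: H) = FF H * rho.
Proof.
have [x1 x2 y1 y2 hN] := deg_bounds; have nz2 : n%:R * z ^+ 2 = 1 by exact: (scale_n sc).
have z2 : 0 < z ^+ 2 by rewrite exprn_gt0 // (z_gt0 cx).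
have z2' : z ^+ 2 != 0 by rewrite gt_eqF.
have [_ _ z_neq0] := pq_neq0 cx.
have od j : outdeg (c |: H) j = (outdeg H j + (j == a))%N.
  by apply/eqP; rewrite -(eqr_nat R) natrD -!rdE rd_add.
have id j : indeg (c |: H) j = (indeg H j + (j == k))%N.
  by apply/eqP; rewrite -(eqr_nat R) natrD -!cdE cd_add.
have hx0 : 0 < n%:R - (outdeg H a)%:R :> R by rewrite subr_gt0 ltr_nat.
have hy0 : 0 < n%:R - (indeg H k)%:R :> R by rewrite subr_gt0 ltr_nat.
have eX : n%:R - (outdeg H a)%:R = (1 - X) / z ^+ 2.
  by rewrite /X rdE; apply: (mulIf z2'); rewrite mulfVK // mulrBl nz2.
have eY : n%:R - (indeg H k)%:R = (1 - Y) / z ^+ 2.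
  by rewrite /Y cdE; apply: (mulIf z2'); rewrite mulfVK // mulrBl nz2.
have X_neq0 : 1 - X != 0.
  by apply: contraTneq hx0 => e; rewrite eX e mul0r ltxx.
have Y_neq0 : 1 - Y != 0.
  by apply: contraTneq hy0 => e; rewrite eY e mul0r ltxx.
have eR : Frow (c |: H) = Frow H * (q - D / (1 - X)).
  have := prod_down od x1 x2; rewrite -/(Frow _) -/(Frow _) => e.
  apply: (mulIf (lt0r_neq0 hx0)); rewrite e eX.
  have -> : (1 - X) / z ^+ 2 - (s a)%:R = (1 - X) / z ^+ 2 * (q - D / (1 - X)); last by ring.
  rewrite -(mulfK z2' (s a)%:R).
  rewrite D_eq.
  by field; rewrite X_neq0 z_neq0.
have eC : Fcol (c |: H) = Fcol H * (q - E / (1 - Y)).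
  have := prod_down id y1 y2; rewrite -/(Fcol _) -/(Fcol _) => e.
  apply: (mulIf (lt0r_neq0 hy0)); rewrite e eY.
  have -> : (1 - Y) / z ^+ 2 - (t k)%:R = (1 - Y) / z ^+ 2 * (q - E / (1 - Y)); last by ring.
  rewrite -(mulfK z2' (t k)%:R).
  rewrite E_eq.
  by field; rewrite Y_neq0 z_neq0.
have cH : #|c |: H| = #|H|.+1 by rewrite cardsU1 hc.
have hb : ('C(n ^ 2 - #|c |: H|, m)%:R)^-1 = ('C(n ^ 2 - #|H|, m)%:R)^-1 * ((1 - g) / (q - g)) :> R.
  have hN1 : (#|H| < n ^ 2)%N by apply: leq_ltn_trans hN; exact: leq_addr.
  have hN2 : (m <= n ^ 2 - #|H|)%N by rewrite leq_subRL ltnW.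
  have hN3 : (m <= n ^ 2 - #|H|.+1)%N by rewrite leq_subRL // addSn.
  have e := mul_bin_down (n ^ 2 - #|H|) m; rewrite -subnS in e.
  have {}e : (n%:R ^+ 2 - #|H|%:R) * 'C(n ^ 2 - #|H|.+1, m)%:R =
     (n%:R ^+ 2 - #|H|%:R - m%:R) * 'C(n ^ 2 - #|H|, m)%:R :> R.
    rewrite -natrX -natrB 1?ltnW // -natrB // -!natrM; congr _%:R; exact: e.
  rewrite cH.
  have c1 : 'C(n ^ 2 - #|H|.+1, m)%:R != 0 :> R by rewrite pnatr_eq0 -lt0n binomial.bin_gt0.
  have c2 : 'C(n ^ 2 - #|H|, m)%:R != 0 :> R by rewrite pnatr_eq0 -lt0n binomial.bin_gt0.
  have n24 : n%:R ^+ 2 * z ^+ 4 = 1.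
    rewrite (_ : _ * z ^+ 4 = (n%:R * z ^+ 2) ^+ 2); last by ring.
    by rewrite nz2 expr1n.
  have z4 : z ^+ 4 != 0 by rewrite expf_neq0.
  have e1 : 1 - g = (n%:R ^+ 2 - #|H|%:R) * z ^+ 4 by rewrite mulrBl n24.
  have e2 : q - g = (n%:R ^+ 2 - #|H|%:R - m%:R) * z ^+ 4.
    rewrite hm !mulrBl n24 -mulrA n24 mulr1 /g; ring.
  have d1 : n%:R ^+ 2 - #|H|%:R - m%:R != 0 :> R.
    by rewrite gt_eqF // -addrA -opprD subr_gt0 -natrX -natrD ltr_nat.
  apply: (mulIf c1); rewrite mulVf // e1 e2 -mulf_div divff // mulr1.
  rewrite -mulrA (mulrC _ 'C(_, _)%:R) mulrA -mulrA.
  apply: (mulIf d1); rewrite mul1r.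
  rewrite (_ : _ * _ = 'C(n ^ 2 - #|H|, m)%:R^-1 * ((n%:R ^+ 2 - #|H|%:R) * 'C(n ^ 2 - #|H|.+1, m)%:R)); last first.
    by field; rewrite c2 d1.
  by rewrite e mulrC -mulrA mulfV ?mulr1.
rewrite /FF hb eR eC YY_step // (mulrDr (w * z ^+ 4)) opprD expRD /rho -/zeta; ring.
Qed.

End Step.

Lemma reg_sub H1 H2 i : H1 \subset H2 -> reg i (MH H2) -> reg i (MH H1).
Proof.
move=> hs [h1 h2 h3 h4 h5 h6 h7].
have le1 c : ind H1 c <= ind H2 c.
  rewrite /indc; case h: (c \in H1) => //=; first by rewrite (subsetP hs).
have lr a : rd H1 a <= rd H2 a by apply: ler_sum => l _.
split=> //= [a|a|].
- exact: le_trans (lr a) (h3 a).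
- by apply: le_trans (h4 a); apply: ler_sum => l _.
- by apply: le_trans h5; apply: ler_sum => l _.
Qed.

Lemma epsH_small : epsH <= 1 / 2.
Proof.
have h : ob 1 520 (2 * epsH) by rewrite /epsH; obt.
have := ob_small sc bigE (csm cx) h isT isT; have := ler_norm (2 * epsH); lra.
Qed.

Lemma FF0_gt0 : (forall j, (s j <= n)%N) -> (forall j, (t j <= n)%N) -> 0 < FF set0.
Proof.
move=> hs ht; have o0 j : outdeg (set0 : digraph n) j = 0%N.
  by apply/eqP; rewrite cards_eq0; apply/eqP/setP => l; rewrite !inE.
have i0 j : indeg (set0 : digraph n) j = 0%N.
  by apply/eqP; rewrite cards_eq0; apply/eqP/setP => l; rewrite !inE.
rewrite /FF /Frow /Fcol cards0 subn0; apply: mulr_gt0; last exact: expR_gt0.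
apply: mulr_gt0; last by apply: prodr_gt0 => j _; rewrite i0 subn0 ltr0n binomial.bin_gt0.
apply: mulr_gt0; last by apply: prodr_gt0 => j _; rewrite o0 subn0 ltr0n binomial.bin_gt0.
rewrite invr_gt0 ltr0n binomial.bin_gt0.
rewrite -(ler_nat R) hm natrX; have p1 := cp1 cx.
by apply: ler_piMl; [exact: exprn_ge0 | exact: ltW].
Qed.

(** Induction on the number of cells. Subsets of [H] inherit regularity from [H], and nonemptiness
    is part of the induction because [pr_rho] presupposes it. *)
Lemma add_H H : reg 58 (MH H) -> nz (MH set0) -> 0 < FF set0 ->
  [/\ nz (MH H), 0 < FF H &
   expR (- (2 * epsH * #|H|%:R)) * (Nb (MH set0) * FF H) <= Nb (MH H) * FF set0
     <= expR (2 * epsH * #|H|%:R) * (Nb (MH set0) * FF H)].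
Proof.
move=> rH z0 F0; move: {2}#|H| (erefl #|H|) => L; elim: L H rH => [|L IH] H rH.
  by move=> /eqP; rewrite cards_eq0 => /eqP ->; rewrite cards0 mulr0 oppr0 expR0 !mul1r lexx.
move=> hL; have [c cH] : exists c, c \in H by apply/card_gt0P; rewrite hL.
have hH : c |: (H :\ c) = H by exact: setD1K.
have cN : c \notin H :\ c by rewrite !inE eqxx.
have hL' : #|H :\ c| = L by have := cardsD1 c H; rewrite cH hL add1n => -[].
have rH' : reg 58 (MH (H :\ c)) by apply: reg_sub rH; exact: subD1set.
have [n1 F1 /andP[l1 l2]] := IH _ rH' hL'.
case: c cH hH cN rH' hL' n1 F1 l1 l2 => a k cH hH cN rH' hL' n1 F1 l1 l2.
have e0 := epsH_small; have nu2' := nu_ge2 cx.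
have [th hth hpr] := pr_rho cN rH' n1.
have fbE : fb (a, k) (MH (H :\ (a, k))) = MH H by rewrite /fb /MH /= hH.
have hN : Nb (MH H) = rho (H :\ (a, k)) a k * (1 + th) * Nb (MH (H :\ (a, k))).
  by rewrite -hpr pr_fb // fbE.
have hF : FF H = FF (H :\ (a, k)) * rho (H :\ (a, k)) a k by rewrite -FF_step // hH.
have r0 : 0 < rho (H :\ (a, k)) a k.
  exact: rho_gt0.
move: hth; rewrite ler_norml => /andP[t1 t2].
have [th1 u1 u2] := expR_1pm e0 t1 t2.
have N1 : 0 < Nb (MH (H :\ (a, k))) by exact: Nb_gt0.
have N0 : 0 < Nb (MH set0) by exact: Nb_gt0.
split.
- by rewrite /nz -(ltr0n R) -/(Nb _) hN; apply: mulr_gt0 => //; exact: mulr_gt0.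
- by rewrite hF mulr_gt0.
rewrite hN hF hL hL' in l1 l2 *.
set r := rho _ _ _ in r0 *; set M1 := Nb (MH (H :\ _)) in N1 l1 l2 *; set F := FF (H :\ _) in F1 l1 l2 *.
have eS : 2 * epsH * L.+1%:R = 2 * epsH + 2 * epsH * L%:R by rewrite -natr1; ring.
rewrite eS opprD !expRD.
rewrite (_ : r * (1 + th) * M1 * FF set0 = (1 + th) * (r * (M1 * FF set0))); last by ring.
have g1 : 0 <= r * (M1 * FF set0) by apply/ltW/mulr_gt0/mulr_gt0.
have g2 : 0 <= expR (- (2 * epsH)) by exact: expR_ge0.
have g3 : 0 <= expR (2 * epsH) by exact: expR_ge0.
apply/andP; split.
  apply: le_trans (ler_wpM2r g1 u2).
  rewrite -mulrA; apply: ler_wpM2l => //.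
  rewrite [leLHS](_ : _ = r * (expR (- (2 * epsH * L%:R)) * (Nb (MH set0) * F))); last by ring.
  by apply: ler_wpM2l => //; exact: ltW.
apply: le_trans (ler_wpM2r g1 u1) _.
rewrite -[leRHS]mulrA; apply: ler_wpM2l => //.
rewrite [leRHS](_ : _ = r * (expR (2 * epsH * L%:R) * (Nb (MH set0) * F))); last by ring.
by apply: ler_wpM2l => //; exact: ltW.
Qed.

End AddH.

End Insertion.
Import Insertion.

(** * The diagonal, and assembly of the formula *)

Module Loops.

(** Looplessness amounts to n further forbidden cells, so the counting above applies to [H] enlarged
    by the diagonal. *)
Definition with_loops n (H : digraph n) : digraph n := H :|: [set e | e.2 == e.1].

Lemma ind_loops (R : realFieldType) n (H : digraph n) e : simple_digraph H ->
  indc R (with_loops H) e = indc R H e + (e.2 == e.1)%:R.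
Proof.
move=> /forallP h; rewrite /indc !inE; case: e => a k /=.
by case: eqP => [->|_]; rewrite ?orbF ?orbT ?addr0 // (negbTE (h a)) add0r.
Qed.

Lemma rd_loops (R : realFieldType) n (H : digraph n) a : simple_digraph H ->
  rd R (with_loops H) a = rd R H a + 1.
Proof.
move=> h; rewrite /rd (eq_bigr (fun k => indc R H (a, k) + (k == a)%:R)).
  by rewrite big_split /= sum_eqr.
by move=> k _; rewrite ind_loops.
Qed.

Lemma cd_loops (R : realFieldType) n (H : digraph n) a : simple_digraph H ->
  cd R (with_loops H) a = cd R H a + 1.
Proof.
move=> h; rewrite /cd (eq_bigr (fun k => indc R H (k, a) + (k == a)%:R)).
  by rewrite big_split /= sum_eqr.
by move=> k _; rewrite ind_loops //= eq_sym.
Qed.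

Lemma out_loops n (H : digraph n) a : simple_digraph H ->
  outdeg (with_loops H) a = (outdeg H a).+1.
Proof.
move=> /forallP h; rewrite /outdeg -add1n.
rewrite (_ : [set k | _] = a |: [set k | (a, k) \in H]); first by rewrite cardsU1 inE (h a).
by apply/setP => k; rewrite !inE orbC.
Qed.

Lemma in_loops n (H : digraph n) a : simple_digraph H ->
  indeg (with_loops H) a = (indeg H a).+1.
Proof.
move=> /forallP h; rewrite /indeg -add1n.
rewrite (_ : [set k | _] = a |: [set k | (k, a) \in H]); first by rewrite cardsU1 inE (h a).
by apply/setP => k; rewrite !inE orbC eq_sym.
Qed.

Lemma card_loops n (H : digraph n) : simple_digraph H ->
  #|with_loops H| = (Xarcs H + n)%N.
Proof.
move=> h; rewrite card_sum_outdeg (eq_bigr (fun a => (xdeg H a + 1)%N)).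
  by rewrite big_split /= sum1_card card_ord.
by move=> a _; rewrite out_loops // addn1.
Qed.

Lemma card_Dset (R : realType) n (s t : 'I_n -> nat) (H : digraph n) :
  (#|Dset s t H|)%:R = Nb (MH R s t (with_loops H)).
Proof.
rewrite /Nb; congr _%:R; apply: eq_card => G; rewrite inE.
apply/and4P/gsP => /= [[/forallP h1 /forallP h2 /forallP h3 h4]|[h1 h2 h3]]; split.
- by move=> a; rewrite rdE (eqP (h2 a)).
- by move=> a; rewrite cdE (eqP (h3 a)).
- move=> [a k] hG; rewrite !inE /= negb_or; apply/andP; split.
    by apply: contraL hG => hH; apply/negP => hG; have := disjointFr h4 hG; rewrite hH.
  by apply: contraTneq hG => ->; exact: h1.
- by apply/forallP => j; apply/negP => /h3; rewrite !inE eqxx orbT.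
- by apply/forallP => j; rewrite -(eqr_nat R) -rdE h1.
- by apply/forallP => j; rewrite -(eqr_nat R) -cdE h2.
- rewrite disjoint_subset; apply/subsetP => c hc; have := h3 c hc.
  by rewrite !inE negb_or => /andP[].
Qed.

Section Core.
Variables (R : realType) (n : nat) (nu z : R) (s t : 'I_n -> nat) (H : digraph n).
Local Notation p := (lam R s).
Hypothesis cx : ctx n nu z p.
Hypothesis hexp : expR (- nu) <= z ^+ 20.
Hypothesis st : (\sum_j s j = \sum_j t j)%N.
Hypothesis sH : simple_digraph H.
Hypotheses (bs : bx nu z p s) (bt : bx nu z p t).
Hypotheses (hx : forall j, (xdeg H j)%:R <= nu / z) (hy : forall j, (ydeg H j)%:R <= nu / z).
Hypothesis hX : (Xarcs H)%:R + n%:R <= (nu / z) ^+ 2.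
Local Notation H' := (with_loops H).
Local Notation m := (\sum_j s j)%N.
Local Notation M := (MH R s t H').
Local Notation q := (1 - p).
Local Notation w := (p * (1 - p))^-1.
Local Notation ob := (ob nu z).
Let sc := cs cx.

Lemma n_neq0 : n%:R != 0 :> R. Proof. by rewrite gt_eqF // (n_gt0 cx). Qed.

Lemma sum_s_lam : m%:R = p * n%:R ^+ 2.
Proof. by rewrite /lam /sbar; field; exact: n_neq0. Qed.

Lemma sbar_lam : sbar R s = p * n%:R.
Proof. by rewrite /lam; field; exact: n_neq0. Qed.

Lemma z4n : z ^+ 4 = (n%:R ^+ 2)^-1.
Proof.
have e := scale_n sc; have n2 : n%:R ^+ 2 != 0 :> R by rewrite expf_neq0 // n_neq0.
apply: (mulfI n2); rewrite mulfV //.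
by rewrite (_ : _ * _ = (n%:R * z ^+ 2) ^+ 2); [rewrite e expr1n | ring].
Qed.

Lemma w_Acst (x : R) : x / (2 * Acst R s * n%:R ^+ 2) = w * z ^+ 4 * x.
Proof.
have [p0 q0 _] := pq_neq0 cx; rewrite z4n /Acst; field.
by rewrite n_neq0 p0 q0.
Qed.

Lemma reg_loops : reg nu z p 58 M.
Proof.
split=> /= [a|a|a|a|||].
- by apply: le_trans (bs a) _; rewrite lerDl.
- by apply: le_trans (bt a) _; rewrite lerDl.
- by rewrite rd_loops // rdE; apply: lerD; [exact: hx | rewrite ler1n].
- by rewrite cd_loops // cdE; apply: lerD; [exact: hy | rewrite ler1n].
- rewrite -(cardE R H') card_loops // natrD; apply: le_trans hX _; by rewrite lerDl.
- by rewrite /nr -natr_sum sum_s_lam subrr normr0.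
- by rewrite /nr -natr_sum -st sum_s_lam subrr normr0.
Qed.

Definition Ydiff : R := YY p s t H' - (Ysum R s t H + STsum R s t).

Lemma Ysum_loops : Ysum R s t H = \sum_a \sum_k indc R H (a, k) * ((dl p M a - p) * (et p M k - p)).
Proof.
rewrite /Ysum (eq_bigr (fun e => (dl p M e.1 - p) * (et p M e.2 - p))); last first.
  move=> e _; rewrite /delta /eta /FirstOrder.dl /FirstOrder.et /= rd_loops // cd_loops // rdE cdE /nr sbar_lam /xdeg /ydeg.
  by congr (_ * _); ring.
rewrite big_mkcond /= (pair_bigA _ (fun a k => indc R H (a, k) * ((dl p M a - p) * (et p M k - p)))) /=.
apply: eq_bigr => -[a k] _ /=; rewrite /indc; case: ifP => _; by rewrite ?mul1r ?mul0r.
Qed.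

(** The diagonal cells in [YY] produce the sum of (s_j - s)(t_j - s), and the off-diagonal ones give
    Y, up to the shift of all degrees by 1. The discrepancy is multiplied by [w * z ^+ 4] in the
    exponent, which leaves O(z). *)
Lemma Ydiff_ob : ob (-3) 100 Ydiff.
Proof.
have rM := reg_loops; have hp := ob_p cx.
have hd a := ob_dl cx (i := 58) isT rM a; have he a := ob_et cx (i := 58) isT rM a.
have hs a : ob (-1) 8 (nr R s a - p * n%:R) := ob_s cx (i := 58) isT rM a.
have ht a : ob (-1) 8 (nr R t a - p * n%:R) := ob_t cx (i := 58) isT rM a.
have hyy a : ob (-1) 8 (cd R H' a) := ob_y cx (i := 58) isT rM a.
(* On the diagonal, [(dl - p) * (et - p)] exceeds the product in [STsum] by
   [(rd - 1) * g + (cd - 1) * f]. *)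
pose g j := p * (nr R t j - p * n%:R) + p ^+ 2 * (cd R H' j - 1).
pose f j := p * (nr R s j - p * n%:R).
have hg j : ob (-1) 20 (g j) by have := ht j; have := hyy j => *; rewrite /g; obt.
have hf j : ob (-1) 20 (f j) by have := hs j => *; rewrite /f; obt.
have h1 : ob (-3) 40 (\sum_a \sum_k indc R H' (a, k) * (p * (dl p M a + et p M k) - p ^+ 2)).
  apply: (ob_rd_sum cx (k := -1) (c := 30) (i := 58) isT rM (F := fun a k => p * (dl p M a + et p M k) - p ^+ 2)).
  by move=> a k; have := hd a; have := he k => *; obt.
have h2 : ob (-3) 40 (\sum_a \sum_k indc R H' (a, k) * g a).
  apply: (ob_rd_sum cx (k := -1) (c := 30) (i := 58) isT rM (F := fun a k => g a)).
  by move=> a k; have := hg a => *; obt.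
have h3 : ob (-3) 40 (\sum_a \sum_k indc R H' (a, k) * f k).
  apply: (ob_rd_sum cx (k := -1) (c := 30) (i := 58) isT rM (F := fun a k => f k)).
  by move=> a k; have := hf k => *; obt.
have h4 : ob (-3) 20 (\sum_j g j) by apply: (ob_sum sc (k := -1)); rewrite ?card_ord.
have h5 : ob (-3) 20 (\sum_j f j) by apply: (ob_sum sc (k := -1)); rewrite ?card_ord.
have -> : Ydiff = \sum_a \sum_k indc R H' (a, k) * (p * (dl p M a + et p M k) - p ^+ 2)
   + (\sum_a \sum_k indc R H' (a, k) * g a - \sum_j g j)
   + (\sum_a \sum_k indc R H' (a, k) * f k - \sum_j f j); last by obt.
have e2 : \sum_a \sum_k indc R H' (a, k) * g a = \sum_a rd R H' a * g a.
  by apply: eq_bigr => a _; rewrite /rd /cd mulr_suml.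
have e3 : \sum_a \sum_k indc R H' (a, k) * f k = \sum_a cd R H' a * f a.
  by rewrite exchange_big; apply: eq_bigr => a _; rewrite /rd /cd mulr_suml.
rewrite e2 e3 -!sumrB.
have e4 : \sum_a \sum_k indc R H' (a, k) * (p * (dl p M a + et p M k) - p ^+ 2) =
  YY p s t H' - (Ysum R s t H + \sum_j (dl p M j - p) * (et p M j - p)).
  have -> : Ysum R s t H + \sum_j (dl p M j - p) * (et p M j - p) =
     \sum_a \sum_k indc R H' (a, k) * ((dl p M a - p) * (et p M k - p)).
    rewrite Ysum_loops -big_split /=; apply: eq_bigr => a _.
    rewrite -(sum_pick a (fun k => (dl p M a - p) * (et p M k - p))) -big_split /=.
    by apply: eq_bigr => k _; rewrite ind_loops //= [RHS]mulrDl.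
  rewrite /YY -sumrB; apply: eq_bigr => a _; rewrite -sumrB; apply: eq_bigr => k _.
  ring.
rewrite e4 /Ydiff -!addrA; congr (_ + _); rewrite !opprD -!addrA; congr (_ + _).
rewrite /STsum -sumrN -sumrN -!big_split /=; apply: eq_bigr => j _.
rewrite /FirstOrder.dl /FirstOrder.et /g /f /= !sbar_lam !rd_loops // !cd_loops // /nr; ring.
Qed.

Lemma FF_formula : FF z p m s t H' * expR (- (1 / 2) * (1 - rr z p s) * (1 - rr z p t)) =
  formula s t H (- (w * z ^+ 4 * Ydiff)).
Proof.
rewrite /FF /formula card_loops // subnDA -[LHS]mulrA -expRD; congr (_ * expR _).
  rewrite -mulrA; congr (_ * _); rewrite /Frow /Fcol -big_split; apply: eq_bigr => j _.
  by rewrite out_loops // in_loops // /xdeg /ydeg !subn1 !subnS.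
rewrite !w_Acst /Rsum /Csum !sbar_lam /rr /nr /Ydiff; ring.
Qed.

Lemma bounded_ln (x y k : R) : 0 < y -> expR (- k) * y <= x <= expR k * y ->
  exists2 d, `|d| <= k & x = y * expR d.
Proof.
move=> y0 /andP[h1 h2]; have x0 : 0 < x by apply: lt_le_trans h1; rewrite mulr_gt0 ?expR_gt0.
exists (ln (x / y)); last by rewrite lnK ?posrE ?divr_gt0 // mulrCA mulfV ?mulr1 // gt_eqF.
by rewrite ler_norml; apply/andP; split; rewrite -ler_expR lnK ?posrE ?divr_gt0 // ?ler_pdivlMr ?ler_pdivrMr.
Qed.

Lemma sub1_loops j : (s j <= n)%N /\ (t j <= n)%N.
Proof. by split; apply/ltnW; [apply: (bx_le cx bs) | apply: (bx_le cx bt)]. Qed.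

(** [NN_norm] settles the empty set and [add_H] leads from it to [H']. The three errors, from
    normalisation, insertion and [Ydiff], are each of order z up to powers of [nu], and [nu ^+ 2900]
    covers their sum. *)
Lemma core : exists2 d, `|d| <= nu ^+ 2900 * z & (#|Dset s t H|)%:R = formula s t H d.
Proof.
have hm := sum_s_lam; have rM := reg_loops.
have GG0 := GG_gt0 cx bs bt.
have hF0 : 0 < FF z p m s t set0.
  by apply: (FF0_gt0 cx hm) => j; have [] := sub1_loops j.
have /andP[l1 l2] := NN_norm cx hm hexp erefl (esym st) bs bt.
have T0 := tot_gt0 cx hm.
have N0 : 0 < NN R s t.
  by rewrite -(pmulr_lgt0 _ T0) (lt_le_trans _ l1) // mulr_gt0 ?expR_gt0.
have nz0 : nz (MH R s t set0) by rewrite /nz -(ltr0n R).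
have [_ F1 /andP[m1 m2]] := add_H cx hm erefl rM nz0 hF0.
set kH := 2 * epsH nu z * #|H'|%:R in m1 m2.
set E := expR (- (1 / 2) * (1 - rr z p s) * (1 - rr z p t)).
have E0 : 0 < E by exact: expR_gt0.
have tot_eq : 'C(n ^ 2, m)%:R * FF z p m s t set0 * E = GG z p s t.
  rewrite /FF cards0 subn0 (_ : YY p s t set0 = 0); last first.
    by rewrite /YY big1 // => a _; rewrite big1 // => k _; rewrite /indc inE mul0r.
  rewrite mulr0 oppr0 expR0 mulr1 !mulrA mulfV ?gt_eqF // mul1r /GG -/E.
  congr (_ * _ * _); apply: eq_bigr => j _; rewrite ?/outdeg ?/indeg.
    by rewrite (_ : [set k | _] = set0) ?cards0 ?subn0 //; apply/setP => k; rewrite !inE.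
  by rewrite (_ : [set k | _] = set0) ?cards0 ?subn0 //; apply/setP => k; rewrite !inE.
have F1E : 0 < FF z p m s t H' * E by exact: mulr_gt0.
have hNF : expR (- (kH + kapN nu z)) * (FF z p m s t H' * E) <= Nb M <= expR (kH + kapN nu z) * (FF z p m s t H' * E).
  have sw (x : R) : x * Nb (MH R s t set0) * FF z p m s t H' * 'C(n ^ 2, m)%:R * E = x * (NN R s t * 'C(n ^ 2, m)%:R) * (FF z p m s t H' * E).
    by rewrite /NN; ring.
  have hT : 0 < 'C(n ^ 2, m)%:R * E by exact: mulr_gt0.
  have hG : Nb M * GG z p s t = Nb M * FF z p m s t set0 * ('C(n ^ 2, m)%:R * E).
    by rewrite -tot_eq; ring.
  rewrite opprD !expRD; apply/andP; split; rewrite -(ler_pM2r GG0) hG.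
    apply: le_trans (ler_wpM2r (ltW hT) m1).
    rewrite [leLHS](_ : _ = expR (- kH) * (FF z p m s t H' * E) * (expR (- kapN nu z) * GG z p s t)); last by ring.
    rewrite [leRHS](_ : _ = expR (- kH) * (FF z p m s t H' * E) * (NN R s t * 'C(n ^ 2, m)%:R)); last by rewrite /NN; ring.
    by apply: ler_wpM2l => //; rewrite mulr_ge0 ?expR_ge0 // ltW.
  apply: le_trans (ler_wpM2r (ltW hT) m2) _.
  rewrite [leRHS](_ : _ = expR kH * (FF z p m s t H' * E) * (expR (kapN nu z) * GG z p s t)); last by ring.
  rewrite [leLHS](_ : _ = expR kH * (FF z p m s t H' * E) * (NN R s t * 'C(n ^ 2, m)%:R)); last by rewrite /NN; ring.
  by apply: ler_wpM2l => //; rewrite mulr_ge0 ?expR_ge0 // ltW.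
have [d1 hd1 e1] := bounded_ln F1E hNF.
exists (- (w * z ^+ 4 * Ydiff) + d1); last first.
  rewrite card_Dset e1 FF_formula /formula -[LHS]mulrA -expRD; congr (_ * expR _).
  by rewrite addrA.
have hw := ob_w cx; have hY := Ydiff_ob.
have hc : ob (-2) 10 (#|H'|%:R : R).
  by rewrite (cardE R H'); exact: (ob_rdsum cx (i := 58) isT rM).
have hk : ob 1 2800 (kapN nu z) by rewrite /kapN; obt.
have he : ob 3 510 (epsH nu z) by rewrite /epsH; obt.
have hkH : ob 1 530 kH by rewrite /kH; obt.
have h1 : ob 1 2801 d1 by apply: (ob_of_le hd1); obt.
have h2 : ob 1 2900 (- (w * z ^+ 4 * Ydiff) + d1) by obt.
exact: h2.
Qed.
End Core.

End Loops.
Import Loops.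

(** * Choice of [nu] and [z] in terms of n *)

Module Growth.

Lemma expR_ge_sqr (R : realType) (x : R) : 0 <= x -> x ^+ 2 / 4 <= expR x.
Proof.
move=> x0; have h := expR_ge1Dx (x / 2).
rewrite [in leRHS](_ : x = x / 2 + x / 2); last by field.
rewrite expRD; apply: (@le_trans _ _ ((1 + x / 2) * (1 + x / 2))).
  rewrite [leRHS](_ : _ = 1 + x + x ^+ 2 / 4); [lra | by field].
by apply: ler_pM => //; lra.
Qed.

(** With out-degree n or more there is no loopless digraph, and a binomial in the formula vanishes
    as well, so every [d] works. The other case has lambda < 1. *)
Lemma dense_trivial (R : realType) n (s t : 'I_n -> nat) (H : digraph n) d j :
  (n <= s j)%N -> #|Dset s t H|%:R = formula s t H d :> R.
Proof.
move=> h; have n0 : (0 < n)%N by apply: leq_ltn_trans (ltn_ord j).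
have e : 'C(n - xdeg H j - 1, s j) = 0%N by apply: bin_small; move: (xdeg H j) => x; lia.
rewrite /formula [X in _ * X * _](bigD1 j) //= e.
rewrite !mul0r mulr0 mul0r; apply/eqP; rewrite pnatr_eq0 cards_eq0; apply/eqP/setP => G.
rewrite !inE; apply/negP => /and4P[sG /forallP/(_ j)/eqP oG _ _].
have := max_card (mem [set k | (j, k) \in with_loops G]).
rewrite -/(outdeg (with_loops G) j) out_loops // oG card_ord; lia.
Qed.

Lemma lam_lt1 (R : realType) n (s : 'I_n -> nat) : (0 < n)%N ->
  (forall j, (s j < n)%N) -> lam R s < 1.
Proof.
move=> n0 h; have n1 : 0 < n%:R :> R by rewrite ltr0n.
rewrite /lam /sbar !ltr_pdivrMr // mul1r -natrM ltr_nat.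
apply: (@leq_trans (\sum_(j < n) n)%N); last by rewrite sum_nat_const card_ord.
apply: (@leq_trans (\sum_(j < n) (s j + 1))%N).
  by rewrite big_split /= sum1_card card_ord -addn1 leq_add2l.
by apply: leq_sum => j _; rewrite addn1.
Qed.

Section Growth.
Variables (R : realType) (a b eps K : R).
Hypotheses (a0 : 0 < a) (b0 : 0 < b) (ab : a + b < 1 / 2) (e0 : 0 < eps).
Hypothesis he : bigE%:R * eps < 1 / 2 - b.
Definition k0 : R := `|K| + 2.
Definition Bc : R := k0 ^+ bigE.
(** Threshold for log n. The second summand makes [nuL] exceed [(10 + 2 * a) * L + 4], as needed for
    [expR (- nu) <= z ^+ 20] and for [cw]; the third makes n^(1/2 - bigE eps) outweigh the constant
    [Bc]. *)
Definition L0 : R := 1 + 2 * (14 + 2 * a) / eps ^+ 2 + Bc / (1 / 2 - bigE%:R * eps).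
Variable L : R.
Hypothesis hL : L0 <= L.
(** With [L] = log n this is k0 n^eps, and [zL] is n^(-1/2). So [nuL / zL] is k0 n^(1/2+eps), which
    dominates the degree hypotheses with constant K, and its square dominates X + n. *)
Definition nuL : R := k0 * expR (eps * L).
Definition zL : R := expR (- (L / 2)).

Lemma k0_ge2 : 2 <= k0. Proof. by rewrite /k0 lerDr. Qed.
Lemma Bc_ge0 : 0 <= Bc. Proof. by apply: exprn_ge0; have := k0_ge2; lra. Qed.

Lemma L_bounds : [/\ 1 <= L, 2 * (14 + 2 * a) <= eps ^+ 2 * L & Bc <= (1 / 2 - bigE%:R * eps) * L].
Proof.
have B0 := Bc_ge0; have e2 : 0 < eps ^+ 2 by rewrite exprn_gt0.
have k1 : 0 < 1 / 2 - bigE%:R * eps by have := he; have := b0; lra.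
have t1 : 0 <= 2 * (14 + 2 * a) / eps ^+ 2.
  by apply: divr_ge0; [have := a0; lra | exact: ltW].
have t2 : 0 <= Bc / (1 / 2 - bigE%:R * eps) by apply: divr_ge0 => //; exact: ltW.
have h := hL; rewrite /L0 in h; split.
- lra.
- by rewrite [leRHS]mulrC -ler_pdivrMr //; lra.
- by rewrite [leRHS]mulrC -ler_pdivrMr //; lra.
Qed.

Lemma nuL_ge : (10 + 2 * a) * L + 4 <= nuL.
Proof.
have [L1 L2 _] := L_bounds; have k2 := k0_ge2.
have eL : 0 <= eps * L by apply: mulr_ge0; [exact: ltW | lra].
have h := expR_ge_sqr eL; have h0 := expR_ge0 (eps * L).
apply: (@le_trans _ _ (2 * expR (eps * L))); last by rewrite /nuL ler_wpM2r.
apply: (@le_trans _ _ ((eps ^+ 2 * L) * L / 2)); last by move: h; rewrite exprMn !expr2; lra.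
have : 2 * (14 + 2 * a) * L <= eps ^+ 2 * L * L by apply: ler_wpM2r => //; lra.
lra.
Qed.

Lemma nuL_ge2 : 2 <= nuL.
Proof.
have [L1 _ _] := L_bounds; have h := nuL_ge; have a0' := a0.
have : 0 <= (10 + 2 * a) * L by apply: mulr_ge0; lra.
lra.
Qed.

Lemma zL_gt0 : 0 < zL. Proof. exact: expR_gt0. Qed.

Lemma nuLzL : nuL ^+ bigE * zL = Bc * expR (bigE%:R * eps * L - L / 2).
Proof.
rewrite /nuL /zL exprMn -expRM_natr -[LHS]mulrA -expRD; congr (_ * expR _).
by rewrite mulrC mulrA.
Qed.

Lemma nuLzL_le1 : nuL ^+ bigE * zL <= 1.
Proof.
have [L1 _ L3] := L_bounds; rewrite nuLzL.
rewrite (_ : _ - L / 2 = - ((1 / 2 - bigE%:R * eps) * L)); last by move: (bigE%:R * eps) => x; field.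
rewrite expRN ler_pdivrMr ?expR_gt0 // [leRHS]mul1r.
apply: (le_trans L3); apply: (le_trans _ (expR_ge1Dx _)); exact: ler_wpDl.
Qed.

(** At most [bigE] factors n^eps multiply n^(-1/2), and [he] says that at least a factor n^(-b) is
    left. *)
Lemma nuLzL_le : nuL ^+ 2900 * zL <= Bc * expR (- b * L).
Proof.
have [L1 _ _] := L_bounds; have n2 := nuL_ge2.
apply: (@le_trans _ _ (nuL ^+ bigE * zL)).
  apply: ler_wpM2r; first exact: ltW zL_gt0.
  by apply: ler_weXn2l; [lra | rewrite /bigE].
rewrite nuLzL; apply: ler_wpM2l; first exact: Bc_ge0.
rewrite ler_expR; have h : bigE%:R * eps * L <= (1 / 2 - b) * L.
  by apply: ler_wpM2r; [lra | exact: ltW he].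
lra.
Qed.

Lemma expR_nuL : expR (- nuL) <= zL ^+ 20.
Proof.
have [L1 _ _] := L_bounds; have h := nuL_ge; have a0' := a0.
rewrite /zL -expRM_natr ler_expR.
have : 0 <= a * L by apply: mulr_ge0; lra.
lra.
Qed.

Lemma scaleL n : n%:R = expR L -> scale n nuL zL.
Proof.
move=> hn; have [L1 _ _] := L_bounds; split; [exact: nuL_ge2 | exact: zL_gt0 | | ].
  by rewrite /zL -[leRHS]expR0 ler_expR; lra.
by rewrite hn /zL -expRM_natr -expRD -[RHS]expR0; congr expR; field.
Qed.

(** As (1 - 2p)^2 = 1 - 4p(1 - p), the hypothesis gives 1 <= p(1 - p)(4 + 3aL/2), and [nuL] exceeds
    the last bracket. *)
Lemma ctxL n p : n%:R = expR L -> 0 < p -> p < 1 ->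
  (1 - 2 * p) ^+ 2 / (3 * (p * (1 - p) / 2)) <= a * L -> ctx n nuL zL p.
Proof.
move=> hn p0 p1 h; have [L1 _ _] := L_bounds.
split=> //; [exact: scaleL | | exact: nuLzL_le1].
have pq : 0 < p * (1 - p) by apply: mulr_gt0; lra.
move: h; rewrite ler_pdivrMr; last by lra.
move=> h; have h2 : p * (1 - p) * ((10 + 2 * a) * L + 4) <= p * (1 - p) * nuL.
  by apply: ler_wpM2l; [exact: ltW | exact: nuL_ge].
have aL : 0 <= a * L by apply: mulr_ge0; have := a0; lra.
have : 0 <= p * (1 - p) * ((10 + a / 2) * L).
  by apply: mulr_ge0; [exact: ltW | apply: mulr_ge0; have := a0; lra].
move: h; rewrite expr2 [nuL * _]mulrC; move: nuL h2 => x; nra.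
Qed.

Lemma nuL_zL : nuL / zL = k0 * expR ((1 / 2 + eps) * L).
Proof.
by rewrite /nuL /zL expRN invrK -[LHS]mulrA -expRD; congr (_ * expR _); field.
Qed.

Lemma K_le x : K * expR ((1 / 2 + eps) * L) >= x -> x <= nuL / zL.
Proof.
move=> h; apply: le_trans h _; rewrite nuL_zL; apply: ler_wpM2r; first exact: expR_ge0.
by rewrite /k0; have := ler_norm K; lra.
Qed.

Lemma K_le2 x n : n%:R = expR L -> x <= K * expR ((1 + 2 * eps) * L) ->
  x + n%:R <= (nuL / zL) ^+ 2.
Proof.
move=> hn h; have [L1 _ _] := L_bounds.
rewrite nuL_zL exprMn -expRM_natr (_ : (1 / 2 + eps) * L * 2%:R = (1 + 2 * eps) * L); last by field.
have : n%:R <= expR ((1 + 2 * eps) * L).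
  rewrite hn ler_expR mulrDl mul1r lerDl; apply: mulr_ge0; last by lra.
  by have := e0; lra.
set E := expR _ in h *; move=> h2.
have E0 : 0 <= E by exact: expR_ge0.
have : (K + 1) * E <= k0 ^+ 2 * E.
  apply: ler_wpM2r => //; have k2 := k0_ge2; rewrite expr2.
  have : K + 1 <= k0 by rewrite /k0; have := ler_norm K; lra.
  nra.
lra.
Qed.
End Growth.

End Growth.
Import Growth.

From mathcomp Require Import all_classical all_reals all_analysis.

Theorem theorem3p1 (R : realType) (a b : R) :
  0 < a -> 0 < b -> a + b < 1 / 2 ->
  exists eps0 : R, 0 < eps0 /\
  forall eps : R, 0 < eps -> eps < eps0 ->
  forall K : R,
  exists Cst : R, exists N : nat,
  forall (n : nat) (s t : 'I_n -> nat) (H : digraph n),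
    (N <= n)%N ->
    (forall j, (0 < s j)%N) -> (forall j, (0 < t j)%N) ->
    (\sum_j s j = \sum_j t j)%N ->
    simple_digraph H ->
    (forall j, `|(s j)%:R - sbar R s| <= K * n%:R `^ (1 / 2 + eps)) ->
    (forall j, `|(t j)%:R - sbar R s| <= K * n%:R `^ (1 / 2 + eps)) ->
    (forall j, (xdeg H j)%:R <= K * n%:R `^ (1 / 2 + eps) :> R) ->
    (forall j, (ydeg H j)%:R <= K * n%:R `^ (1 / 2 + eps) :> R) ->
    (Xarcs H)%:R <= K * n%:R `^ (1 + 2 * eps) ->
    (1 - 2 * lam R s) ^+ 2 / (3 * Acst R s) <= a * ln n%:R ->
    exists d : R, `|d| <= Cst * n%:R `^ (- b) /\
      (#|Dset s t H|)%:R = formula s t H d.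
Proof.
move=> a0 b0 ab; have bE : 0 < bigE%:R :> R by rewrite ltr0n.
(* The error is n^(-1/2) times fewer than [bigE] factors n^eps; this value of eps0 keeps it below a
   constant times n^(-b). *)
exists ((1 / 2 - b) / bigE%:R); split; first by apply: divr_gt0 => //; lra.
move=> eps e0; rewrite ltr_pdivlMr // [X in X < _]mulrC => he K.
(* The constant collects the powers of [k0] in [nuL]; every n beyond the second witness satisfies
   log n >= [L0]. *)
exists (Bc K), (Num.bound (expR (L0 a eps K))).
move=> n s t H hn s0 t0 st sH hs ht hx hy hX hA.
have hnE : expR (L0 a eps K) < n%:R.
  by apply: lt_le_trans (archi_boundP (expR_ge0 _)) _; rewrite ler_nat.
have n0 : 0 < n%:R :> R by apply: lt_trans hnE; exact: expR_gt0.
have nL : n%:R = expR (ln n%:R) :> R by rewrite lnK.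
have hL : L0 a eps K <= ln n%:R by rewrite -ler_expR -nL ltW.
have pw (x : R) : n%:R `^ x = expR (x * ln n%:R) by rewrite /powR gt_eqF.
rewrite !pw in hs ht hx hy hX *.
have Bx (x : R) : 0 <= Bc K * expR x by apply: mulr_ge0; [exact: Bc_ge0 | exact: expR_ge0].
have [/existsP[j hj]|/existsPn hlt] := boolP [exists j, (n <= s j)%N].
  by exists 0; rewrite normr0; split=> //; exact: (dense_trivial _ _ _ hj).
have nn : (0 < n)%N by rewrite -(ltr0n R).
have p1 : lam R s < 1 by apply: lam_lt1 => // j; rewrite ltnNge.
have p0 : 0 < lam R s.
  rewrite /lam /sbar !divr_gt0 // ltr0n (bigD1 (Ordinal nn)) //= addn_gt0 s0.
  by [].
have cx := ctxL a0 b0 e0 he hL nL p0 p1 hA.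
have [d hd ->] : exists2 d, `|d| <= nuL eps K (ln n%:R) ^+ 2900 * zL (ln n%:R)
    & (#|Dset s t H|)%:R = formula s t H d.
  apply: (core cx (expR_nuL a0 b0 e0 he hL) st sH).
  - by move=> j; rewrite /nr -(sbar_lam cx); apply: K_le; exact: hs.
  - by move=> j; rewrite /nr -(sbar_lam cx); apply: K_le; exact: ht.
  - by move=> j; apply: K_le; exact: hx.
  - by move=> j; apply: K_le; exact: hy.
  - exact: (K_le2 a0 b0 e0 he hL nL hX).
exists d; split=> //; apply: le_trans hd _.
exact: (nuLzL_le a0 b0 e0 he hL).
Qed.
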